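(* There is an algorithm that solves each instance $(G,k,\mathcal{X},\mathcal{U})$ of Set-Restricted Totally Disjoint Paths, where $G$ is a connected well-partitioned chordal graph on $n$ vertices given along with a partition tree $\mathcal{T}$, in time $2^{\mathcal{O}(k\log k)}\cdot n$.
   Context: All graphs are finite, simple and undirected. A connected graph $G$ is a well-partitioned chordal graph if there exist a partition $\mathcal{P}$ of $V(G)$ and a tree $\mathcal{T}$ with vertex set $\mathcal{P}$ such that: (i) each part $X\in\mathcal{P}$ is a clique in $G$; (ii) for each edge $XY\in E(\mathcal{T})$ there are $X'\subseteq X$ and $Y'\subseteq Y$ such that the edges of $G$ between $X$ and $Y$ are exactly the pairs $xy$ with $x\in X'$, $y\in Y'$; (iii) for distinct $X,Y\in\mathcal{P}$ with $XY\notin E(\mathcal{T})$, there are no edges of $G$ between $X$ and $Y$. Such a $\mathcal{T}$ is a partition tree of $G$. Two paths, an $(s_1,t_1)$-path $P_1$ and an $(s_2,t_2)$-path $P_2$, are internally vertex-disjoint if for $i\in\{1,2\}$, $(V(P_i)\setminus\{s_i,t_i\})\cap V(P_{3-i})=\emptyset$. Set-Restricted Totally Disjoint Paths: the input is a graph $G$, a set $\mathcal{X}=\{(s_1,t_1),\dots,(s_k,t_k)\}$ of $k$ pairs of vertices of $G$ (terminals; different indices may have the same pair), and $\mathcal{U}=\{U_1,\dots,U_k\}$ of $k$ vertex subsets of $G$ (domains). The question is whether $G$ contains $k$ pairwise distinct and internally vertex-disjoint paths $P_1,\dots,P_k$ such that for each $i\in\{1,\dots,k\}$, $P_i$ is an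 $(s_i,t_i)$-path with $V(P_i)\subseteq U_i$. (In particular, if $\{s_i,t_i\}=\{s_j,t_j\}$ with $i\ne j$, the single edge $s_it_i$ may be used as at most one of $P_i,P_j$.) *)

(* Defs.v *)
From mathcomp Require Import all_boot.

Set Implicit Arguments.
Unset Strict Implicit.
Unset Printing Implicit Defensive.

(** * Graphs *)

Record sgraph (V : finType) := SGraph {
  adj :> rel V;
  adj_sym : symmetric adj;
  adj_irr : irreflexive adj
}.

Definition connected (V : finType) (G : sgraph V) : Prop :=
  0 < #|V| /\ forall x y : V, connect G x y.

Definition clique (V : finType) (G : sgraph V) (A : {set V}) : Prop :=
  {in A &, forall x y, x != y -> G x y}.

(* [ucycle G [:: x; y]] holds whenever [G x y], hence the bound 3. *)
Definition acyclic (V : finType) (G : sgraph V) : Prop :=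
  forall c : seq V, ucycle G c -> size c < 3.

Definition tree (V : finType) (G : sgraph V) : Prop :=
  connected G /\ acyclic G.

(** * Well-partitioned chordal graphs *)

(* The tree has as nodes the indices in [I] of the parts; [bag] is the
   bijection from [I] onto the partition. *)
Definition partition_tree (V I : finType) (G : sgraph V)
    (bag : I -> {set V}) (T : sgraph I) : Prop :=
  [/\ injective bag /\ partition [set bag a | a : I] [set: V],
      tree T,
      forall a, clique G (bag a),
      forall a b, T a b ->
        exists X' Y' : {set V},
          [/\ X' \subset bag a, Y' \subset bag b &
              {in bag a & bag b, forall x y,
                 G x y = (x \in X') && (y \in Y')}]
    & forall a b, a != b -> ~~ T a b ->
        {in bag a & bag b, forall x y, ~~ G x y}].

Definition well_partitioned_chordal (V : finType) (G : sgraph V) : Prop :=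
  connected G /\
  exists (p : nat) (bag : 'I_p -> {set V}) (T : sgraph 'I_p),
    partition_tree G bag T.

(** * Set-Restricted Totally Disjoint Paths *)

(* A path is given by the sequence of all its vertices. *)
Definition is_path (V : finType) (G : sgraph V) (s t : V) (P : seq V) : bool :=
  if P is x :: q then [&& x == s, last x q == t, path G x q & uniq P]
  else false.

Definition internally_avoids (V : finType) (s t : V) (P Q : seq V) : Prop :=
  forall v, v \in P -> v != s -> v != t -> v \notin Q.

(* Paths are subgraphs: a sequence and its reversal are the same path. *)
Definition same_path (V : finType) (P Q : seq V) : Prop :=
  P = Q \/ P = rev Q.

Definition totally_disjoint_paths (V : finType) (G : sgraph V) (k : nat)
    (s t : 'I_k -> V) (U : 'I_k -> {set V}) : Prop :=
  exists P : 'I_k -> seq V,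
    (forall i, is_path G (s i) (t i) (P i) /\ {subset P i <= U i}) /\
    (forall i j, i != j ->
       ~ same_path (P i) (P j) /\
       internally_avoids (s i) (t i) (P i) (P j)).

(** * Word RAM

    Structured programs over a word RAM: finitely many registers, a memory
    with indirect addressing, and words of [w] bits. An elementary operation
    costs one unit. *)

Inductive binop := Add | Sub | Mul | Div | Mod | Lt | Eq.

Inductive expr :=
  | Const of nat
  | Reg of nat
  | Read of expr
  | Op of binop & expr & expr.

Inductive cmd :=
  | Skip
  | Assign of nat & expr
  | Write of expr & expr            (* address, value *)
  | Seq of cmd & cmd
  | If of expr & cmd & cmd
  | While of expr & cmd.

Record state := State { regs : nat -> nat; ram : nat -> nat }.

(* [Sub] is truncated, division by zero yields 0, comparisons yield 0 or 1. *)
Definition binop_sem (o : binop) (a b : nat) : nat :=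
  match o with
  | Add => a + b
  | Sub => a - b
  | Mul => a * b
  | Div => a %/ b
  | Mod => a %% b
  | Lt => a < b
  | Eq => a == b
  end.

Fixpoint eval (w : nat) (st : state) (e : expr) : nat :=
  match e with
  | Const c => c %% 2 ^ w
  | Reg x => regs st x
  | Read a => ram st (eval w st a)
  | Op o a b => binop_sem o (eval w st a) (eval w st b) %% 2 ^ w
  end.

Fixpoint cost (e : expr) : nat :=
  match e with
  | Const _ | Reg _ => 1
  | Read a => (cost a).+1
  | Op _ a b => (cost a + cost b).+1
  end.

(* [exec w c st t st']: started in [st], the program [c] halts in state [st']
   after [t] time units. *)
Inductive exec (w : nat) : cmd -> state -> nat -> state -> Prop :=
  | ExecSkip st : exec w Skip st 1 st
  | ExecAssign st x e :
      exec w (Assign x e) st (cost e).+1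
        (State [eta regs st with x |-> eval w st e] (ram st))
  | ExecWrite st a e :
      exec w (Write a e) st (cost a + cost e).+1
        (State (regs st) [eta ram st with eval w st a |-> eval w st e])
  | ExecSeq c1 c2 st1 st2 st3 t1 t2 :
      exec w c1 st1 t1 st2 -> exec w c2 st2 t2 st3 ->
      exec w (Seq c1 c2) st1 (t1 + t2) st3
  | ExecIf e c1 c2 st st' t :
      exec w (if eval w st e != 0 then c1 else c2) st t st' ->
      exec w (If e c1 c2) st (cost e + t).+1 st'
  | ExecWhileEnd e c st :
      eval w st e = 0 -> exec w (While e c) st (cost e).+1 st
  | ExecWhileStep e c st1 st2 st3 t1 t2 :
      eval w st1 e <> 0 ->
      exec w c st1 t1 st2 -> exec w (While e c) st2 t2 st3 ->
      exec w (While e c) st1 (cost e + t1 + t2).+1 st3.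

Definition init (input : seq nat) : state :=
  State (fun=> 0) (nth 0 input).

(** * Encoding of instances *)

(* Array of blocks of varying length, with random access: a table of the start
   positions of the blocks, relative to the start of the table itself and
   followed by the end position, then the blocks. *)
Definition pack (bs : seq (seq nat)) : seq nat :=
  let h := (size bs).+1 in
  [seq h + sumn (take i (shape bs)) | i <- iota 0 h] ++ flatten bs.

Definition ord_list (n : nat) (A : {pred 'I_n}) : seq nat :=
  [seq val x | x <- enum A].

(* The set X' (up to the degenerate case of no edges) of the edge ab of a
   partition tree; Y' is [boundary G bag b a]. *)
Definition boundary (V I : finType) (G : sgraph V) (bag : I -> {set V})
    (a b : I) : {set V} :=
  [set x in bag a | [exists y in bag b, G x y]].

(* The blocks are: the sizes; the adjacency matrix of G by rows; the bags; the
   adjacency lists of the tree, and in parallel to them the boundaries of the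
   bag towards each neighbouring bag; the terminals s_i; the terminals t_i;
   the domains. *)
Definition encode (n p k : nat) (G : sgraph 'I_n)
    (bag : 'I_p -> {set 'I_n}) (T : sgraph 'I_p)
    (s t : 'I_k -> 'I_n) (U : 'I_k -> {set 'I_n}) : seq nat :=
  pack
    [:: [:: n; p; k];
        pack [seq [seq nat_of_bool (G x y) | y <- enum 'I_n] | x <- enum 'I_n];
        pack [seq ord_list (bag a) | a <- enum 'I_p];
        pack [seq ord_list (T a) | a <- enum 'I_p];
        pack [seq pack [seq ord_list (boundary G bag a b)
                           | b <- enum (T a)]
                 | a <- enum 'I_p];
        [seq val (s i) | i <- enum 'I_k];
        [seq val (t i) | i <- enum 'I_k];
        pack [seq ord_list (U i) | i <- enum 'I_k]].

(* Main.v *)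
Require Import Defs.
From mathcomp Require Import all_boot.
From mathcomp Require Import zify.

(** Root the partition tree. In a solution, a path between non-adjacent ends
    must cross exactly the tree edges that separate the bags of its ends, and
    it crosses such an edge from one boundary to the other. Conversely, since
    the bags are cliques and the edges between two adjacent bags join all
    boundary vertices, one vertex chosen on each side of every edge to be
    crossed already connects the two ends ([path_cross], [connect_crossings]).
    So a long path is nothing but a choice, bag by bag, of a vertex in the
    boundary towards each crossed edge: a slot. Choices in different bags do
    not interact. A path between adjacent ends is the edge itself or can be
    shortened to one inner vertex, a common neighbour of its ends ([shortcut]);
    call it a middle. At most one of the paths with the same adjacent ends
    uses the edge. This gives [solution_of_middles] and [middles_of_solution].

    All that remains is to choose distinct vertices from lists, and long lists
    are harmless: if fewer than [M] entries of a list can be taken by other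
    paths, the list can be cut after its first [M] entries ([truncate_lists]).
    A crossed edge is determined by an end of the path and a depth
    ([slot_anc]), so a path has at most 3 slots in a bag, and at most 12 slot
    vertices among the common neighbours of two given vertices. Hence
    [M = 16 k + 16] suffices, for the middles as well as for the slots, and
    the problem becomes a search over digits ([solution_digits]): one digit in
    [0 .. M] for each path, and for every outcome, independently in each bag,
    one digit below [M] for each of the at most [3 k] slots. That is
    [2 ^ O(k log k)] rounds, each of cost polynomial in [k] and linear in the
    sizes of the bag and of its adjacency list; the total is linear in [n]
    because the bags partition the vertices and the degrees in a tree with [p]
    vertices add up to less than [2 p], where [p <= n].

    The program is written in a structured language with counted loops and
    arrays over [nat], which is translated to the word machine ([run_exec]).
    Words are only assumed to be logarithmic in the input length, which is too
    little for a number of the order of [M ^ k]; the search therefore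
    increments an array of digits ([Odometer]). Breadth-first search roots the
    tree ([RootTree]), and the edges crossed by a path are found by flipping
    one bit per bag on the way from each of its two ends to the root
    ([MarkCrossings]). *)

Set Implicit Arguments.
Unset Strict Implicit.
Unset Printing Implicit Defensive.

(** * Rooted trees *)

Lemma fconnect_step (I : finType) (f : I -> I) x y :
  fconnect f x y = (x == y) || fconnect f (f x) y.
Proof.
apply/idP/orP => [h|[/eqP->//|h]]; last exact: connect_trans (fconnect1 f x) h.
rewrite -(iter_findex h); case: (findex f x y) => [|m]; first by left.
by right; rewrite iterSr fconnect_iter.
Qed.

(** A tree given by parent pointers; the depths [dep] witness that they lead to
    the root. *)
Record rooted (I : finType) (T : sgraph I) (par : I -> I) (r0 : I)
    (dep : I -> nat) : Prop := Rooted {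
  par_root : par r0 = r0;
  dep_root : dep r0 = 0;
  par_edge : forall c, c != r0 -> T c (par c);
  par_dep : forall c, c != r0 -> dep c = (dep (par c)).+1 }.

Section RootedTree.
Variables (I : finType) (T : sgraph I) (par : I -> I) (r0 : I) (dep : I -> nat).
Hypothesis Tac : acyclic T.
Hypothesis Rt : rooted T par r0 dep.

Definition anc c b := fconnect par b c.

Lemma anc_step c b : anc c b = (b == c) || anc c (par b).
Proof. exact: fconnect_step. Qed.

Lemma anc_refl c : anc c c. Proof. exact: connect0. Qed.

(** Otherwise the tree without the edge [x y] would still contain the paths from
    [x] and [y] to the root, hence a path from [x] to [y] that the edge closes
    to a cycle. *)
Lemma tree_edge_par x y : T x y -> x = par y \/ y = par x.
Proof.
move=> xy.
have nxy : x != y by apply/eqP => E; rewrite E adj_irr in xy.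
case: (x =P par y) => [|/eqP n1]; [by left|case: (y =P par x) => [|/eqP n2]; [by right|exfalso]].
(* [e] is the tree without the edge between [x] and [y]. *)
pose e := [rel u v | [&& T u v, (u, v) != (x, y) & (u, v) != (y, x)]].
have es : symmetric e.
  move=> u v /=; rewrite adj_sym; congr (_ && _).
  by rewrite !xpair_eqE andbC (andbC (v == x)) (andbC (v == y)).
have up m c : dep c = m -> connect e c r0.
  elim: m c => [|m IH] c dc; case: (c =P r0) => [->|/eqP nc] //.
    by rewrite (par_dep Rt nc) in dc.
  apply: connect_trans (IH (par c) _); last by move: dc; rewrite (par_dep Rt nc) => -[].
  apply: connect1 => /=; rewrite (par_edge Rt nc) !xpair_eqE /=.
  apply/andP; split; apply: contraTN isT => /andP[/eqP E1 /eqP E2].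
  - by rewrite -E1 -E2 eqxx in n2.
  - by rewrite -E1 -E2 eqxx in n1.
have /connectP[p0 pp lp] : connect e x y.
  apply: connect_trans (up _ x erefl) _.
  by rewrite (sym_connect_sym es); apply: up erefl.
case/shortenP: pp lp => p pp up' _ lp.
have pT : path T x p by apply: sub_path pp => u v /and3P[].
have : ucycle T (x :: p).
  by rewrite /ucycle up' /= rcons_path pT -lp adj_sym xy.
move/Tac.
case: p pp lp {pT up'} => [|z [|z' p]] //=.
  by move=> _ E; rewrite E eqxx in nxy.
by move=> /andP[/and3P[_ n _] _] E; rewrite E eqxx in n.
Qed.

(** The part of the tree below [c] can be left only from [c] to its parent. *)
Lemma anc_cross c x y : T x y -> anc c x -> ~~ anc c y -> x = c /\ y = par c.
Proof.
move=> xy ax ay; case: (tree_edge_par xy) => E.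
  by rewrite anc_step -E ax orbT in ay.
by move: ax; rewrite anc_step -E (negPf ay) orbF => /eqP Ex; rewrite -Ex.
Qed.

Lemma dep0 x : dep x = 0 -> x = r0.
Proof. by case: (x =P r0) => // /eqP h; rewrite (par_dep Rt h). Qed.

Lemma dep_iter m b : dep (iter m par b) = dep b - m.
Proof.
elim: m => [|m IH] /=; first by rewrite subn0.
case: (iter m par b =P r0) => [E|/eqP n].
  by move: IH; rewrite E (par_root Rt) (dep_root Rt); lia.
by move: IH; rewrite (par_dep Rt n); lia.
Qed.

Lemma anc_dep c b : anc c b -> dep c <= dep b /\ c = iter (dep b - dep c) par b.
Proof.
move=> h; rewrite -(iter_findex h); move: (findex par b c) => m {h c}.
rewrite dep_iter; split; first by lia.
case: (leqP m (dep b)) => h; first by rewrite subKn.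
have -> : dep b - m = 0 by lia.
by rewrite subn0 [LHS]dep0 1?[RHS]dep0 ?dep_iter //; lia.
Qed.

Lemma anc_root b : anc r0 b.
Proof.
move: {-1}(dep b) (erefl (dep b)) => m; elim: m b => [|m IH] b db.
  by rewrite (dep0 db) anc_refl.
case: (b =P r0) => [->|/eqP nb]; first exact: anc_refl.
by rewrite anc_step IH ?orbT //; move: db; rewrite (par_dep Rt nb) => -[].
Qed.

Lemma anc_top a b : anc a b -> dep b <= dep a -> a = b.
Proof.
by move=> /anc_dep[h E] h2; rewrite E; have -> : dep b - dep a = 0 by lia.
Qed.

Lemma par_nanc c : c != r0 -> ~~ anc c (par c).
Proof.
by move=> nc; apply/negP => /anc_dep[+ _]; rewrite (par_dep Rt nc) ltnn.
Qed.

(** Tree edges are indexed by their end farther from the root. *)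
Definition lower_end b c := if par b == c then b else c.

Lemma lower_end_par b c : T b c -> [\/ par b = c /\ lower_end b c = b | par c = b /\ lower_end b c = c].
Proof.
rewrite /lower_end => bc; case: (par b =P c) => h; first by left.
by right; split=> //; case: (tree_edge_par bc) => E //; rewrite E in h.
Qed.

Lemma lower_end_root b c : T b c -> lower_end b c != r0.
Proof.
move=> bc; apply/eqP => E.
case: (lower_end_par bc) => -[h1 h2]; rewrite h2 in E; subst;
by rewrite (par_root Rt) adj_irr in bc.
Qed.

Lemma lower_end_sides b c : T b c -> anc (lower_end b c) b != anc (lower_end b c) c.
Proof.
move=> bc; have := lower_end_root bc.
case: (lower_end_par bc) => -[h1 ->] /par_nanc; rewrite h1 anc_refl.
- by move/negPf->.
- by move/negPf->.
Qed.

(** The vertices met on the way to the root have distinct depths. *)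
Lemma dep_lt b : dep b < #|I|.
Proof.
pose f (i : 'I_(dep b).+1) := iter i par b.
have inj : injective f.
  move=> i j E; apply: val_inj; have := congr1 dep E.
  rewrite !dep_iter; move: (ltn_ord i) (ltn_ord j) => /=.
  move: (dep b) (nat_of_ord i) (nat_of_ord j) => x y z; clear; lia.
by have := max_card (mem (codom f)); rewrite card_codom // card_ord.
Qed.

(** Every edge joins a vertex to its parent and is counted from two sides. *)
Lemma sum_degrees : \sum_(b : I) #|T b| <= 2 * #|I|.
Proof.
have -> : \sum_(b : I) #|T b| = #|[set q : I * I | T q.1 q.2]|.
  rewrite -sum1_card; under eq_bigr do rewrite -sum1_card.
  by rewrite pair_big_dep /=; apply: eq_bigl => -[b c]; rewrite inE.
pose f (q : bool * I) := if q.1 then (q.2, par q.2) else (par q.2, q.2).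
apply: (@leq_trans #|[set f q | q : bool * I]|); last first.
  by apply: leq_trans (leq_imset_card _ _) _; rewrite card_prod card_bool.
apply: subset_leq_card; apply/subsetP => -[b c]; rewrite inE /= => bc.
apply/imsetP; case: (tree_edge_par bc) => ->.
- by exists (false, c).
- by exists (true, b).
Qed.

End RootedTree.

(** * Paths in a well-partitioned chordal graph *)

Section WellPartitioned.
Variables (V I : finType) (G : sgraph V) (bag : I -> {set V}) (T : sgraph I).
Hypothesis PT : partition_tree G bag T.
Variable bg : V -> I.
Hypothesis bgP : forall v a, (v \in bag a) = (a == bg v).

Lemma bag_clique u v : bg u = bg v -> u != v -> G u v.
Proof.
move=> E n; case: PT => _ _ h _ _; apply: (h (bg u)) => //; rewrite bgP //.
by rewrite E.
Qed.

Lemma adj_bg u v : G u v -> bg u != bg v -> T (bg u) (bg v).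
Proof.
move=> uv n; case: PT => _ _ _ _ h; apply: contraTT uv => nT.
by apply: h nT _ _ _ _ => //; rewrite bgP.
Qed.

Lemma in_boundary a b x :
  (x \in boundary G bag a b) = (bg x == a) && [exists y, (bg y == b) && G x y].
Proof.
rewrite inE bgP eq_sym; congr (_ && _).
by apply: eq_existsb => y; rewrite bgP eq_sym.
Qed.

(** All edges between the two bags are pairs in some [X' * Y'], and then the
    boundaries are contained in [X'] and [Y']. *)
Lemma boundary_complete a b x y : T a b ->
  x \in boundary G bag a b -> y \in boundary G bag b a -> G x y.
Proof.
move=> ab; rewrite !in_boundary.
move=> /andP[/eqP xa /existsP[y' /andP[/eqP yb' xy']]].
move=> /andP[/eqP yb /existsP[x' /andP[/eqP xa' yx']]].
case: PT => _ _ _ h _; case: (h a b ab) => X' [Y' [_ _ hXY]].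
have bb z : z \in bag (bg z) by rewrite bgP.
move: (bb x) (bb x') (bb y) (bb y'); rewrite xa xa' yb yb' => ix ix' iy iy'.
rewrite hXY //; move: xy'; rewrite hXY // => /andP[-> _].
by move: yx'; rewrite adj_sym hXY // => /andP[].
Qed.

Lemma adj_boundary x y : G x y -> x \in boundary G bag (bg x) (bg y).
Proof.
by move=> xy; rewrite in_boundary eqxx; apply/existsP; exists y; rewrite eqxx.
Qed.

Variables (par : I -> I) (r0 : I) (dep : I -> nat).
Hypothesis Rt : rooted T par r0 dep.

Let Tac : acyclic T. Proof. by case: PT => _ []. Qed.

Local Notation anc := (anc par).
Local Notation bd := (boundary G bag).

(** Edges of [G] between different bags follow edges of the tree, so the path
    leaves or enters the part of the tree below [c] along the edge at [c]. *)
Lemma path_cross c x q : path G x q -> anc c (bg x) != anc c (bg (last x q)) ->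
  exists u v, [/\ u \in x :: q, v \in x :: q, u \in bd c (par c) &
                  v \in bd (par c) c].
Proof.
elim: q x => [|y q IH] x /=; first by rewrite eqxx.
move=> /andP[xy yq]; case: (eqVneq (anc c (bg x)) (anc c (bg y))) => [->|n _].
  move=> /(IH y yq)[u [v [hu hv h1 h2]]]; exists u, v.
  by split=> //; rewrite in_cons ?hu ?hv orbT.
have nb : bg x != bg y by apply: contraNneq n => ->.
have Txy := adj_bg xy nb.
case ax : (anc c (bg x)) n; case ay : (anc c (bg y)) => // _.
  case: (anc_cross Tac Rt Txy ax (negbT ay)) => Ex Ey.
  exists x, y; rewrite !in_cons !eqxx ?orbT -Ey -Ex; split=> //; first exact: adj_boundary.
  by apply: adj_boundary; rewrite adj_sym.
have Tyx : T (bg y) (bg x) by rewrite adj_sym.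
case: (anc_cross Tac Rt Tyx ay (negbT ax)) => Ey Ex.
exists y, x; rewrite !in_cons !eqxx ?orbT -Ex -Ey; split=> //; last exact: adj_boundary.
by apply: adj_boundary; rewrite adj_sym.
Qed.

(** A converse of [path_cross], and the reason why the bags can be treated
    separately: from the deeper of [x] and [y], go to the chosen vertex [u] of
    its bag, which is a clique, then to the chosen vertex [v] of the parent bag,
    which is adjacent to [u] because both are in the boundary. *)
Lemma connect_crossings (S : {set V}) x y : x \in S -> y \in S ->
  (forall c, c != r0 -> anc c (bg x) != anc c (bg y) ->
     exists u v, [/\ u \in S, v \in S, u \in bd c (par c) & v \in bd (par c) c]) ->
  connect [rel u v | [&& G u v, u \in S & v \in S]] x y.
Proof.
set e := [rel u v | _].
have es : symmetric e by move=> u v /=; rewrite adj_sym; congr (_ && _); exact: andbC.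
move: {-1}(dep (bg x) + dep (bg y)) (leqnn (dep (bg x) + dep (bg y))) => m.
have same u v : u \in S -> v \in S -> bg u = bg v -> connect e u v.
  move=> hu hv E; case: (eqVneq u v) => [->|n] //; apply: connect1.
  by rewrite /= hu hv (bag_clique E n).
elim: m x y => [|m IH] x y dm hx hy cr.
  have d1 : dep (bg x) = 0 by lia.
  have d2 : dep (bg y) = 0 by lia.
  by apply: (same x y hx hy); rewrite (dep0 Rt d1) (dep0 Rt d2).
case: (eqVneq (bg x) (bg y)) => [|nxy]; first exact: same.
wlog le : x y hx hy cr dm nxy / dep (bg y) <= dep (bg x).
  move=> wl; case: (leqP (dep (bg y)) (dep (bg x))) => h; first exact: wl.
  rewrite (sym_connect_sym es); apply: wl => //; last by rewrite ltnW.
  - by move=> c hc; rewrite eq_sym => /(cr c hc).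
  - by rewrite addnC.
  - by rewrite eq_sym.
have nr : bg x != r0.
  apply: contraNneq nxy => E; rewrite E (dep_root Rt) in le.
  by rewrite E eq_sym; apply/eqP; apply: (dep0 Rt); lia.
have nay : ~~ anc (bg x) (bg y).
  by apply: contra nxy => h; apply/eqP/(anc_top Rt h le).
case: (cr (bg x) nr _) => [|u [v [hu hv bu bv]]].
  by rewrite anc_refl (negPf nay).
have bgu : bg u = bg x by move: bu; rewrite in_boundary => /andP[/eqP].
have bgv : bg v = par (bg x) by move: bv; rewrite in_boundary => /andP[/eqP].
apply: connect_trans (same x u hx hu (esym bgu)) _.
apply: (@connect_trans _ _ v).
  apply: connect1; rewrite /= hu hv !andbT.
  exact: boundary_complete (par_edge Rt nr) bu bv.
apply: IH => //; first by rewrite bgv -ltnS -addSn -(par_dep Rt nr).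
move=> c hc hcr; apply: cr => //.
rewrite anc_step; case: (eqVneq (bg x) c) => [E|_]; last by rewrite -bgv.
by move: hcr; rewrite -E bgv (negPf (par_nanc Rt nr)) (negPf nay).
Qed.

(** Before it enters [b], the path is on the side of [a], so it goes through
    the boundary of [a] towards [b]. *)
Lemma edge_cross a b x q : T a b -> path G x q -> bg (last x q) = b ->
  bg x = a \/ (bg x != b /\ T a (bg x)) ->
  exists u, [/\ u \in x :: q, bg u = a & u \in bd a b].
Proof.
move=> ab pq lb ha.
pose c := lower_end par a b.
have sides : anc c a != anc c b by exact: (lower_end_sides Tac Rt ab).
have sx : anc c (bg x) = anc c a.
  case: ha => [->//|[nb Tax]].
  apply/eqP/negPn/negP => n.
  have E : (a = c /\ bg x = par c) \/ (bg x = c /\ a = par c).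
    case ax : (anc c (bg x)) n; case aa : (anc c a) => // _.
    - right; have Txa : T (bg x) a by rewrite adj_sym.
      exact: (anc_cross Tac Rt Txa ax (negbT aa)).
    - left; exact: (anc_cross Tac Rt Tax aa (negbT ax)).
  case/negP: nb; apply/eqP.
  move: E; rewrite /c; case: (lower_end_par Tac Rt ab) => -[h1 ->] [[h2 h3]|[h2 h3]].
  - by rewrite h3.
  - by rewrite h2 in Tax; rewrite adj_irr in Tax.
  - by rewrite h2 in ab; rewrite adj_irr in ab.
  - exact: h2.
case: (path_cross (c := c) pq); first by rewrite sx lb.
move=> u [v [hu hv bu bv]].
have bgu : bg u = c by move: bu; rewrite in_boundary => /andP[/eqP].
have bgv : bg v = par c by move: bv; rewrite in_boundary => /andP[/eqP].
move: bgu bgv bu bv; rewrite /c; case: (lower_end_par Tac Rt ab) => -[h1 ->].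
- by rewrite h1 => *; exists u.
- by rewrite h1 => *; exists v.
Qed.

(** A path between adjacent vertices that is not the edge between them can be
    replaced by a path with one inner vertex. *)
Lemma shortcut x y P : G x y -> is_path G x y P ->
  (exists2 v, v \in P & (v != x) && (v != y)) ->
  exists w, [/\ w \in P, w != x, w != y, G x w & G y w].
Proof.
move=> xy; case: P => // x' q /and4P[/eqP-> {x'} /eqP lq pq uq] [v0 hv0 /andP[n0 n1]].
have nxy : x != y by apply: contraTneq xy => ->; rewrite adj_irr.
case: q lq pq uq hv0 => [/= E|z q /= lq /andP[xz zq] /andP[nx /andP[nz uq]] hv0].
  by rewrite E eqxx in nxy.
have nzy : z != y.
  apply: contraTneq hv0 => E; move: lq; rewrite E.
  case: q {zq nx uq} nz => [|z' q] nz; first by rewrite !inE (negPf n0) (negPf n1).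
  by move=> /= l; move: nz; rewrite E -{1}l mem_last.
have nzx : z != x by apply: contraNneq nx => ->; rewrite mem_head.
have inq u : u \in z :: q -> (u \in x :: z :: q) && (u != x).
  by move=> hu; rewrite inE hu orbT; apply: contraNneq nx => <-.
have yx : G y x by rewrite adj_sym.
case: (eqVneq (bg x) (bg y)) => [Exy|nbxy].
- (* The detour has a vertex in the bag of its ends, or comes back to it
     through the boundary. *)
  have good u : u \in z :: q -> u != y -> bg u = bg x ->
      exists w, [/\ w \in x :: z :: q, w != x, w != y, G x w & G y w].
    move=> /inq/andP[h1 h2] h3 h4; exists u; split=> //; apply: bag_clique => //.
    - by rewrite eq_sym. - by rewrite h4. - by rewrite eq_sym.
  case: (eqVneq (bg z) (bg x)) => [Ez|nbz]; first by apply: (good z) => //; rewrite mem_head.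
  have Tzx : T (bg z) (bg x) by apply: adj_bg nbz; rewrite adj_sym.
  case: (boolP (y \in bd (bg x) (bg z))) => hy.
    exists z; split=> //; first by rewrite inE mem_head orbT.
    apply: boundary_complete (_ : T (bg x) (bg z)) hy _; first by rewrite adj_sym.
    by apply: adj_boundary; rewrite adj_sym.
  have lb : bg (last z q) = bg x by rewrite lq Exy.
  have pc : anc (lower_end par (bg x) (bg z)) (bg z) != anc (lower_end par (bg x) (bg z)) (bg (last z q)).
    by rewrite lb eq_sym; apply: (lower_end_sides Tac Rt); rewrite adj_sym.
  have Txz : T (bg x) (bg z) by rewrite adj_sym.
  case: (path_cross zq pc) => u [v [hu hv]].
  have use w : w \in z :: q -> w \in bd (bg x) (bg z) ->
      exists w, [/\ w \in x :: z :: q, w != x, w != y, G x w & G y w].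
    move=> hw bw; apply: (good w) => //; first by apply: contraNneq hy => <-.
    by move: bw; rewrite in_boundary => /andP[/eqP].
  case: (lower_end_par Tac Rt Txz) => -[h1 ->]; rewrite h1 => bu bv.
  + exact: use hu bu.
  + exact: use hv bv.
- have Txy := adj_bg xy nbxy.
  have Tyx : T (bg y) (bg x) by rewrite adj_sym.
  have bx := adj_boundary xy; have by_ := adj_boundary yx.
  have goodx u : u \in z :: q -> bg u = bg x -> u \in bd (bg x) (bg y) ->
      exists w, [/\ w \in x :: z :: q, w != x, w != y, G x w & G y w].
    move=> /inq/andP[h1 h2] h3 h4; exists u; split=> //.
    + by apply: contraNneq nbxy => <-; rewrite h3.
    + by apply: bag_clique; rewrite // eq_sym.
    + exact: boundary_complete Tyx by_ h4.
  case: (eqVneq (bg z) (bg y)) => [Ez|nz'].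
    exists z; split=> //; first by rewrite inE mem_head orbT.
    by apply: bag_clique; rewrite // eq_sym.
  case: (@edge_cross (bg x) (bg y) z q Txy zq) => [||u [hu h1 h2]].
  + by rewrite lq.
  + case: (eqVneq (bg z) (bg x)) => [->|n]; [by left|right; split=> //].
    by apply: adj_bg xz _; rewrite eq_sym.
  + exact: goodx hu h1 h2.
Qed.

End WellPartitioned.

(** * Solutions as choices of middles and slots *)

Section Problem.
Variables (V I : finType) (G : sgraph V) (T : sgraph I) (bag : I -> {set V}).
Variables (par : I -> I) (bg : V -> I) (k : nat) (s t : 'I_k -> V) (U : 'I_k -> {set V}).

(** The paths that have to travel through the tree. *)
Definition long i := (s i != t i) && ~~ G (s i) (t i).

(** The edge from [c] to its parent separates the ends of path [i]. *)
Definition crossed i c :=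
  long i && (anc par c (bg (s i)) != anc par c (bg (t i))).

(** In bag [b], path [i] needs a vertex of the boundary towards [c]. *)
Definition slot i b c := T b c && crossed i (lower_end par b c).

Definition terminal v := [exists i, (v == s i) || (v == t i)].

(** The possible inner vertices of path [i] when its ends are adjacent. *)
Definition middle i v :=
  [&& G (s i) v, G (t i) v, v \in U i & ~~ terminal v].

Definition same_ends i j :=
  (s i == s j) && (t i == t j) || (s i == t j) && (t i == s j).

Definition blocked (g : 'I_k -> option V) v :=
  terminal v || [exists i, g i == Some v].

Definition usable g i v :=
  (v \in U i) && [|| ~~ blocked g v, v == s i | v == t i].

(** [g i = None] stands for a path without inner vertices as well as for a long
    path; two paths of the first kind must not have the same ends. *)
Definition valid_middles (g : 'I_k -> option V) :=
  [/\ forall i, s i \in U i /\ t i \in U i,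
      forall i v, g i = Some v -> G (s i) (t i) /\ middle i v
    & forall i j, i != j -> g i = g j ->
        g i = None /\ ~~ (~~ long i && same_ends i j)].

(** The slots of one path may share a vertex, those of different paths only a
    vertex that is an end of both. *)
Definition valid_slots g b (f : 'I_k -> I -> V) :=
  (forall i c, slot i b c -> f i c \in boundary G bag b c /\ usable g i (f i c)) /\
  (forall i j c d, i != j -> slot i b c -> slot j b d -> f i c = f j d ->
     (f i c == s i) || (f i c == t i)).

Variables (r0 : I) (dep : I -> nat).
Hypothesis PT : partition_tree G bag T.
Hypothesis bgP : forall v a, (v \in bag a) = (a == bg v).
Hypothesis Rt : rooted T par r0 dep.

Let Tac : acyclic T. Proof. by case: PT => _ []. Qed.

Lemma is_path_in i P : is_path G (s i) (t i) P -> s i \in P /\ t i \in P.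
Proof.
case: P => // x q /and4P[/eqP-> /eqP<- _ _].
by rewrite mem_head mem_last.
Qed.

Lemma is_pathP i (S : {set V}) : connect [rel u v | [&& G u v, u \in S & v \in S]] (s i) (t i) ->
  s i \in S -> exists P, is_path G (s i) (t i) P /\ {subset P <= S}.
Proof.
move=> /connectP[q0 pq lq] hs; case/shortenP: pq lq => q pq uq _ lq.
exists (s i :: q); split.
  rewrite /is_path eqxx -lq eqxx uq andbT /=.
  by apply: sub_path pq => u v /andP[].
move=> v; rewrite inE => /orP[/eqP->//|].
elim: q (s i) pq {uq lq hs} => // y q IH x /= /andP[/and3P[_ _ hy] pq].
by rewrite inE => /orP[/eqP->//|]; apply: IH pq.
Qed.

Lemma terminal_s i : terminal (s i). Proof. by apply/existsP; exists i; rewrite eqxx. Qed.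
Lemma terminal_t i : terminal (t i). Proof. by apply/existsP; exists i; rewrite eqxx orbT. Qed.

Lemma slot_bag b c f g i : valid_slots g b f -> slot i b c -> bg (f i c) = b.
Proof. by move=> [h _] /h[]; rewrite (in_boundary G bgP) => /andP[/eqP]. Qed.

(** Path [i] is found inside this set by connectivity, not written down. *)
Definition support g (f : I -> 'I_k -> I -> V) i : {set V} :=
  [set v | [|| v == s i, v == t i, g i == Some v |
     [exists b, exists c, slot i b c && (v == f b i c)]]].

Lemma supportP g f i v : v \in support g f i -> v != s i -> v != t i ->
  g i = Some v \/ exists b c, slot i b c /\ v = f b i c.
Proof.
rewrite inE => h n1 n2; move: h; rewrite (negPf n1) (negPf n2) /=.
case/orP => [/eqP|/existsP[b /existsP[c /andP[h /eqP]]]]; [by left|].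
by right; exists b, c.
Qed.

Lemma slot_long i b c : slot i b c -> long i.
Proof. by case/and3P. Qed.

(** The support of a long path connects its ends by [connect_crossings], and
    supports of different paths meet in terminals only. *)
Lemma solution_of_middles g (f : I -> 'I_k -> I -> V) :
  valid_middles g -> (forall b, valid_slots g b (f b)) ->
  totally_disjoint_paths G s t U.
Proof.
move=> [gU gm gd] fv.
have sub i v : v \in support g f i -> v \in U i.
  move=> hv; case: (eqVneq v (s i)) => [->|n1]; first by case: (gU i).
  case: (eqVneq v (t i)) => [->|n2]; first by case: (gU i).
  case: (supportP hv n1 n2) => [/gm[_ /and4P[]]//|[b [c [h ->]]]].
  by case: (fv b) => + _ => /(_ i c h) [_ /andP[]].
have hs i : s i \in support g f i by rewrite inE eqxx.
have ht i : t i \in support g f i by rewrite inE eqxx orbT.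
have glong i : long i -> g i = None.
  case E : (g i) => [v|] //; case: (gm _ _ E) => h _ /andP[_].
  by rewrite h.
have ex i : exists P, [/\ is_path G (s i) (t i) P, {subset P <= support g f i} &
   (g i <> None \/ long i) -> exists2 v, v \in P & (v != s i) && (v != t i)].
  case E : (g i) => [v|].
    case: (gm _ _ E) => adjst /and4P[sv tv _ nt].
    exists [:: s i; v; t i]; split.
    - rewrite /is_path /= !eqxx sv (adj_sym G v) tv !inE /= andbT.
      have h1 : s i != v by apply: contraNneq nt => <-; apply: terminal_s.
      have h2 : v != t i by apply: contraNneq nt => ->; apply: terminal_t.
      have h3 : s i != t i by apply: contraTneq adjst => ->; rewrite adj_irr.
      by rewrite negb_or h1 h2 h3.
    - by move=> u; rewrite !inE => /or3P[] /eqP->; rewrite ?E ?eqxx ?orbT.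
    - move=> _; exists v; first by rewrite !inE eqxx orbT.
      by apply/andP; split; apply: contraNneq nt => ->; [apply: terminal_s|apply: terminal_t].
  case: (boolP (long i)) => L.
    have [P [h1 h2]] : exists P, is_path G (s i) (t i) P /\ {subset P <= support g f i}.
      apply: is_pathP => //; apply: (connect_crossings PT bgP Rt) => // c nc hc.
      have cr : crossed i c by rewrite /crossed L.
      have chc : lower_end par c (par c) = c by rewrite /lower_end eqxx.
      have Tcp := par_edge Rt nc.
      have Tpc : T (par c) c by rewrite adj_sym.
      have chp : lower_end par (par c) c = c.
        rewrite /lower_end; case: eqP => // E'.
        move: (par_nanc Rt nc); rewrite anc_step E'.
        by rewrite anc_refl orbT.
      have s1 : slot i c (par c) by rewrite /slot Tcp chc.
      have s2 : slot i (par c) c by rewrite /slot Tpc chp.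
      exists (f c i (par c)), (f (par c) i c).
      have ins b d : slot i b d -> f b i d \in support g f i.
        move=> h; rewrite inE; apply/or4P; apply: Or44.
        by apply/existsP; exists b; apply/existsP; exists d; rewrite h eqxx.
      split; try exact: ins.
      + by case: (fv c) => + _ => /(_ i (par c) s1) [].
      + by case: (fv (par c)) => + _ => /(_ i c s2) [].
    exists P; split=> // _.
    move: h1 L; case: P h2 => // x q _ /and4P[/eqP-> /eqP lq pq uq] /andP[n1 n2].
    case: q lq pq uq => [/= E'|v q lq /andP[sv vq] /andP[nx /andP[nv uq]]].
      by rewrite E' eqxx in n1.
    exists v; first by rewrite !inE eqxx orbT.
    apply/andP; split; first by apply: contraNneq nx => <-; rewrite mem_head.
    by apply: contraNneq n2 => <-.
  exists (if s i == t i then [:: s i] else [:: s i; t i]).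
  move: L; rewrite /long negb_and negbK; case: (eqVneq (s i) (t i)) => [Est|nst] /=.
    move=> _; split; first by rewrite /is_path /= -Est !eqxx.
      by move=> v; rewrite inE => /eqP->.
    by case => //; rewrite Est eqxx.
  rewrite negbK => h; split.
  - by rewrite /= !eqxx h inE nst.
  - by move=> v; rewrite !inE => /orP[] /eqP->; rewrite eqxx ?orbT.
  - by case => //; rewrite h andbF.
have [P PP] := fin_all_exists ex.
have avoid i j v : i != j -> v \in P i -> v != s i -> v != t i -> v \notin P j.
  move=> nij hv n1 n2.
  have [_ h2 _] := PP i; have [_ h2' _] := PP j.
  apply/negP => /h2' hj; move/h2: hv => hi.
  case: (supportP hi n1 n2) => [gi|[b [c [sl Ev]]]].
  - have [_ /and4P[_ _ _ nt]] := gm _ _ gi.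
    have m1 : v != s j by apply: contraNneq nt => ->; apply: terminal_s.
    have m2 : v != t j by apply: contraNneq nt => ->; apply: terminal_t.
    case: (supportP hj m1 m2) => [gj|[b [c [sl Ev]]]].
      by case: (gd i j nij); rewrite gi ?gj.
    case: (fv b) => + _ => /(_ j c sl) [_ /andP[_]].
    rewrite -Ev (negPf m1) (negPf m2) !orbF => /negP[].
    by apply/orP; right; apply/existsP; exists i; rewrite gi.
  - have nb : ~~ blocked g v.
      case: (fv b) => + _ => /(_ i c sl) [_ /andP[_]].
      by rewrite -Ev (negPf n1) (negPf n2) !orbF.
    have nt : ~~ terminal v by apply: contra nb => h; rewrite /blocked h.
    have m1 : v != s j by apply: contraNneq nt => ->; apply: terminal_s.
    have m2 : v != t j by apply: contraNneq nt => ->; apply: terminal_t.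
    case: (supportP hj m1 m2) => [gj|[b' [c' [sl' Ev']]]].
      by case/negP: nb; apply/orP; right; apply/existsP; exists j; rewrite gj.
    have Eb : b' = b by rewrite -(slot_bag (fv b') sl') -Ev' Ev (slot_bag (fv b) sl).
    rewrite Eb in sl' Ev'.
    case: (fv b) => _ /(_ i j c c' nij sl sl').
    rewrite -Ev -Ev' => /(_ erefl).
    by rewrite (negPf n1) (negPf n2).
exists P; split.
  by move=> i; have [h1 h2 _] := PP i; split=> // v /h2/sub.
move=> i j nij; split; last by move=> v hv n1 n2; exact: (avoid i).
have rv v : same_path (P i) (P j) -> (v \in P i) = (v \in P j).
  by case=> ->; rewrite ?mem_rev.
move=> sp; have rvs v := rv v sp.
have [p1 _ in1] := PP i; have [p2 _ in2] := PP j.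
have no1 : ~ (g i <> None \/ long i).
  by move=> /in1[v hv /andP[n1 n2]]; move: (avoid i j v nij hv n1 n2); rewrite -rvs hv.
have no2 : ~ (g j <> None \/ long j).
  move=> /in2[v hv /andP[n1 n2]]; rewrite eq_sym in nij.
  by move: (avoid j i v nij hv n1 n2); rewrite rvs hv.
have gi : g i = None by case: (g i) no1 => // v []; left.
have gj : g j = None by case: (g j) no2 => // v []; left.
case: (gd i j nij); first by rewrite gi gj.
move=> _ /negP[]; apply/andP; split; first by apply/negP => h; apply: no1; right.
have pe l : is_path G (s l) (t l) (P l) -> exists2 q, P l = s l :: q & last (s l) q = t l.
  by case: (P l) => // x q /and4P[/eqP-> /eqP lq _ _]; exists q.
case: (pe i p1) => q Pi lq; case: (pe j p2) => q' Pj lq'.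
apply/orP; case: sp => E; [left|right].
  move: E lq lq'; rewrite Pi Pj => -[-> ->] -> ->.
  by rewrite !eqxx.
have rw x (r r' : seq V) y : x :: r = rev (y :: r') -> x = last y r'.
  by rewrite (lastI y) rev_rcons => -[].
have E' : P j = rev (P i) by rewrite E revK.
move: E E'; rewrite Pi Pj => /rw E1 /rw E2.
by rewrite E1 lq' E2 lq !eqxx.
Qed.

(** A long path has a vertex for each of its slots by [path_cross], and another
    path with inner vertices has a middle by [shortcut]. *)
Lemma middles_of_solution : totally_disjoint_paths G s t U ->
  exists g f, valid_middles g /\ forall b : I, valid_slots g b (f b).
Proof.
move=> [P [hP hd]].
have av i j v : i != j -> v \in P i -> v != s i -> v != t i -> v \notin P j.
  by move=> nij; case: (hd i j nij) => _; apply.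
have ends i : s i \in P i /\ t i \in P i by apply: is_path_in; case: (hP i).
have inner_nt i v : v \in P i -> v != s i -> v != t i -> ~~ terminal v.
  move=> hv n1 n2; apply/existsP => -[j h].
  case: (eqVneq i j) => [E|nij]; first by rewrite -E (negPf n1) (negPf n2) in h.
  have := av i j v nij hv n1 n2; have [h1 h2] := ends j.
  by case/orP: h => /eqP->; rewrite ?h1 ?h2.
pose inn i := [pred w | [&& w \in P i, w != s i & w != t i]].
pose g i := if long i then None else [pick w | [&& inn i w, G (s i) w & G (t i) w]].
have gP i v : g i = Some v -> [/\ v \in P i, v != s i, v != t i & ~~ long i /\ G (s i) v /\ G (t i) v].
  rewrite /g; case: (boolP (long i)) => // L; case: pickP => // w /andP[/= /and3P[h1 h2 h3] /andP[h4 h5]] [<-].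
  by [].
have direct i : ~~ long i -> g i = None -> forall v, v \in P i -> (v == s i) || (v == t i).
  move=> L; rewrite /g (negPf L); case: pickP => // none _ v hv.
  apply/negP => /negP; rewrite negb_or => h.
  have hp := (hP i).1.
  move: L; rewrite negb_and !negbK => /orP[/eqP Est|adjst].
    move: hp hv h; rewrite -Est; case: (P i) => // x q /and4P[/eqP-> /eqP lq _ /andP[nx _]].
    case: q lq nx => [|y q] /= lq nx; first by rewrite inE => ->.
    by rewrite -{1}lq mem_last in nx.
  case: (shortcut PT bgP Rt adjst hp); first by exists v.
  move=> w [h1 h2 h3 h4 h5]; move: (none w).
  by rewrite /= h1 h2 h3 h4 h5.
pose f b i c := odflt (s i) [pick v | (v \in P i) && (v \in boundary G bag b c)].
have fP b i c : slot i b c -> f b i c \in P i /\ f b i c \in boundary G bag b c.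
  move=> /andP[Tbc /andP[L cr]]; rewrite /f; case: pickP => [v /andP[] //|none].
  have [hp _] := hP i; move: hp none; case: (P i) => // x q /and4P[/eqP-> /eqP lq pq _] none.
  rewrite -lq in cr; case: (path_cross PT bgP Rt pq cr) => u [v [hu hv bu bv]].
  case: (lower_end_par Tac Rt Tbc) => -[h1 h2]; rewrite h2 h1 in bu bv.
  - by move: (none u); rewrite hu bu.
  - by move: (none v); rewrite hv bv.
exists g, f; split; [split|].
- by move=> i; have [h1 h2] := ends i; split; apply: (hP i).2.
- move=> i v /gP[h1 h2 h3 [L [h4 h5]]]; split.
    move: L; rewrite negb_and !negbK => /orP[/eqP Est|//].
    have hp := (hP i).1.
    move: hp h1 h2 h3; rewrite -Est; case: (P i) => // x q /and4P[/eqP-> /eqP lq _ /andP[nx _]].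
    case: q lq nx => [|y q] /= lq nx; first by rewrite inE => ->.
    by rewrite -{1}lq mem_last in nx.
  by rewrite /middle h4 h5 (inner_nt i) // andbT (hP i).2.
- move=> i j nij E.
  case gi : (g i) (E) => [v|] E1.
    have [h1 h2 h3 _] := gP i v gi; have [h1' _ _ _] := gP j v (esym E1).
    by move: (av i j v nij h1 h2 h3); rewrite h1'.
  split=> //; apply/negP => /andP[L se].
  have Lj : ~~ long j.
    move: L; rewrite /long; case/orP: se => /andP[/eqP-> /eqP->] //.
    by rewrite eq_sym adj_sym.
  have di := direct i L gi; have dj := direct j Lj (esym E1).
  have [ns _] := hd i j nij; apply: ns.
  have two l : (forall v, v \in P l -> (v == s l) || (v == t l)) ->
      P l = if s l == t l then [:: s l] else [:: s l; t l].
    have := (hP l).1; case: (P l) => // x q /and4P[/eqP-> /eqP lq _ uq] dl.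
    case: q lq uq dl => [|y q] lq uq dl; first by move: lq => /= ->; rewrite eqxx.
    have hy := dl y; rewrite !inE eqxx orbT in hy; move: (hy isT) => {}hy.
    move: uq; rewrite /= inE negb_or => /andP[/andP[nsy nsq] /andP[yq uq]].
    rewrite eq_sym (negPf nsy) /= in hy; move/eqP: hy => hy; rewrite -hy (negPf nsy).
    case: q lq nsq yq uq dl => // z q lq nsq yq _ _.
    by move: lq yq; rewrite /= hy => {1}<-; rewrite mem_last.
  rewrite (two i di) (two j dj); case/orP: se => /andP[/eqP Es /eqP Et].
    by left; rewrite Es Et.
  right; rewrite Es Et eq_sym; case: eqP => [<-//|//].
- move=> b; split.
    move=> i c sl; have [h1 h2] := fP b i c sl; split=> //.
    rewrite /usable (hP i).2 //=.
    case: (eqVneq (f b i c) (s i)) => [|n1]; first by rewrite orbT.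
    case: (eqVneq (f b i c) (t i)) => [|n2]; first by rewrite !orbT.
    rewrite !orbF /blocked negb_or (inner_nt i) //=.
    apply/existsP => -[j /eqP gj].
    have [h3 _ _ [L _]] := gP j _ gj.
    have nij : i != j by apply: contraNneq L => <-; apply: slot_long sl.
    by move: (av i j _ nij h1 n1 n2); rewrite h3.
  move=> i j c d nij si sj E.
  have [h1 h2] := fP b i c si; have [h3 _] := fP b j d sj.
  apply/negP => /negP; rewrite negb_or => /andP[n1 n2].
  by move: (av i j _ nij h1 n1 n2); rewrite E h3.
Qed.

End Problem.

(** * Truncation of the lists *)

Lemma notin_take (V : eqType) M (l : seq V) x : x \in l -> x \notin take M l ->
  size (take M l) = M.
Proof.
move=> h n; rewrite size_take; case: ltnP => // le.
by rewrite take_oversize // h in n.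
Qed.

Lemma count_mem_leq (V : eqType) (l u : seq V) : uniq l ->
  count (mem u) l <= size u.
Proof.
move=> ul; rewrite -size_filter; apply: uniq_leq_size; first exact: filter_uniq.
by move=> v; rewrite mem_filter => /andP[].
Qed.

(** Exchange argument. A representative beyond the first [M] entries of its list
    can be replaced by one of these entries, since fewer than [M] of them are
    excluded by [F] or represent another index. *)
Lemma truncate_lists (V : eqType) (Q : finType) (M : nat) (L : Q -> seq V)
    (D : {set Q}) (F : pred V) (A : Q -> Q -> V -> Prop) (x : Q -> V) :
  (forall q, q \in D -> uniq (L q)) ->
  (forall q, q \in D -> count F (L q) + #|D| <= M) ->
  (forall q, q \in D -> x q \in L q /\ ~~ F (x q)) ->
  (forall q q', q \in D -> q' \in D -> q != q' -> x q = x q' -> A q q' (x q)) ->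
  exists y : Q -> V,
    (forall q, q \in D -> y q \in take M (L q) /\ ~~ F (y q)) /\
    (forall q q', q \in D -> q' \in D -> q != q' -> y q = y q' -> A q q' (y q)).
Proof.
move=> uL cF hx hA.
suff H (r : seq Q) : exists y : Q -> V,
    [/\ forall q, q \in D -> y q \in L q /\ ~~ F (y q),
        forall q, q \in D -> q \in r -> y q \in take M (L q) &
        forall q q', q \in D -> q' \in D -> q != q' -> y q = y q' -> A q q' (y q)].
  case: (H (enum Q)) => y [h1 h2 h3]; exists y; split=> // q hq.
  by split; [apply: h2; rewrite ?mem_enum|case: (h1 q hq)].
elim: r => [|p r [y [h1 h2 h3]]]; first by exists x.
case: (boolP (p \in D)) => hp; last first.
  exists y; split=> // q hq; rewrite inE => /orP[/eqP E|]; last exact: h2.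
  by rewrite -E hq in hp.
case: (boolP (y p \in take M (L p))) => yt.
  exists y; split=> // q hq; rewrite inE => /orP[/eqP->//|]; exact: h2.
have st := notin_take (h1 p hp).1 yt.
pose used := [seq y q | q <- enum (D :\ p)].
have su : size used + 1 = #|D|.
  by rewrite size_map -cardE (cardsD1 p D) hp addnC.
have : has [pred w | ~~ F w && (w \notin used)] (take M (L p)).
  apply: contraT; rewrite -all_predC => al.
  have e : count (predU F (mem used)) (take M (L p)) = M.
    rewrite -{2}st; apply/eqP; rewrite -all_count; apply: sub_all al => w /=.
    by rewrite negb_and !negbK.
  have := count_predUI F (mem used) (take M (L p)); rewrite e.
  have c1 : count (mem used) (take M (L p)) <= size used.
    by apply: count_mem_leq; apply: take_uniq; apply: uL.
  have c2 : count F (take M (L p)) <= count F (L p).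
    by rewrite -{2}(cat_take_drop M (L p)) count_cat leq_addr.
  have c3 := cF p hp; move: (count _ _) c1 c2 c3 su; lia.
case/hasP => w wt /andP[/= nF nu].
exists (fun q => if q == p then w else y q); split.
- move=> q hq; case: eqP => [->|_]; last exact: h1.
  by split=> //; apply: mem_take wt.
- move=> q hq; rewrite inE; case: eqP => [->//|_] /=; exact: h2.
- have nw q : q \in D -> q != p -> w <> y q.
    move=> hq n E; case/negP: nu; rewrite E; apply: map_f.
    by rewrite mem_enum !inE n.
  move=> q q' hq hq' n; case: eqP => [Eq|/eqP nq]; case: eqP => [Eq'|/eqP nq'].
  + by rewrite Eq Eq' eqxx in n.
  + by move/(nw q' hq' nq').
  + by move/esym/(nw q hq nq).
  + exact: h3.
Qed.

Section Truncation.
Variables (V I : finType) (G : sgraph V) (T : sgraph I) (bag : I -> {set V}).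
Variables (par : I -> I) (bg : V -> I) (k : nat) (s t : 'I_k -> V) (U : 'I_k -> {set V}).
Variables (r0 : I) (dep : I -> nat).
Hypothesis PT : partition_tree G bag T.
Hypothesis bgP : forall v a, (v \in bag a) = (a == bg v).
Hypothesis Rt : rooted T par r0 dep.
Variables (x0 : V) (M : nat).
Hypothesis M_big : 13 * k < M.

Let Tac : acyclic T. Proof. by case: PT => _ []. Qed.

Local Notation slot := (slot G T par bg s t).
Local Notation crossed := (crossed G par bg s t).
Local Notation usable := (usable s t U).
Local Notation bd := (boundary G bag).
Local Notation middle := (middle G s t U).
Local Notation valid_middles := (valid_middles G s t U).
Local Notation valid_slots := (valid_slots G T bag par bg s t U).

Definition middles i := [seq v <- enum V | G (s i) (t i) && middle i v].
Definition slot_list g i b c := [seq v <- enum (bd b c) | usable g i v].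

Definition ends i (b : bool) := bg (if b then s i else t i).
(** The ancestor of [x] at depth [d]. *)
Definition anc_at x d := iter (dep x - d) par x.

Lemma dep_adj b c : T b c -> dep b <= (dep c).+1 /\ dep c <= (dep b).+1.
Proof.
move=> bc; case: (lower_end_par Tac Rt bc) => -[h1 h2]; have := lower_end_root Tac Rt bc;
  rewrite h2 => /(par_dep Rt); rewrite h1 => ->; by split; lia.
Qed.

(** A crossed edge lies on the way from one of the two ends to the root, so it
    is determined by this end and by its depth. *)
Lemma slot_anc i b c : slot i b c ->
  exists e, [\/ c = par b /\ b = anc_at (ends i e) (dep b) |
      c = anc_at (ends i e) (dep b).+1 /\ b = par c].
Proof.
case/andP => bc /andP[_ cr].
have [e he] : exists e, anc par (lower_end par b c) (ends i e).
  case h : (anc par (lower_end par b c) (bg (s i))) cr; first by exists true.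
  by case h' : (anc par (lower_end par b c) (bg (t i))) => // _; exists false.
exists e; case: (lower_end_par Tac Rt bc) => -[h1 h2]; rewrite h2 in he.
- by left; split=> //; case: (anc_dep Rt he).
- right; split=> //; case: (anc_dep Rt he) => _ {1}->.
  have := lower_end_root Tac Rt bc; rewrite h2 => nc.
  by rewrite (par_dep Rt nc) h1.
Qed.

Definition bag_slots b : {set 'I_k * I} := [set q | slot q.1 b q.2].

(** The possible slots are towards the parent of [b] and towards the child of
    [b] above either end. *)
Lemma card_bag_slots b : #|bag_slots b| <= 3 * k.
Proof.
pose dec (q : 'I_k * option bool) :=
  (q.1, if q.2 is Some e then anc_at (ends q.1 e) (dep b).+1 else par b).
have sub : bag_slots b \subset [set dec q | q : 'I_k * option bool].
  apply/subsetP => -[i c]; rewrite inE /= => h; apply/imsetP.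
  case: (slot_anc h) => e [[-> _]|[-> _]]; [by exists (i, None)|by exists (i, Some e)].
apply: leq_trans (subset_leq_card sub) _; apply: leq_trans (leq_imset_card _ _) _.
by rewrite card_prod card_ord card_option card_bool mulnC.
Qed.

(** The common neighbours of [s i] and [t i] lie on at most three consecutive
    levels of the tree, and a path has at most four slots on each level: either
    side of the edge, above either end. *)
Lemma count_slot_middles g f i : (forall b, valid_slots g b (f b)) ->
  count [pred v | [exists b, exists j, exists c, slot j b c && (v == f b j c)]]
    (middles i) <= 12 * k.
Proof.
move=> fv; pose a := bg (s i).
pose dec (q : 'I_k * bool * bool * 'I_3) :=
  let: (j, up, e, l) := q in
  let x := ends j e in
  if up then let b := anc_at x (dep a + l).-1 in f b j (par b)
  else let c := anc_at x (dep a + l) in f (par c) j c.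
rewrite -size_filter.
have -> : 12 * k = size [seq dec q | q <- enum {: 'I_k * bool * bool * 'I_3}].
  by rewrite size_map -cardE !card_prod !card_ord card_bool; lia.
apply: uniq_leq_size; first by rewrite filter_uniq // filter_uniq // enum_uniq.
move=> v; rewrite mem_filter mem_filter => /andP[/=].
move=> /existsP[b /existsP[j /existsP[c /andP[sl /eqP Ev]]]] /andP[/andP[_ /and4P[sv _ _ _]] _].
have bv : bg v = b by rewrite Ev; apply: slot_bag bgP _ _ _ _ _ (fv b) sl.
have [l hl] : exists l : 'I_3, dep b + 1 = dep a + l.
  case: (eqVneq a b) => [<-|nab]; first by exists (inord 1); rewrite inordK.
  have /dep_adj[d1 d2] : T a b by rewrite -bv; apply: (adj_bg PT bgP sv); rewrite bv.
  case: (ltngtP (dep a) (dep b)) => h.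
  - by exists (inord 2); rewrite inordK //; lia.
  - by exists (inord 0); rewrite inordK //; lia.
  - by exists (inord 1); rewrite inordK //; lia.
apply/mapP; case: (slot_anc sl) => e [[h1 h2]|[h1 h2]].
- exists (j, true, e, l); first by rewrite mem_enum.
  by rewrite /dec -hl addn1 /= -h2 -h1.
- exists (j, false, e, l); first by rewrite mem_enum.
  by rewrite /dec -hl addn1 /= -h1 -h2.
Qed.

(** The vertices in slots are excluded for the middles, so that the slots stay
    valid when the middles are exchanged. *)
Lemma truncate_middles g f : valid_middles g -> (forall b, valid_slots g b (f b)) ->
  exists g', [/\ valid_middles g', forall b, valid_slots g' b (f b) &
     forall i v, g' i = Some v -> v \in take M (middles i)].
Proof.
move=> gv fv; have [gU gm gd] := gv.
pose D := [set i | g i != None].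
pose F := [pred v | [exists b, exists j, exists c, slot j b c && (v == f b j c)]].
pose x i := odflt (s i) (g i).
have DP i : i \in D -> g i = Some (x i) by rewrite inE /x; case: (g i).
case: (@truncate_lists V 'I_k M middles D F (fun _ _ _ => False) x).
- by move=> i _; rewrite filter_uniq // enum_uniq.
- move=> i _; have := count_slot_middles i fv; have := max_card (mem D).
  rewrite card_ord; move: (count _ _) #|D|; lia.
- move=> i /DP gi; have [h1 h2] := gm _ _ gi.
  split; first by rewrite mem_filter h1 h2 mem_enum.
  apply/existsP => -[b /existsP[j /existsP[c /andP[sl /eqP Ev]]]].
  have [+ _] := fv b => /(_ j c sl) [_ /andP[_]]; rewrite -Ev.
  have /and4P[_ _ _ nt] := h2.
  have -> : (x i == s j) = false by apply: contraNF nt => /eqP->; apply: terminal_s.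
  have -> : (x i == t j) = false by apply: contraNF nt => /eqP->; apply: terminal_t.
  by rewrite !orbF /blocked negb_or => /andP[_ /existsP[]]; exists i; rewrite gi.
- move=> i j /DP gi /DP gj nij E; case: (gd i j nij); rewrite gi ?gj //.
  by rewrite E.
move=> y [h1 h2].
have yP i : i \in D -> [/\ y i \in take M (middles i), G (s i) (t i), middle i (y i) & ~~ F (y i)].
  move=> hi; have [h3 h4] := h1 i hi; have := mem_take h3.
  by rewrite mem_filter => /andP[/andP[]].
pose g' i := if i \in D then Some (y i) else None.
exists g'; split.
- split=> //.
  + by move=> i v; rewrite /g'; case: ifP => // /yP[_ a1 a2 _] [<-].
  + move=> i j nij; rewrite /g'; case: ifP => [hi|/negbT hi]; case: ifP => [hj|/negbT hj] //.
      by move=> [E]; case: (h2 i j hi hj nij E).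
    move: hi hj; rewrite !inE !negbK => /eqP gi /eqP gj _.
    by case: (gd i j nij); rewrite gi ?gj.
- move=> b; split; last by case: (fv b).
  move=> i c sl; case: (fv b) => /(_ i c sl) [bf /andP[uf hf]] _; split=> //.
  apply/andP; split=> //; case/or3P: hf => [nb|->|->]; rewrite ?orbT //.
  apply/orP; left; apply: contra nb => /orP[h|/existsP[j]]; first by rewrite /blocked h.
  rewrite /g'; case: ifP => // /yP[_ _ _ nF] /eqP[Ey]; case/negP: nF.
  apply/existsP; exists b; apply/existsP; exists i; apply/existsP; exists c.
  by rewrite sl Ey eqxx.
- by move=> i v; rewrite /g'; case: ifP => // /yP[h _ _ _] [<-].
Qed.

Lemma truncate_slots g f b : valid_slots g b f ->
  exists f', valid_slots g b f' /\
     forall i c, slot i b c -> f' i c \in take M (slot_list g i b c).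
Proof.
move=> [f1 f2].
pose A (q q' : 'I_k * I) v := q.1 != q'.1 -> (v == s q.1) || (v == t q.1).
case: (@truncate_lists V ('I_k * I)%type M (fun q => slot_list g q.1 b q.2)
        (bag_slots b) pred0 A (fun q => f q.1 q.2)).
- by move=> q _; rewrite filter_uniq // enum_uniq.
- move=> q _; rewrite count_pred0; have := card_bag_slots b.
  by move: #|_|; lia.
- move=> [i c]; rewrite inE /= => sl; split=> //.
  by rewrite mem_filter mem_enum; case: (f1 i c sl) => -> ->.
- move=> [i c] [j d]; rewrite !inE /A /= => si sj _ E n; exact: f2 sj E.
move=> y [h1 h2]; exists (fun i c => y (i, c)); split; last first.
  by move=> i c sl; case: (h1 (i, c)); rewrite ?inE.
split.
- move=> i c sl; have hq : (i, c) \in bag_slots b by rewrite inE.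
  by case: (h1 _ hq) => /mem_take; rewrite mem_filter mem_enum => /andP[u1 u2] _.
- move=> i j c d nij si sj E; apply: (h2 (i, c) (j, d)); rewrite ?inE //.
  by rewrite xpair_eqE negb_and nij.
Qed.

(** * The search space *)

Definition candidates i := take M (middles i).

(** Digit 0 stands for no middle, digit [r.+1] for the candidate of rank [r]. *)
Definition middle_of (gd : nat -> nat) (i : 'I_k) : option V :=
  if gd i is r.+1 then Some (nth x0 (candidates i) r) else None.

Definition direct_clash i j := ~~ long G s t i && same_ends s t i j.

Definition clash gd (i j : 'I_k) :=
  if gd i == 0 then (gd j == 0) && direct_clash i j
  else (gd j != 0) && (nth x0 (candidates i) (gd i).-1 == nth x0 (candidates j) (gd j).-1).

Definition terminals_ok := [forall i, (s i \in U i) && (t i \in U i)].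

Definition middles_test gd :=
  [forall i : 'I_k, (gd i <= size (candidates i)) &&
     [forall j : 'I_k, (j < i) ==> ~~ clash gd i j]].

Definition slots g b : seq ('I_k * seq V) :=
  flatten [seq [seq (j, take M (slot_list g j b c)) | j <- enum 'I_k & crossed j (lower_end par b c)]
          | c <- enum (T b)].

Definition choice (sl : seq ('I_k * seq V)) (h : nat -> nat) (q : 'I_(size sl)) :=
  nth x0 (tnth (in_tuple sl) q).2 (h q).

(** Only the ends of the path of the first slot are tested: a vertex listed for
    another path and equal to such an end is an end of that path as well. *)
Definition slot_clash (sl : seq ('I_k * seq V)) (h : nat -> nat) (q q' : 'I_(size sl)) :=
  let i := (tnth (in_tuple sl) q).1 in
  [&& i != (tnth (in_tuple sl) q').1, choice h q == choice h q' &
      ~~ ((choice h q == s i) || (choice h q == t i))].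

Definition slots_test (sl : seq ('I_k * seq V)) (h : nat -> nat) :=
  [forall q : 'I_(size sl), (h q < size (tnth (in_tuple sl) q).2) &&
     [forall q' : 'I_(size sl), (q' < q) ==> ~~ slot_clash h q q']].

Lemma slotsP g b i l : reflect (exists2 c, slot i b c & l = take M (slot_list g i b c))
  ((i, l) \in slots g b).
Proof.
apply: (iffP flatten_mapP) => [[c]|[c /andP[bc cr] ->]].
  rewrite mem_enum => bc /mapP[j]; rewrite mem_filter mem_enum => /andP[cr _] [-> ->].
  by exists c => //; rewrite /slot cr andbT; apply: bc.
exists c; first by rewrite mem_enum.
by apply/mapP; exists i => //; rewrite mem_filter cr mem_enum.
Qed.

Lemma size_slots g b : size (slots g b) = #|bag_slots b|.
Proof.
rewrite size_flatten /shape -map_comp sumnE big_map big_enum /=.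
rewrite (eq_bigr (fun c => \sum_(j | crossed j (lower_end par b c)) 1)); last first.
  by move=> c _ /=; rewrite size_map size_filter -sum1_count big_enum_cond /=; apply: eq_bigl.
rewrite pair_big_dep /= sum1_card /=.
rewrite -(card_imset _ (f := fun q : I * 'I_k => (q.2, q.1))); last by move=> [? ?] [? ?] [-> ->].
apply: eq_card => -[i c]; rewrite inE /slot /=; apply/imsetP/andP.
  by move=> [[c' i'] h [-> ->]]; move: h; rewrite unfold_in => /andP[].
by move=> [h1 h2]; exists (c, i) => //; rewrite unfold_in /= h2 andbT.
Qed.

Lemma size_slots_leq g b : size (slots g b) <= 3 * k.
Proof. by rewrite size_slots card_bag_slots. Qed.

Lemma direct_clash_sym i j : direct_clash i j -> direct_clash j i.
Proof.
rewrite /direct_clash /long /same_ends => /andP[h /orP[]/andP[/eqP E1 /eqP E2]].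
  by move: h; rewrite E1 E2 !eqxx => ->.
by move: h; rewrite E1 E2 !eqxx orbT eq_sym adj_sym => ->.
Qed.

Lemma clash_sym gd i j : clash gd i j = clash gd j i.
Proof.
rewrite /clash; case: (eqVneq (gd i) 0) => hi; case: (eqVneq (gd j) 0) => hj //=.
by apply/idP/idP; apply: direct_clash_sym.
Qed.

Lemma eq_slots g g' b : g =1 g' -> slots g b = slots g' b.
Proof.
move=> E; congr flatten; apply: eq_map => c; apply: eq_map => j; congr (_, take _ _).
apply: eq_filter => v; rewrite /usable /blocked.
by congr (_ && (~~ (_ || _) || _)); apply: eq_existsb => i; rewrite E.
Qed.

Lemma digits_of_middles g f : valid_middles g -> (forall b, valid_slots g b (f b)) ->
  (forall i v, g i = Some v -> v \in take M (middles i)) ->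
  exists gd : nat -> nat, [/\ forall i, gd i <= M, terminals_ok, middles_test gd &
    forall b, exists h : nat -> nat, (forall q, h q < M) /\ slots_test (slots (middle_of gd) b) h].
Proof.
move=> gv fv gt; have [gU gm gdd] := gv.
pose gd n := if insub n is Some i then
  (if g i is Some v then (index v (candidates i)).+1 else 0) else 0.
have gdE (i : 'I_k) : gd i = if g i is Some v then (index v (candidates i)).+1 else 0.
  by rewrite /gd valK.
have midE : middle_of gd =1 g.
  move=> i; rewrite /middle_of gdE; case E : (g i) => [v|] //.
  by rewrite nth_index // gt.
have gd_cand (i : 'I_k) : gd i <= size (candidates i).
  by rewrite gdE; case E : (g i) => [v|] //; rewrite index_mem gt.
have M0 : 0 < M by apply: leq_trans M_big.
exists gd; split.
- move=> n; rewrite /gd; case: insubP => // i _ _; case E : (g i) => [v|] //.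
  apply: (@leq_trans (size (candidates i))); first by rewrite index_mem gt.
  by rewrite size_take_min geq_minl.
- by apply/forallP => i; case: (gU i) => -> ->.
- apply/forallP => i; rewrite gd_cand; apply/forallP => j; apply/implyP => ji.
  have nij : i != j by apply: contraTneq ji => ->; rewrite ltnn.
  rewrite /clash; case Ei : (g i) (gdE i) => [v|] ->; case Ej : (g j) (gdE j) => [v'|] -> //=.
    rewrite !nth_index ?gt //; apply/eqP => E.
    by case: (gdd i j nij); rewrite Ei ?Ej ?E.
  by case: (gdd i j nij); rewrite Ei ?Ej.
move=> b; case: (truncate_slots (fv b)) => f' [[f1 f2] ft].
rewrite (eq_slots _ midE); set sl := slots g b.
pose tn := tnth (in_tuple sl).
have ex_c q : exists c, slot (tn q).1 b c /\ (tn q).2 = take M (slot_list g (tn q).1 b c).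
  have : tn q \in sl by apply: mem_tnth.
  by case: (tn q) => i l /slotsP[c h1 h2]; exists c.
have [cq cqP] := fin_all_exists ex_c.
pose w q := f' (tn q).1 (cq q).
have win q : w q \in (tn q).2 by case: (cqP q) => h1 ->; apply: ft.
pose h n := if insub n is Some q then index (w q) (tn q).2 else 0.
have hE (q : 'I_(size sl)) : h q = index (w q) (tn q).2 by rewrite /h valK.
have chE q : choice h q = w q by rewrite /choice hE nth_index.
exists h; split.
  move=> n; rewrite /h; case: insubP => // q _ _.
  apply: (@leq_trans (size (tn q).2)); first by rewrite index_mem.
  by case: (cqP q) => _ ->; rewrite size_take_min geq_minl.
apply/forallP => q; rewrite hE index_mem win; apply/forallP => q'; apply/implyP => _.
rewrite /slot_clash !chE; apply/negP => /and3P[n /eqP E /negP[]].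
by apply: (f2 _ _ _ _ n _ _ E); case: (cqP q) (cqP q') => ? _ [? _].
Qed.

Lemma middles_of_digits (gd : nat -> nat) : terminals_ok -> middles_test gd ->
  (forall b, exists h : nat -> nat, slots_test (slots (middle_of gd) b) h) ->
  exists g f, valid_middles g /\ forall b : I, valid_slots g b (f b).
Proof.
move=> tok ot it.
have [h hP] := fin_all_exists it.
pose sl b := slots (middle_of gd) b.
have slotP i b c : slot i b c -> (i, take M (slot_list (middle_of gd) i b c)) \in sl b.
  by move=> hs; apply/slotsP; exists c.
pose ix b i c := index (i, take M (slot_list (middle_of gd) i b c)) (sl b).
pose f b i c := nth x0 (take M (slot_list (middle_of gd) i b c)) (h b (ix b i c)).
have it_sl b i c : slot i b c -> exists q : 'I_(size (sl b)), [/\ val q = ix b i c,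
    tnth (in_tuple (sl b)) q = (i, take M (slot_list (middle_of gd) i b c)) &
    choice (h b) q = f b i c].
  move=> hs; have lt : ix b i c < size (sl b) by rewrite index_mem slotP.
  have E : tnth (in_tuple (sl b)) (Ordinal lt) = (i, take M (slot_list (middle_of gd) i b c)).
    by rewrite (tnth_nth (i, [::])) /= nth_index // slotP.
  by exists (Ordinal lt); rewrite /choice E.
exists (middle_of gd), f; split; [split|].
- by move=> i; move/forallP: tok => /(_ i) /andP[].
- move=> i v; rewrite /middle_of; case E : (gd i) => [|r] // [<-].
  have : nth x0 (candidates i) r \in candidates i.
    by apply: mem_nth; move/forallP: ot => /(_ i) /andP[]; rewrite E.
  by move/mem_take; rewrite mem_filter => /andP[/andP[]].
- move=> i j nij.
  have nc : ~~ clash gd i j.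
    case: (ltngtP i j) => ij; last by rewrite (val_inj ij) eqxx in nij.
      rewrite clash_sym.
      by move/forallP: ot => /(_ j) /andP[_ /forallP /(_ i)]; rewrite ij.
    by move/forallP: ot => /(_ i) /andP[_ /forallP /(_ j)]; rewrite ij.
  move: nc; rewrite /clash /middle_of; case: (gd i) => [|r]; case: (gd j) => [|r'] //=.
  by move=> n [E]; rewrite E eqxx in n.
move=> b; split.
- move=> i c hs; case: (it_sl b i c hs) => q [Eq tq cq].
  have /forallP/(_ q)/andP[lt _] := hP b; rewrite -/(sl b) tq Eq /= in lt.
  have /mem_take : f b i c \in take M (slot_list (middle_of gd) i b c) by apply: mem_nth.
  by rewrite mem_filter mem_enum => /andP[].
- move=> i j c d nij si sj E.
  case: (it_sl b i c si) => q [Eq tq cq]; case: (it_sl b j d sj) => q' [Eq' tq' cq'].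
  have nq : q != q' by apply: contraNneq nij => e; move: tq; rewrite e tq' => -[->].
  have := hP b; rewrite /slots_test -/(sl b) => /forallP hb.
  case: (ltngtP q q') => qq; last by rewrite (val_inj qq) eqxx in nq.
    have /andP[_ /forallP/(_ q)] := hb q'; rewrite qq /slot_clash cq cq' tq tq' /=.
    rewrite eq_sym nij E eqxx negbK /= => hj.
    have ui : usable (middle_of gd) i (f b i c).
      have /forallP/(_ q)/andP[lt _] := hP b; rewrite -/(sl b) tq Eq /= in lt.
      have /mem_take : f b i c \in take M (slot_list (middle_of gd) i b c) by apply: mem_nth.
      by rewrite mem_filter => /andP[].
    move: ui; rewrite /usable E => /andP[_ /or3P[nb|->|->]]; rewrite ?orbT //.
    case/negP: nb; rewrite /blocked; case/orP: hj => /eqP ->.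
      by rewrite terminal_s.
    by rewrite terminal_t.
  have /andP[_ /forallP/(_ q')] := hb q; rewrite qq /slot_clash cq cq' tq tq' /=.
  by rewrite nij E eqxx negbK.
Qed.

Theorem solution_digits : totally_disjoint_paths G s t U <->
  exists gd : nat -> nat, [/\ forall i, gd i <= M, terminals_ok, middles_test gd &
    forall b, exists h : nat -> nat, (forall q, h q < M) /\ slots_test (slots (middle_of gd) b) h].
Proof.
split.
- case/(middles_of_solution PT bgP Rt) => g0 [f0 [gv0 fv0]].
  case: (truncate_middles gv0 fv0) => g [gv fv gt] {gv0}.
  exact: digits_of_middles gv fv gt.
- move=> [gd [_ tok ot it]].
  case: (middles_of_digits tok ot _) => [b|g [f [gv fv]]].
    by case: (it b) => h [_ ?]; exists h.
  exact: (solution_of_middles PT bgP Rt gv fv).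
Qed.

End Truncation.

(** * A structured language with arrays *)

Definition upd {A : Type} (f : nat -> A) (x : nat) (a : A) : nat -> A :=
  fun y => if eqn x y then a else f y.

Lemma upd_same A (f : nat -> A) x a : upd f x a x = a.
Proof. by rewrite /upd eqnE eqxx. Qed.

Lemma upd_neq A (f : nat -> A) x a y : x != y -> upd f x a y = f y.
Proof. by rewrite /upd eqnE => /negPf->. Qed.

Lemma updE A (f : nat -> A) x a y : upd f x a y = if x == y then a else f y.
Proof. by rewrite /upd eqnE. Qed.

(** The memory of a program: registers, and arrays without a length. *)
Record mst := MSt { rg : nat -> nat; ar : nat -> nat -> nat }.

Definition setr ms x v := MSt (upd (rg ms) x v) (ar ms).
Definition seta ms j i v := MSt (rg ms) (upd (ar ms) j (upd (ar ms j) i v)).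

(** Cells of the input ([In]) and of the arrays ([A]) are told apart by the
    syntax, so that writing to an array changes neither the input nor another
    array. *)
Inductive iexp :=
  | K of nat
  | R of nat
  | In of iexp
  | A of nat & iexp
  | O of binop & iexp & iexp.

Inductive com :=
  | CSkip
  | CSet of nat & iexp
  | CPut of nat & iexp & iexp
  | CSeq of com & com
  | CIf of iexp & com & com
  | CLoop of iexp & com.

(** The register with the length of the input. *)
Definition rN := 1.

(** Interleaving 16 arrays behind the input gives each of them unlimited room. *)
Definition addr j e := Op Add (Reg rN) (Op Add (Op Mul e (Const 16)) (Const j)).

Fixpoint compile_exp (e : iexp) : expr :=
  match e with
  | K c => Const c
  | R x => Reg x
  | In e => Read (compile_exp e)
  | A j e => Read (addr j (compile_exp e))
  | O o a b => Op o (compile_exp a) (compile_exp b)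
  end.

Fixpoint compile (c : com) : cmd :=
  match c with
  | CSkip => Skip
  | CSet x e => Assign x (compile_exp e)
  | CPut j e1 e2 => Write (addr j (compile_exp e1)) (compile_exp e2)
  | CSeq c1 c2 => Seq (compile c1) (compile c2)
  | CIf e c1 c2 => If (compile_exp e) (compile c1) (compile c2)
  | CLoop e c => While (compile_exp e) (compile c)
  end.

Definition ecost e := cost (compile_exp e).

Fixpoint wfe (e : iexp) : bool :=
  match e with
  | K _ | R _ => true
  | In e => wfe e
  | A j e => (j < 16) && wfe e
  | O _ a b => wfe a && wfe b
  end.

Fixpoint wf (c : com) : bool :=
  match c with
  | CSkip => true
  | CSet x e => (x != rN) && wfe e
  | CPut j e1 e2 => [&& j < 16, wfe e1 & wfe e2]
  | CSeq c1 c2 => wf c1 && wf c2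
  | CIf e c1 c2 => [&& wfe e, wf c1 & wf c2]
  | CLoop e c => wfe e && wf c
  end.

Fixpoint mods (c : com) : seq nat :=
  match c with
  | CSet x _ => [:: x]
  | CSeq c1 c2 | CIf _ c1 c2 => mods c1 ++ mods c2
  | CLoop _ c => mods c
  | _ => [::]
  end.

Fixpoint amods (c : com) : seq nat :=
  match c with
  | CPut j _ _ => [:: j]
  | CSeq c1 c2 | CIf _ c1 c2 => amods c1 ++ amods c2
  | CLoop _ c => amods c
  | _ => [::]
  end.

(** The frame condition of a command follows from its text alone. *)
Definition frame (xs js : seq nat) (ms ms' : mst) : Prop :=
  (forall x, x \notin xs -> rg ms' x = rg ms x) /\
  (forall j, j \notin js -> ar ms' j = ar ms j).

Lemma frame_refl xs js ms : frame xs js ms ms.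
Proof. by []. Qed.

Lemma frame_trans xs js a b c : frame xs js a b -> frame xs js b c -> frame xs js a c.
Proof.
by move=> [h1 h2] [h3 h4]; split=> x hx; rewrite ?h3 ?h4 ?h1 ?h2.
Qed.

Lemma frame_sub xs js xs' js' a b : frame xs js a b ->
  {subset xs <= xs'} -> {subset js <= js'} -> frame xs' js' a b.
Proof.
by move=> [h1 h2] hx hj; split=> x hn;
  [apply: h1|apply: h2]; apply: contra hn => /hx || apply: contra hn => /hj.
Qed.

Lemma frame_setr xs js x ms v : x \in xs -> frame xs js ms (setr ms x v).
Proof.
move=> hx; split=> // y hy /=; rewrite upd_neq //.
by apply: contraNneq hy => <-.
Qed.

Lemma frame_seta xs js j ms i v : j \in js -> frame xs js ms (seta ms j i v).
Proof.
move=> hj; split=> // y hy /=; rewrite upd_neq //.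
by apply: contraNneq hy => <-.
Qed.

Section Machine.
Variables (w N B : nat) (inp : nat -> nat).

Fixpoint ev (ms : mst) (e : iexp) : nat :=
  match e with
  | K c => c
  | R x => rg ms x
  | In e => inp (ev ms e)
  | A j e => ar ms j (ev ms e)
  | O o a b => binop_sem o (ev ms a) (ev ms b)
  end.

(** Under these conditions no operation exceeds the word size. As all stored
    values are below [B], only constants, sums and products need one. *)
Fixpoint safe (ms : mst) (e : iexp) : Prop :=
  match e with
  | K c => c < B
  | R _ => True
  | In e => safe ms e /\ ev ms e < N
  | A _ e => safe ms e
  | O Add a b => [/\ safe ms a, safe ms b & ev ms a + ev ms b < B]
  | O Mul a b => [/\ safe ms a, safe ms b & ev ms a * ev ms b < B]
  | O _ a b => safe ms a /\ safe ms b
  end.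

(** Big-step semantics in [nat] that charges the cost of the compiled program;
    it gets stuck on unsafe expressions. *)
Inductive run : com -> mst -> nat -> mst -> Prop :=
  | RSkip ms : run CSkip ms 1 ms
  | RSet ms x e : safe ms e ->
      run (CSet x e) ms (ecost e).+1 (setr ms x (ev ms e))
  | RPut ms j a e : safe ms a -> safe ms e ->
      run (CPut j a e) ms (ecost a + 6 + ecost e).+1
          (seta ms j (ev ms a) (ev ms e))
  | RSeq c1 c2 ms1 ms2 ms3 t1 t2 :
      run c1 ms1 t1 ms2 -> run c2 ms2 t2 ms3 -> run (CSeq c1 c2) ms1 (t1 + t2) ms3
  | RIf e c1 c2 ms ms' t : safe ms e ->
      run (if ev ms e != 0 then c1 else c2) ms t ms' ->
      run (CIf e c1 c2) ms (ecost e + t).+1 ms'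
  | RLoopEnd e c ms : safe ms e -> ev ms e = 0 ->
      run (CLoop e c) ms (ecost e).+1 ms
  | RLoopStep e c ms1 ms2 ms3 t1 t2 : safe ms1 e -> ev ms1 e <> 0 ->
      run c ms1 t1 ms2 -> run (CLoop e c) ms2 t2 ms3 ->
      run (CLoop e c) ms1 (ecost e + t1 + t2).+1 ms3.

Lemma run_fr c ms t ms' : run c ms t ms' -> frame (mods c) (amods c) ms ms'.
Proof.
elim=> {c ms t ms'} /=.
- by move=> ms; apply: frame_refl.
- move=> ms x e _; split=> // y; rewrite inE => hy /=.
  by rewrite upd_neq // eq_sym.
- move=> ms j a e _ _; split=> // y; rewrite inE => hy /=.
  by rewrite upd_neq // eq_sym.
- move=> c1 c2 ms1 ms2 ms3 t1 t2 _ h1 _ h2.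
  by apply: (frame_trans (frame_sub h1 _ _) (frame_sub h2 _ _)) => x hx;
    rewrite mem_cat hx ?orbT.
- move=> e c1 c2 ms ms' t _ _ h.
  by apply: (frame_sub h) => x; case: (ev ms e != 0) => hx; rewrite mem_cat hx ?orbT.
- by move=> *; apply: frame_refl.
- move=> e c ms1 ms2 ms3 t1 t2 _ _ _ h1 _ h2; exact: (frame_trans h1 h2).
Qed.

(** * Translation to the word machine *)

Hypothesis B1 : 1 < B.
Hypothesis NB : N + 16 * B + 16 <= 2 ^ w.
Hypothesis inpB : forall a, a < N -> inp a < B.

Definition bounded ms :=
  (forall x, rg ms x < B) /\ (forall j i, ar ms j i < B).

Record sim (ms : mst) (st : state) : Prop := Sim {
  sim_rg : forall x, regs st x = rg ms x;
  sim_N : rg ms rN = N;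
  sim_in : forall a, a < N -> ram st a = inp a;
  sim_ar : forall j i, j < 16 -> i < B -> ram st (N + (i * 16 + j)) = ar ms j i;
  sim_bd : bounded ms }.

Lemma eval_cmp ms st e : sim ms st -> safe ms e -> wfe e ->
  eval w st (compile_exp e) = ev ms e /\ ev ms e < B.
Proof.
move=> S; elim: e => [c|x|e IH|j e IH|o a IHa b IHb] /=.
- by move=> h _; rewrite modn_small //; lia.
- by move=> _ _; rewrite (sim_rg S); case: (sim_bd S).
- move=> [h1 h2] h3; case: (IH h1 h3) => -> h4.
  by rewrite (sim_in S) // inpB.
- move=> h1 /andP[hj h3]; case: (IH h1 h3) => -> h4.
  rewrite (sim_rg S) (sim_N S) (@modn_small 16); last by lia.
  rewrite (@modn_small j); last by lia.
  rewrite (@modn_small (_ * 16)); last by lia.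
  rewrite (@modn_small (_ + j)); last by lia.
  rewrite modn_small; last by lia.
  by rewrite (sim_ar S) //; case: (sim_bd S).
- move=> h /andP[wa wb].
  have [sa sb] : safe ms a /\ safe ms b by case: o h => [] [].
  case: (IHa sa wa) => -> ha; case: (IHb sb wb) => -> hb.
  have hB : binop_sem o (ev ms a) (ev ms b) < B.
    case: o h => /=; try by case.
    + by move=> _; lia.
    + by move=> _; apply: leq_ltn_trans (leq_div _ _) _.
    + by move=> _; apply: leq_ltn_trans (leq_mod _ _) _.
    + by move=> _; apply: leq_ltn_trans (leq_b1 _) _.
    + by move=> _; apply: leq_ltn_trans (leq_b1 _) _.
  by rewrite modn_small //; lia.
Qed.

(** Safe runs are faithful: no operation wraps around, and the addresses of the
    array cells are distinct, fit in a word and lie behind the input. *)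
Lemma run_exec c ms t ms' : run c ms t ms' -> wf c ->
  forall st, sim ms st ->
  exists2 st', exec w (compile c) st t st' & sim ms' st'.
Proof.
elim=> {c ms t ms'} /=.
- by move=> ms _ st S; exists st => //; constructor.
- move=> ms x e h /andP[hx we] st S; eexists; first by constructor.
  case: (eval_cmp S h we) => -> hB.
  split=> /=.
  + move=> y /=; rewrite /upd eq_sym.
    by case: eqnP => [->|/eqP/negPf->]; rewrite ?eqxx // (sim_rg S).
  + by rewrite upd_neq // (sim_N S).
  + by move=> a ha; rewrite (sim_in S).
  + by move=> j i hj hi; rewrite (sim_ar S).
  + case: (sim_bd S) => h1 h2; split=> //= y.
    by rewrite /upd; case: ifP.
- move=> ms j a e ha he /and3P[hj wa we] st S.
  have -> : (ecost a + 6 + ecost e).+1 =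
    (cost (addr j (compile_exp a)) + cost (compile_exp e)).+1 by rewrite /ecost /=; lia.
  eexists; first by constructor.
  case: (eval_cmp S ha wa) => ea hBa; case: (eval_cmp S he we) => ee hBe.
  rewrite /= ea ee (sim_rg S) (sim_N S) (@modn_small 16); last by lia.
  rewrite (@modn_small j); last by lia.
  rewrite (@modn_small (_ * 16)); last by lia.
  rewrite (@modn_small (_ + j)); last by lia.
  rewrite modn_small; last by lia.
  split=> /=.
  + by move=> y; rewrite (sim_rg S).
  + by rewrite (sim_N S).
  + move=> b hb; case: eqP => [|_]; first by lia.
    by rewrite (sim_in S).
  + move=> j' i hj' hi; case: eqP => [E|NE].
      have E1 : i = ev ms a by lia.
      have E2 : j' = j by lia.
      by rewrite E1 E2 !upd_same.
    rewrite (sim_ar S) // /upd; case: eqnP => // E1.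
    by case: eqnP => [E2|_]; [case: NE; lia|rewrite E1].
  + case: (sim_bd S) => h1 h2; split=> //= j' i.
    by rewrite /upd; case: ifP => // _; case: ifP.
- move=> c1 c2 ms1 ms2 ms3 t1 t2 _ IH1 _ IH2 /andP[w1 w2] st S.
  case: (IH1 w1 st S) => st2 e1 S2; case: (IH2 w2 st2 S2) => st3 e2 S3.
  by exists st3 => //; apply: ExecSeq e1 e2.
- move=> e c1 c2 ms ms' t h _ IH /and3P[we w1 w2] st S.
  case: (eval_cmp S h we) => ee _.
  have wc : wf (if ev ms e != 0 then c1 else c2) by case: ifP.
  case: (IH wc st S) => st' ex S'; exists st' => //.
  by apply: ExecIf; rewrite ee; move: ex; case: ifP.
- move=> e c ms h e0 /andP[we wc] st S; exists st => //.
  by apply: ExecWhileEnd; case: (eval_cmp S h we) => ->.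
- move=> e c ms1 ms2 ms3 t1 t2 h e0 _ IH1 _ IH2 /andP[we wc] st S.
  case: (IH1 wc st S) => st2 e1 S2.
  have wl : wf (CLoop e c) by rewrite /= we wc.
  case: (IH2 wl st2 S2) => st3 e2 S3.
  exists st3 => //; apply: ExecWhileStep e1 e2.
  by case: (eval_cmp S h we) => ->.
Qed.

End Machine.

(** * Total correctness with running times *)

Section Logic.
Variables (N B : nat) (inp : nat -> nat).
Hypothesis B1 : 1 < B.
Local Notation ev := (ev inp).
Local Notation safe := (safe N B inp).
Local Notation run := (run N B inp).

(** From memory [ms] at time [t], command [c] halts and [Q] holds of the final
    time and memory. *)
Definition wp (c : com) (Q : nat -> mst -> Prop) (t : nat) (ms : mst) : Prop :=
  exists t' ms', run c ms t' ms' /\ Q (t + t') ms'.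

(** Every postcondition comes with the frame condition for free. *)
Lemma wp_mono c (Q Q' : nat -> mst -> Prop) t ms :
  wp c Q t ms ->
  (forall t' ms', frame (mods c) (amods c) ms ms' -> Q t' ms' -> Q' t' ms') ->
  wp c Q' t ms.
Proof.
move=> [t' [ms' [r q]]] h; exists t', ms'; split=> //; apply: h q.
exact: run_fr r.
Qed.

Lemma wp_skip Q t ms : Q (t + 1) ms -> wp CSkip Q t ms.
Proof. by move=> q; exists 1, ms; split=> //; constructor. Qed.

Lemma wp_set x e Q t ms : safe ms e ->
  Q (t + (ecost e).+1) (setr ms x (ev ms e)) -> wp (CSet x e) Q t ms.
Proof. by move=> h q; do 2 eexists; split; first by constructor. Qed.

Lemma wp_put j a e Q t ms : safe ms a -> safe ms e ->
  Q (t + (ecost a + 6 + ecost e).+1) (seta ms j (ev ms a) (ev ms e)) ->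
  wp (CPut j a e) Q t ms.
Proof. by move=> h h' q; do 2 eexists; split; first by constructor. Qed.

Lemma wp_seq c1 c2 Q t ms : wp c1 (wp c2 Q) t ms -> wp (CSeq c1 c2) Q t ms.
Proof.
move=> [t1 [ms1 [r1 [t2 [ms2 [r2 q]]]]]]; exists (t1 + t2), ms2.
by rewrite addnA; split=> //; apply: RSeq r1 r2.
Qed.

Lemma wp_if e c1 c2 Q t ms : safe ms e ->
  (ev ms e <> 0 -> wp c1 Q (t + (ecost e).+1) ms) ->
  (ev ms e = 0 -> wp c2 Q (t + (ecost e).+1) ms) ->
  wp (CIf e c1 c2) Q t ms.
Proof.
move=> h h1 h2.
have [t' [ms' [r q]]] :
    wp (if ev ms e != 0 then c1 else c2) Q (t + (ecost e).+1) ms.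
  by case: eqP => /= h0; [apply: h2|apply: h1].
exists (ecost e + t').+1, ms'; split; first by apply: RIf.
by move: q; congr Q; lia.
Qed.

Lemma wp_loop_end e c Q t ms : safe ms e -> ev ms e = 0 ->
  Q (t + (ecost e).+1) ms -> wp (CLoop e c) Q t ms.
Proof. by move=> h h0 q; do 2 eexists; split; first by apply: RLoopEnd. Qed.

Lemma wp_loop_step e c Q t ms : safe ms e -> ev ms e <> 0 ->
  wp c (wp (CLoop e c) Q) (t + (ecost e).+1) ms -> wp (CLoop e c) Q t ms.
Proof.
move=> h h0 [t1 [ms1 [r1 [t2 [ms2 [r2 q]]]]]].
exists (ecost e + t1 + t2).+1, ms2; split; first by apply: RLoopStep r1 r2.
by move: q; congr Q; lia.
Qed.

(** * Counted loops *)

Definition For x y body :=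
  CSeq (CSet x (K 0))
    (CLoop (O Lt (R x) (R y)) (CSeq body (CSet x (O Add (R x) (K 1))))).

(** The invariant includes the clock, as needed for amortized costs. *)
Lemma wp_for x y body Q t ms m (I : nat -> nat -> mst -> Prop) :
  x \notin mods body -> y \notin x :: mods body ->
  rg ms y = m -> m < B ->
  I 0 (t + 2) (setr ms x 0) ->
  (forall i t' ms', i < m -> rg ms' x = i ->
     frame (x :: mods body) (amods body) ms ms' -> I i t' ms' ->
     wp body (fun t'' ms'' => I i.+1 (t'' + 4) (setr ms'' x i.+1)) (t' + 4) ms') ->
  (forall t' ms', frame (x :: mods body) (amods body) ms ms' ->
     I m t' ms' -> Q (t' + 4) ms') ->
  wp (For x y body) Q t ms.
Proof.
move=> hx hy ym mB I0 Ib IQ; apply/wp_seq/wp_set => /=; first lia.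
have F0 : frame (x :: mods body) (amods body) ms (setr ms x 0).
  by split=> // z; rewrite inE negb_or /= => /andP[hz _]; rewrite upd_neq // eq_sym.
have X0 : rg (setr ms x 0) x = 0 by rewrite /= upd_same.
rewrite [ecost (K 0)]/=.
suff H d i t1 ms1 : I i t1 ms1 -> rg ms1 x = i ->
    frame (x :: mods body) (amods body) ms ms1 -> i + d = m ->
    wp (CLoop (O Lt (R x) (R y)) (CSeq body (CSet x (O Add (R x) (K 1))))) Q t1 ms1.
  exact: (H m 0).
elim: d i t1 ms1 => [|d IH] i t1 ms1 I1 X1 F1 E.
  apply: wp_loop_end => //=.
    by rewrite X1 F1.1 // ym; lia.
  by apply: IQ => //; rewrite -E addn0.
apply: wp_loop_step => //=.
  by rewrite X1 F1.1 // ym; have -> : i < m by lia.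
apply: wp_seq; rewrite [(ecost _).+1]/=.
have im : i < m by lia.
apply: wp_mono (Ib i t1 ms1 im X1 F1 I1) _ => t2 ms2 F2 I2.
have X2 : rg ms2 x = i by rewrite F2.1.
apply: wp_set => /=.
  by rewrite X2; split=> //; lia.
rewrite X2 addn1; apply: IH.
- exact: I2.
- by rewrite /= upd_same.
- apply: (frame_trans F1); split=> [z|z hz] /=; last by rewrite F2.2.
  by rewrite inE negb_or => /andP[hz1 hz2]; rewrite upd_neq ?F2.1 // eq_sym.
- lia.
Qed.

(** When the cost of iteration [i] is bounded by [D i] alone, the clock can be
    left out of the invariant. *)
Lemma wp_for_cost x y body Q t ms m (D : nat -> nat) (I : nat -> mst -> Prop) :
  x \notin mods body -> y \notin x :: mods body ->
  rg ms y = m -> m < B ->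
  I 0 (setr ms x 0) ->
  (forall i t' ms', i < m -> rg ms' x = i ->
     frame (x :: mods body) (amods body) ms ms' -> I i ms' ->
     wp body (fun t'' ms'' => t'' <= t' + D i /\ I i.+1 (setr ms'' x i.+1)) t' ms') ->
  (forall t' ms', frame (x :: mods body) (amods body) ms ms' ->
     t' <= t + 6 + \sum_(i < m) (D i + 8) ->
     I m ms' -> Q t' ms') ->
  wp (For x y body) Q t ms.
Proof.
move=> hx hy ym mB I0 Ib IQ.
pose J i t' ms' := t' <= t + 2 + \sum_(i0 < i) (D i0 + 8) /\ I i ms'.
apply: (wp_for (I := J) hx hy ym mB).
- by split; rewrite ?big_ord0 ?addn0.
- move=> i t' ms' im xi F [le1 I1].
  apply: wp_mono (Ib i (t' + 4) ms' im xi F I1) _ => t2 ms2 _ [le2 I2].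
  split=> //; rewrite big_ord_recr /=; move: (\sum_(_ < i) _) le1 => S le1; lia.
- by move=> t' ms' F [le1 I1]; apply: IQ => //; lia.
Qed.

End Logic.

(* [lia] inspects every hypothesis, which is slow in large contexts. *)
Ltac nat_lia :=
  repeat match goal with
  | H : ?P |- _ =>
    lazymatch P with
    | is_true (leq _ _) => fail
    | @eq nat _ _ => fail
    | nat => fail
    | _ => clear H
    end
  end; lia.
Ltac cost_lia := rewrite /ecost /=; nat_lia.

Notation "c1 ;;; c2" := (CSeq c1 c2) (at level 60, right associativity).

(** * Digits of a number *)

Definition digit b tau i := tau %/ b ^ i %% b.

Lemma digit0 b i : digit b 0 i = 0.
Proof. by rewrite /digit div0n mod0n. Qed.

Lemma digit_lt b tau i : 0 < b -> digit b tau i < b.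
Proof. exact: ltn_pmod. Qed.

(** The carry reaches position [i] exactly when [b ^ i] divides [tau.+1]. *)
Lemma digit_succ b tau i : 0 < b ->
  digit b tau.+1 i = if b ^ i %| tau.+1 then
      (if digit b tau i == b.-1 then 0 else (digit b tau i).+1) else digit b tau i.
Proof.
move=> b0; rewrite /digit divnS ?expn_gt0 ?b0 //; case: (b ^ i %| tau.+1) => //.
rewrite add1n modnS; set q := _ %/ _.
have -> // : (b %| q.+1) = (q %% b == b.-1).
rewrite {1}(divn_eq q b) -addnS dvdn_addr ?dvdn_mull //.
have := ltn_pmod q b0; move: (q %% b) => {q} r rb.
case: (ltngtP r.+1 b) => h; last by rewrite -h dvdnn /= eqxx.
  by rewrite gtnNdvd //; apply/esym/eqP; nat_lia.
by nat_lia.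
Qed.

Lemma carry_succ b tau i : 0 < b ->
  (b ^ i.+1 %| tau.+1) = (b ^ i %| tau.+1) && (digit b tau i == b.-1).
Proof.
move=> b0; case h : (b ^ i %| tau.+1) => /=; last first.
  by apply: contraFF h; apply: dvdn_trans; rewrite expnS dvdn_mull.
have := digit_succ tau i b0; rewrite h.
have -> : (b ^ i.+1 %| tau.+1) = (digit b tau.+1 i == 0).
  by rewrite expnS -dvdn_divRL.
by case: ifP => // _ ->.
Qed.

(** Running through the numbers below [b ^ len] produces every assignment of
    [len] digits. *)
Lemma digits_surj b (d : nat -> nat) len : 0 < b -> (forall i, d i < b) ->
  exists2 tau, tau < b ^ len & forall i, i < len -> digit b tau i = d i.
Proof.
move=> b0; elim: len d => [|len IH] d hd; first by exists 0.
case: (IH (fun i => d i.+1)) => [i|tau lt ht]; first exact: hd.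
exists (tau * b + d 0).
  rewrite expnS mulnC; apply: (@leq_trans (b * tau.+1)).
    by rewrite mulnS addnC ltn_add2r hd.
  by rewrite leq_mul2l lt orbT.
case=> [_|i hi]; first by rewrite /digit expn0 divn1 modnMDl modn_small.
by rewrite -[RHS]ht // /digit expnS divnMA divnMDl // (divn_small (hd 0)) addn0.
Qed.

(** * Packed arrays *)

Section Packed.
Variables (N : nat) (inp : nat -> nat).

(** The list [xs] is stored in the input from position [base] on. *)
Definition at_ base (xs : seq nat) :=
  base + size xs <= N /\ forall r, r < size xs -> inp (base + r) = nth 0 xs r.

Definition start (bs : seq (seq nat)) i := (size bs).+1 + sumn (take i (shape bs)).

Lemma size_pack bs : size (pack bs) = start bs (size bs).
Proof.
rewrite /pack size_cat size_map size_iota size_flatten /start.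
by rewrite take_oversize // size_map.
Qed.

Lemma nth_pack_start bs i : i <= size bs -> nth 0 (pack bs) i = start bs i.
Proof.
move=> h; rewrite /pack nth_cat size_map size_iota ltnS h.
by rewrite (nth_map 0) ?size_iota // nth_iota.
Qed.

Lemma start_succ bs i : i < size bs -> start bs i.+1 = start bs i + size (nth [::] bs i).
Proof.
move=> h; rewrite /start (take_nth 0) ?size_map // sumn_rcons.
by rewrite (nth_map [::]) // addnA.
Qed.

Lemma start_mono bs i j : i <= j -> start bs i <= start bs j.
Proof.
move=> /subnK <-; elim: (j - i) => // m IH; rewrite addSn; apply: leq_trans IH _.
case: (ltnP (m + i) (size bs)) => h; first by rewrite start_succ // leq_addr.
by rewrite /start !take_oversize // size_map // ltnW.
Qed.

Lemma nth_pack bs i r : i < size bs -> r < size (nth [::] bs i) ->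
  nth 0 (pack bs) (start bs i + r) = nth 0 (nth [::] bs i) r.
Proof.
move=> h hr; rewrite /pack nth_cat size_map size_iota /start.
have -> : ((size bs).+1 + sumn (take i (shape bs)) + r < (size bs).+1) = false by nat_lia.
have -> : (size bs).+1 + sumn (take i (shape bs)) + r - (size bs).+1 =
  sumn (take i (shape bs)) + r by nat_lia.
have -> : flatten bs = flatten (take i bs) ++ flatten (drop i bs).
  by rewrite -flatten_cat cat_take_drop.
rewrite nth_cat size_flatten /shape map_take.
have -> : (sumn (take i [seq size i | i <- bs]) + r < sumn (take i [seq size i | i <- bs])) = false by nat_lia.
by rewrite addKn (drop_nth [::] h) /= nth_cat hr.
Qed.

(** What the table in front of a packed array is for: the position and the size
    of a block are obtained by two readings. *)
Lemma at_pack base bs i : at_ base (pack bs) -> i < size bs ->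
  [/\ base + i.+1 < N, inp (base + i) = start bs i,
      inp (base + i.+1) = start bs i + size (nth [::] bs i) &
      at_ (base + start bs i) (nth [::] bs i)].
Proof.
move=> [h1 h2] hi; move: (size_pack bs) (start_mono bs hi) (start_succ hi) => e1 e2 e3.
have hs : (size bs).+1 <= size (pack bs) by rewrite e1 /start leq_addr.
split.
- by nat_lia.
- by rewrite h2 ?nth_pack_start; try nat_lia.
- by rewrite h2 ?nth_pack_start //; nat_lia.
- have e4 := start_mono bs (ltnW hi).
  have e5 : start bs i.+1 <= start bs (size bs) by apply: start_mono.
  split; first by nat_lia.
  by move=> r hr; rewrite -addnA h2 ?nth_pack //; nat_lia.
Qed.

End Packed.

Section Rules.
Variables (N B : nat) (inp : nat -> nat).
Hypothesis B3 : 2 < B.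
Local Notation wp := (wp N B inp).

Local Notation at_ := (at_ N inp).

Let B1 : 1 < B. Proof. exact: ltnW B3. Qed.

Definition evs ms e v := safe N B inp ms e /\ ev inp ms e = v.

Lemma evs_K ms c : c < B -> evs ms (K c) c.
Proof. by []. Qed.

Lemma evs_R ms x v : rg ms x = v -> evs ms (R x) v.
Proof. by []. Qed.

Lemma evs_In ms e a v : evs ms e a -> a < N -> inp a = v -> evs ms (In e) v.
Proof. by move=> [h1 h2] h3 h4; split=> /=; rewrite h2. Qed.

Lemma evs_A ms j e i v : evs ms e i -> ar ms j i = v -> evs ms (A j e) v.
Proof. by move=> [h1 h2] h3; split=> //=; rewrite h2. Qed.

Lemma evs_add ms a b va vb : evs ms a va -> evs ms b vb -> va + vb < B ->
  evs ms (O Add a b) (va + vb).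
Proof. by move=> [h1 h2] [h3 h4] h5; split=> /=; rewrite h2 h4. Qed.

Lemma evs_mul ms a b va vb : evs ms a va -> evs ms b vb -> va * vb < B ->
  evs ms (O Mul a b) (va * vb).
Proof. by move=> [h1 h2] [h3 h4] h5; split=> /=; rewrite h2 h4. Qed.

Lemma evs_sub ms a b va vb : evs ms a va -> evs ms b vb ->
  evs ms (O Defs.Sub a b) (va - vb).
Proof. by move=> [h1 h2] [h3 h4]; split=> /=; rewrite ?h2 ?h4. Qed.

Lemma evs_lt ms a b va vb : evs ms a va -> evs ms b vb ->
  evs ms (O Lt a b) (va < vb).
Proof. by move=> [h1 h2] [h3 h4]; split=> /=; rewrite ?h2 ?h4. Qed.

Lemma evs_eq ms a b va vb : evs ms a va -> evs ms b vb ->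
  evs ms (O Eq a b) (va == vb).
Proof. by move=> [h1 h2] [h3 h4]; split=> /=; rewrite ?h2 ?h4. Qed.

Definition And a b := O Mul a b.
Definition Or a b := O Lt (K 0) (O Add a b).
Definition Not a := O Eq a (K 0).

Lemma evs_and ms a b (va vb : bool) : evs ms a va -> evs ms b vb ->
  evs ms (And a b) (va && vb).
Proof.
move=> h1 h2; rewrite -mulnb; apply: evs_mul => //.
by move: va vb {h1 h2} => [] []; nat_lia.
Qed.

Lemma evs_or ms a b (va vb : bool) : evs ms a va -> evs ms b vb ->
  evs ms (Or a b) (va || vb).
Proof.
move=> h1 h2; have -> : (va || vb : nat) = (0 < va + vb) :> nat by case: va vb {h1 h2} => [] [].
apply: evs_lt; first by apply: evs_K; nat_lia.
by apply: evs_add => //; move: va vb {h1 h2} => [] []; nat_lia.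
Qed.

Lemma evs_not ms a (va : bool) : evs ms a va -> evs ms (Not a) (~~ va).
Proof.
move=> h; have -> : (~~ va : nat) = ((va : nat) == 0) :> nat by case: va h.
by apply: evs_eq => //; apply: evs_K; nat_lia.
Qed.

Lemma wp_set_val x e v Q t ms : evs ms e v ->
  Q (t + (ecost e).+1) (setr ms x v) -> wp (CSet x e) Q t ms.
Proof. by move=> [h <-] q; apply: wp_set. Qed.

Lemma wp_put_val j a e i v Q t ms : evs ms a i -> evs ms e v ->
  Q (t + (ecost a + 6 + ecost e).+1) (seta ms j i v) ->
  wp (CPut j a e) Q t ms.
Proof. by move=> [h <-] [h' <-] q; apply: wp_put. Qed.

Lemma wp_if_val e c1 c2 (b : bool) Q t ms : evs ms e b ->
  (b -> wp c1 Q (t + (ecost e).+1) ms) ->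
  (~~ b -> wp c2 Q (t + (ecost e).+1) ms) ->
  wp (CIf e c1 c2) Q t ms.
Proof.
move=> [h e1] h1 h2; apply: (wp_if B1); first exact: h.
  by move=> n; apply: h1; case: b e1 n {h2} => // ->.
by move=> n; apply: h2; case: b e1 n {h1} => // ->.
Qed.

Lemma wp_for_var x y body Q t ms m (D : nat -> nat) (I : nat -> mst -> Prop) :
  [&& x \notin mods body & y \notin x :: mods body] ->
  (forall i ms v, I i ms -> I i (setr ms x v)) ->
  rg ms y = m -> m < B -> I 0 ms ->
  (forall i t' ms', i < m -> rg ms' x = i ->
     frame (x :: mods body) (amods body) ms ms' -> I i ms' ->
     wp body (fun t'' ms'' => t'' <= t' + D i /\ I i.+1 ms'') t' ms') ->
  (forall t' ms', frame (x :: mods body) (amods body) ms ms' ->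
     t' <= t + 6 + \sum_(i < m) (D i + 8) ->
     I m ms' -> Q t' ms') ->
  wp (For x y body) Q t ms.
Proof.
move=> /andP[hx hy] st hm mB I0 hb hq.
apply: (wp_for_cost B1 (D := D) (I := I) hx hy hm mB) => //; first exact: st.
move=> i t' ms' im xi F Ii; apply: wp_mono (hb i t' ms' im xi F Ii) _.
by move=> t2 ms2 _ [h1 h2]; split=> //; apply: st.
Qed.

Lemma wp_for_const x y body Q t ms m (D : nat) (I : nat -> mst -> Prop) :
  [&& x \notin mods body & y \notin x :: mods body] ->
  (forall i ms v, I i ms -> I i (setr ms x v)) ->
  rg ms y = m -> m < B -> I 0 ms ->
  (forall i t' ms', i < m -> rg ms' x = i ->
     frame (x :: mods body) (amods body) ms ms' -> I i ms' ->
     wp body (fun t'' ms'' => t'' <= t' + D /\ I i.+1 ms'') t' ms') ->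
  (forall t' ms', frame (x :: mods body) (amods body) ms ms' ->
     t' <= t + 6 + m * (D + 8) ->
     I m ms' -> Q t' ms') ->
  wp (For x y body) Q t ms.
Proof.
move=> h st hm mB I0 hb hq.
apply: (wp_for_var (D := fun=> D) (I := I) h st hm mB I0 hb) => t' ms' F le.
by apply: hq => //; move: le; rewrite sum_nat_const card_ord.
Qed.

(** The body is run with [x] set to the entry of rank [r] of block [idx] of the
    packed array at [base]. *)
Definition ForBlock (base idx : iexp) (rst rlen r x : nat) (body : com) : com :=
  CSet rst (O Add base (In (O Add base idx))) ;;;
  CSet rlen (O Defs.Sub (In (O Add (O Add base idx) (K 1))) (In (O Add base idx))) ;;;
  For r rlen (CSet x (In (O Add (R rst) (R r))) ;;; body).

Definition block_regs_ok (rst rlen r x : nat) (body : com) :=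
  uniq [:: rst; rlen; r; x] && all [predC mods body] [:: rst; rlen; r].

Lemma wp_ForBlockD base idx rst rlen r x body Q t ms b bs j (D : nat -> nat)
    (I : nat -> mst -> Prop) :
  N < B ->
  block_regs_ok rst rlen r x body ->
  (forall i ms y v, y \in [:: rst; rlen; r; x] -> I i ms -> I i (setr ms y v)) ->
  evs ms base b -> evs ms idx j ->
  (forall v, evs (setr ms rst v) base b) -> (forall v, evs (setr ms rst v) idx j) ->
  at_ b (pack bs) -> j < size bs -> I 0 ms ->
  (forall i t' ms', i < size (nth [::] bs j) -> rg ms' r = i ->
     rg ms' x = nth 0 (nth [::] bs j) i ->
     frame (rst :: rlen :: r :: x :: mods body) (amods body) ms ms' -> I i ms' ->
     wp body (fun t'' ms'' => t'' <= t' + D i /\ I i.+1 ms'') t' ms') ->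
  (forall t' ms', frame (rst :: rlen :: r :: x :: mods body) (amods body) ms ms' ->
     t' <= t + (4 * ecost base + 3 * ecost idx + 22) + \sum_(i < size (nth [::] bs j)) (D i + 13) ->
     I (size (nth [::] bs j)) ms' -> Q t' ms') ->
  wp (ForBlock base idx rst rlen r x body) Q t ms.
Proof.
move=> NB ok st eb ei eb' ei' hat hj I0 hb hq.
have [a1 a2 a3 [a4 a5]] := at_pack hat hj.
set l := nth [::] bs j in hb hq a3 a4 a5 *.
move: ok => /andP[un /and4P[/= m1 m2 m3 _]].
apply: wp_seq; apply: (@wp_set_val _ _ (b + start bs j)).
  apply: evs_add => //; last by nat_lia.
  apply: (@evs_In _ _ (b + j)) => //; [apply: evs_add => //|]; nat_lia.
apply: wp_seq; apply: (@wp_set_val _ _ (size l)).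
  have -> : size l = (start bs j + size l) - start bs j by nat_lia.
  apply: evs_sub.
    apply: (@evs_In _ _ (b + j + 1)) => //; last by rewrite -addnA addn1.
      by apply: evs_add; [apply: evs_add => //|apply: evs_K|]; nat_lia.
    by nat_lia.
  apply: (@evs_In _ _ (b + j)) => //; last by nat_lia.
  by apply: evs_add => //; nat_lia.
set ms1 := setr _ rlen _.
move: un; rewrite /= !inE !negb_or => /and3P[/and3P[u1 u2 u3] /andP[u4 u5] /andP[u6 _]].
have F1 : frame (rst :: rlen :: r :: x :: mods body) (amods body) ms ms1.
  split=> // y; rewrite !inE !negb_or => /and5P[y1 y2 _ _ _] /=.
  by rewrite !upd_neq 1?eq_sym.
have s1 : rg ms1 rst = b + start bs j by rewrite /= upd_neq 1?eq_sym // upd_same.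
apply: (wp_for_var (D := fun i => D i + 5) (I := I) _ _ _ _ _ _ _ (m := size l)).
- by rewrite /= !inE !negb_or u6 m3 m2 u4 u5.
- by move=> i ms2 v; apply: st; rewrite !inE eqxx !orbT.
- by rewrite /= upd_same.
- by nat_lia.
- by apply: (st); rewrite ?inE ?eqxx ?orbT //; apply: (st); rewrite ?inE ?eqxx ?orbT.
- move=> i t' ms' il ri F Ii.
  have F2 : frame (rst :: rlen :: r :: x :: mods body) (amods body) ms1 ms'.
    by apply: (frame_sub F) => // y; rewrite !inE => /or3P[]->; rewrite ?orbT.
  have rr : rg ms' rst = b + start bs j.
    by rewrite F.1 // !inE !negb_or u2 u3 m1.
  apply: wp_seq; apply: (@wp_set_val _ _ (nth 0 l i)).
    apply: (@evs_In _ _ (b + start bs j + i)); [|nat_lia|exact: a5].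
    by apply: evs_add; [apply: evs_R|apply: evs_R|nat_lia].
  apply: wp_mono (hb i _ _ il _ _ _ _) _.
  + by rewrite /= upd_neq // eq_sym.
  + by rewrite /= upd_same.
  + apply: (frame_trans F1); apply: (frame_trans F2); split=> // y.
    rewrite !inE !negb_or => /and5P[_ _ _ y1 _] /=.
    by rewrite upd_neq // eq_sym.
  + by apply: st; rewrite ?inE ?eqxx ?orbT.
  + by move=> t2 ms2 _ [h1 h2]; split=> //; move: h1; cost_lia.
- move=> t' ms' F le Im; apply: hq => //.
    apply: (frame_trans F1); apply: (frame_sub F) => // y.
    by rewrite !inE => /or3P[]->; rewrite ?orbT.
  move: le; under eq_bigr do rewrite -addnA.
  move: (\sum_(_ < _) _) => Z.
  have q1 : ecost (O Add base (In (O Add base idx))) = 2 * ecost base + ecost idx + 3.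
    by rewrite /ecost /=; nat_lia.
  have q2 : ecost (O Defs.Sub (In (O Add (O Add base idx) (K 1))) (In (O Add base idx))) =
     2 * ecost base + 2 * ecost idx + 7.
    by rewrite /ecost /=; nat_lia.
  by rewrite q1 q2; nat_lia.
Qed.

Lemma wp_ForBlock base idx rst rlen r x body Q t ms b bs j (D : nat)
    (I : nat -> mst -> Prop) :
  N < B ->
  block_regs_ok rst rlen r x body ->
  (forall i ms y v, y \in [:: rst; rlen; r; x] -> I i ms -> I i (setr ms y v)) ->
  evs ms base b -> evs ms idx j ->
  (forall v, evs (setr ms rst v) base b) -> (forall v, evs (setr ms rst v) idx j) ->
  at_ b (pack bs) -> j < size bs -> I 0 ms ->
  (forall i t' ms', i < size (nth [::] bs j) -> rg ms' r = i ->
     rg ms' x = nth 0 (nth [::] bs j) i ->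
     frame (rst :: rlen :: r :: x :: mods body) (amods body) ms ms' -> I i ms' ->
     wp body (fun t'' ms'' => t'' <= t' + D /\ I i.+1 ms'') t' ms') ->
  (forall t' ms', frame (rst :: rlen :: r :: x :: mods body) (amods body) ms ms' ->
     t' <= t + (4 * ecost base + 3 * ecost idx + 22) + size (nth [::] bs j) * (D + 13) ->
     I (size (nth [::] bs j)) ms' -> Q t' ms') ->
  wp (ForBlock base idx rst rlen r x body) Q t ms.
Proof.
move=> NB ok st eb ei eb' ei' hat hj I0 hb hq.
apply: (wp_ForBlockD (D := fun=> D) NB ok st eb ei eb' ei' hat hj I0 hb) => t' ms' F le.
by apply: hq => //; move: le; rewrite sum_nat_const card_ord.
Qed.

(** * Exhaustive search *)

(** The assignments of digits are too many to be counted in a word. So the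
    digits, each at most the value of register [rtop], are kept in array [aD],
    and incremented with a carry until it leaves the last digit. *)
Definition Odometer aD rlen rtop ri rc rgo body :=
  For ri rlen (CPut aD (R ri) (K 0)) ;;;
  CSet rgo (K 1) ;;;
  CLoop (R rgo)
    (body ;;;
     CSet rc (K 1) ;;;
     For ri rlen
       (CIf (R rc)
          (CIf (O Eq (A aD (R ri)) (R rtop))
             (CPut aD (R ri) (K 0))
             (CPut aD (R ri) (O Add (A aD (R ri)) (K 1)) ;;; CSet rc (K 0)))
          CSkip) ;;;
     CSet rgo (Not (R rc))).

Definition odo_ok aD rlen rtop ri rc rgo rf body :=
  [&& uniq [:: ri; rc; rgo; rf; rlen; rtop],
      all [predC mods body] [:: rgo; rlen; rtop] & aD \notin amods body].

(** After [tau] rounds the digits are those of [tau]. *)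
Lemma wp_Odometer aD rlen rtop ri rc rgo rf body Q t ms len top Db (test : nat -> bool) :
  let c := Odometer aD rlen rtop ri rc rgo body in
  odo_ok aD rlen rtop ri rc rgo rf body ->
  rg ms rlen = len -> rg ms rtop = top -> len < B -> top.+1 < B -> rg ms rf = 0 ->
  (forall tau t' ms' (x : bool), tau < top.+1 ^ len -> frame (mods c) (amods c) ms ms' ->
     (forall i, i < len -> ar ms' aD i = digit top.+1 tau i) -> rg ms' rf = x ->
     wp body (fun t'' ms'' => t'' <= t' + Db /\ rg ms'' rf = x || test tau) t' ms') ->
  (forall t' ms', frame (mods c) (amods c) ms ms' ->
     t' <= t + 20 + 20 * len + top.+1 ^ len * (Db + 16 + len * 48) ->
     rg ms' rf = has test (iota 0 (top.+1 ^ len)) -> Q t' ms') ->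
  wp c Q t ms.
Proof.
move=> c ok elen etop lenB topB rf0 hb hq.
suff : wp c (fun t' ms' => t' <= t + 20 + 20 * len + top.+1 ^ len * (Db + 16 + len * 48) /\
    rg ms' rf = has test (iota 0 (top.+1 ^ len))) t ms.
  by move=> h; apply: wp_mono h _ => t' ms' F [h1 h2]; apply: hq.
have {}hq := I.
move: ok => /and3P[un /and4P[/= m1 m2 m3 _] m4].
move: un; rewrite /= !inE !negb_or => /and5P[/and5P[u1 u2 u3 u4 u5] /and4P[u6 u7 u8 u9]
  /and3P[v1 v2 v3] /andP[v4 v5] /andP[v6 _]].
have mc y : (y \in mods c) = [|| y == ri, y == rc, y == rgo | y \in mods body].
  rewrite /c /= !inE !mem_cat !inE.
  by case: (y == ri); case: (y == rc); case: (y == rgo); rewrite ?orbT ?orbF.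
have ac y : (y \in amods c) = (y == aD) || (y \in amods body).
  rewrite /c /= !inE !mem_cat !inE.
  by case: (y == aD); rewrite ?orbT ?orbF.
have fri a v : frame (mods c) (amods c) a (setr a ri v) by apply: frame_setr; rewrite mc eqxx.
have frc a v : frame (mods c) (amods c) a (setr a rc v) by apply: frame_setr; rewrite mc eqxx ?orbT.
have frgo a v : frame (mods c) (amods c) a (setr a rgo v) by apply: frame_setr; rewrite mc eqxx ?orbT.
have fra a i v : frame (mods c) (amods c) a (seta a aD i v) by apply: frame_seta; rewrite ac eqxx.
have frb a b : frame (mods body) (amods body) a b -> frame (mods c) (amods c) a b.
  by move=> h; apply: (frame_sub h) => y hy; rewrite ?mc ?ac hy ?orbT.
have fR ms' x : frame (mods c) (amods c) ms ms' -> x \notin mods body ->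
    x \notin [:: ri; rc; rgo] -> rg ms' x = rg ms x.
  move=> F h; rewrite !inE !negb_or => /and3P[n1 n2 n3]; apply: F.1.
  by rewrite mc !negb_or n1 n2 n3 h.
have len2 ms' : frame (mods c) (amods c) ms ms' -> rg ms' rlen = len.
  move=> F; rewrite (fR _ _ F) ?elen // !inE !negb_or.
  by rewrite ![rlen == _]eq_sym u4 u8 v2.
have top2 ms' : frame (mods c) (amods c) ms ms' -> rg ms' rtop = top.
  move=> F; rewrite (fR _ _ F) ?etop // !inE !negb_or.
  by rewrite ![rtop == _]eq_sym u5 u9 v3.
apply: wp_seq.
apply: (wp_for_const (D := 9) (m := len)
    (I := fun i ms' => [/\ forall j, j < i -> ar ms' aD j = 0, rg ms' rf = 0 &
           frame (mods c) (amods c) ms ms'])).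
- by rewrite /= !inE eq_sym.
- move=> i ms1 v [h1 h2 h3]; split=> //; first by rewrite /= upd_neq.
  exact: frame_trans h3 (fri _ _).
- exact: elen.
- exact: lenB.
- by split.
- move=> i t' ms' il ri_i F [h1 h2 h3].
  apply: (wp_put_val (i := i) (v := 0)); [exact: evs_R|apply: evs_K; nat_lia|].
  split; first by cost_lia.
  split=> //; last exact: frame_trans h3 (fra _ _ _).
  move=> j hj /=; rewrite upd_same; case: (eqVneq i j) => [->|n]; first by rewrite upd_same.
  by rewrite upd_neq // h1 //; move: hj n; clear; lia.
move=> t1 ms1 _ le1 [d0 rf1 F1].
apply: wp_seq; apply: (wp_set_val (v := 1)); first by apply: evs_K; nat_lia.
have {}F1 := frame_trans F1 (frgo ms1 1).
set c1 := CLoop _ _.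
(* [d] is the number of rounds left. *)
suff H d tau t2 ms2 : tau + d = top.+1 ^ len -> frame (mods c) (amods c) ms ms2 ->
   (d > 0 -> forall i, i < len -> ar ms2 aD i = digit top.+1 tau i) ->
   rg ms2 rf = has test (iota 0 tau) -> rg ms2 rgo = (0 < d) ->
   wp c1 (fun t' ms' => t' <= t2 + 2 + d * (Db + 16 + len * 48) /\
     rg ms' rf = has test (iota 0 (top.+1 ^ len))) t2 ms2.
  have := H (top.+1 ^ len) 0 (t1 + (ecost (K 1)).+1) (setr ms1 rgo 1) (add0n _) F1.
  rewrite /= !upd_same expn_gt0 /= upd_neq // => w.
  apply: wp_mono (w _ rf1 erefl) _; first by move=> _ i il; rewrite digit0 d0.
  move=> t' ms' _ [h1 h2]; split=> //; move: h1 le1; rewrite /ecost /=.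
  by move: (top.+1 ^ len * _) => Z; clear; lia.
elim: d tau t2 ms2 => [|d IH] tau t2 ms2 etau F2 hd hf hgo.
  apply: wp_loop_end => //=; split; last by rewrite hf -etau addn0.
  by cost_lia.
apply: wp_loop_step => //=; first by rewrite hgo.
rewrite [ecost _]/=.
have ltau : tau < top.+1 ^ len by rewrite -etau; nat_lia.
apply: wp_seq; apply: wp_mono (hb tau (t2 + 2) ms2 _ ltau F2 (hd isT) hf) _.
move=> t3 ms3 Fb [le3 hf3].
have {Fb} [F3 D3] : frame (mods c) (amods c) ms ms3 /\
    (forall i, i < len -> ar ms3 aD i = digit top.+1 tau i).
  split; last by move=> i il; rewrite Fb.2 // hd.
  exact: frame_trans F2 (frb _ _ Fb).
apply: wp_seq; apply: (wp_set_val (v := 1)); first by apply: evs_K; nat_lia.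
set ms4 := setr _ _ _.
have F4 : frame (mods c) (amods c) ms ms4 by exact: frame_trans F3 (frc _ _).
apply: wp_seq.
apply: (wp_for_const (D := 40) (m := len) (I := fun i ms' =>
  [/\ frame (mods c) (amods c) ms ms', rg ms' rf = rg ms3 rf,
   rg ms' rc = (top.+1 ^ i %| tau.+1) &
   forall j, j < len -> ar ms' aD j = digit top.+1 (if j < i then tau.+1 else tau) j])).
- by rewrite /= !inE !negb_or u1 /= ![rlen == _]eq_sym u4 u8.
- move=> i ms' v [G1 G2 G3 G4]; split=> //=.
  + exact: frame_trans G1 (fri _ _).
  + by rewrite upd_neq.
  + by rewrite upd_neq.
- exact: len2 F4.
- by [].
- split=> //.
  + by rewrite /= upd_neq.
  + by rewrite /= upd_same expn0 dvd1n.
- move=> i t' ms' il ri_i F [G1 G2 G3 G4].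
  have fput v : frame (mods c) (amods c) ms (seta ms' aD i v).
    exact: frame_trans G1 (fra _ _ _).
  have Di : ar ms' aD i = digit top.+1 tau i by rewrite G4 // ltnn.
  have dlt : digit top.+1 tau i < top.+1 by apply: digit_lt.
  have Dput v : v = digit top.+1 tau.+1 i -> forall j, j < len ->
     ar (seta ms' aD i v) aD j = digit top.+1 (if j < i.+1 then tau.+1 else tau) j.
    move=> -> j jl /=; rewrite upd_same ltnS leq_eqVlt.
    case: (eqVneq j i) => [->|n] /=; first by rewrite upd_same.
    by rewrite upd_neq 1?eq_sym // G4.
  have ds := @digit_succ top.+1 tau i isT; rewrite /= in ds.
  have cs := @carry_succ top.+1 tau i isT; rewrite /= in cs.
  apply: (wp_if_val (b := (top.+1 ^ i %| tau.+1))); first exact: evs_R.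
    move=> cry; rewrite cry in ds cs.
    apply: (wp_if_val (b := digit top.+1 tau i == top)).
      apply: evs_eq; last by apply: evs_R; exact: top2 G1.
      by apply: (evs_A (i := i)); [exact: evs_R|exact: Di].
    + move=> dt; rewrite dt in ds cs.
      apply: (wp_put_val (i := i) (v := 0)); [exact: evs_R|apply: evs_K; nat_lia|].
      split; first by cost_lia.
      split=> //; last exact: Dput.
      by rewrite /= G3 cry cs.
    + move=> dt; rewrite (negbTE dt) in ds cs.
      apply: wp_seq; apply: (wp_put_val (i := i) (v := digit top.+1 tau i + 1)); first exact: evs_R.
        apply: evs_add; [|apply: evs_K; nat_lia|nat_lia].
        by apply: (evs_A (i := i)); [exact: evs_R|exact: Di].
      apply: (wp_set_val (v := 0)); first by apply: evs_K; nat_lia.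
      split; first by cost_lia.
      split=> /=.
      * exact: frame_trans (fput _) (frc _ _).
      * by rewrite upd_neq.
      * by rewrite upd_same cs.
      * by apply: Dput; rewrite ds addn1.
  move=> ncry; rewrite (negbTE ncry) in ds cs.
  apply: wp_skip; split; first by cost_lia.
  split=> //; first by rewrite G3 (negbTE ncry) cs.
  move=> j jl; rewrite G4 // ltnS [j <= i]leq_eqVlt; case: (eqVneq j i) => [->|//] /=.
  by rewrite ltnn ds.
move=> t5 ms5 _ le5 [G1 G2 G3 G4].
have Z0 : (top.+1 ^ len %| tau.+1) = (d == 0).
  apply/idP/eqP => [h|d0']; last by rewrite d0' addn1 in etau; rewrite etau.
  by move: (dvdn_leq (ltn0Sn tau) h) => h'; nat_lia.
apply: (wp_set_val (v := (0 < d))).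
  by have -> : (0 < d) = ~~ (d == 0) by [case: d {IH etau hgo hd Z0}]; apply: (evs_not (va := d == 0)); apply: evs_R; rewrite G3 Z0.
have le6 : t5 + (ecost (Not (R rc))).+1 <= t2 + (Db + 16 + len * 48).
  by move: le5 le3; rewrite /ecost /=; move: (len * _) => Z; clear; lia.
set t6 := t5 + _ in le6 *.
apply: wp_mono (IH tau.+1 t6 _ _ _ _ _ _) _.
- by rewrite -etau addSnnS.
- exact: frame_trans G1 (frgo _ _).
- by move=> _ i il; rewrite /= G4 // il.
- rewrite -(addn1 tau) iotaD has_cat /= add0n orbF -hf3 -G2.
  by rewrite upd_neq.
- by rewrite /= upd_same.
- move=> t' ms' _ [h1 h2]; split=> //; rewrite mulSn.
  by move: h1 le6; move: (Db + 16 + len * 48) => Z; move: (d * Z) => Z'; clear; lia.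
Qed.

End Rules.

(** * Registers and arrays of the program *)

Notation rAns := 0 (only parsing).
Notation rn := 2 (only parsing).
Notation rp := 3 (only parsing).
Notation rk := 4 (only parsing).
Notation rM := 5 (only parsing).
Notation rAdj := 6 (only parsing).
Notation rBag := 7 (only parsing).
Notation rNbr := 8 (only parsing).
Notation rBnd := 9 (only parsing).
Notation rS := 10 (only parsing).
Notation rT := 11 (only parsing).
Notation rU := 12 (only parsing).
Notation rj := 13 (only parsing).
Notation rb := 14 (only parsing).
Notation ri := 15 (only parsing).
Notation rst := 16 (only parsing).
Notation rlen := 17 (only parsing).
Notation rr := 18 (only parsing).
Notation rx := 19 (only parsing).
Notation rst2 := 20 (only parsing).
Notation rlen2 := 21 (only parsing).
Notation rr2 := 22 (only parsing).
Notation rx2 := 23 (only parsing).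
Notation ra := 24 (only parsing).
Notation rqt := 25 (only parsing).
Notation rh := 26 (only parsing).
Notation rcur := 27 (only parsing).
Notation rw := 28 (only parsing).
Notation ru := 29 (only parsing).
Notation rv := 30 (only parsing).
Notation rok := 31 (only parsing).
Notation rval := 32 (only parsing).
Notation rm := 33 (only parsing).
Notation rfound := 34 (only parsing).
Notation rgood := 35 (only parsing).
Notation rii := 36 (only parsing).
Notation rcar := 37 (only parsing).
Notation rgo := 38 (only parsing).
Notation rii2 := 39 (only parsing).
Notation rcar2 := 40 (only parsing).
Notation rgo2 := 41 (only parsing).
Notation rq := 42 (only parsing).
Notation rq2 := 43 (only parsing).
Notation re := 44 (only parsing).
Notation ro := 45 (only parsing).
Notation rbase := 46 (only parsing).
Notation rM1 := 47 (only parsing).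

(** [aU]: the bits of the domains. [aBG], [aPAR]: the bag of a vertex, the parent
    of a bag. [aQ]: the queue of the breadth-first search. [aX]: the bit of each
    path and bag that tells whether the edge above the bag is crossed. [aG]: the
    digits of the middles, with [aCN] and [aCV] the sizes and the entries of the
    lists to which they refer. [aH], [aSN], [aSV]: the same for the slots of the
    current bag, and [aSO] the paths of these slots. *)
Notation aU := 0 (only parsing).
Notation aBG := 1 (only parsing).
Notation aPAR := 2 (only parsing).
Notation aQ := 3 (only parsing).
Notation aX := 4 (only parsing).
Notation aG := 5 (only parsing).
Notation aCN := 6 (only parsing).
Notation aCV := 7 (only parsing).
Notation aSO := 8 (only parsing).
Notation aSN := 9 (only parsing).
Notation aSV := 10 (only parsing).
Notation aH := 11 (only parsing).

(** * Auxiliary facts for the loops *)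

Lemma all_pack m bs : all (fun b => all (fun x => x <= m) b) bs -> size (pack bs) <= m ->
  all (fun x => x <= m) (pack bs).
Proof.
move=> h hs; rewrite /pack all_cat; apply/andP; split; last first.
  by elim: bs h {hs} => //= b bs IH /andP[hb h]; rewrite all_cat hb IH.
apply/allP => x /mapP[i]; rewrite mem_iota => /andP[_ hi] ->.
apply: leq_trans hs; rewrite size_pack -/(start bs i).
by apply: start_mono; rewrite -ltnS.
Qed.

Lemma size_pack_block b bs : b \in bs -> size b <= size (pack bs).
Proof.
move=> /(nthP [::])[i hi <-]; rewrite size_pack.
apply: leq_trans (start_mono bs hi); by rewrite start_succ // leq_addl.
Qed.

Lemma size_pack_gt bs : size bs < size (pack bs).
Proof. by rewrite size_pack /start; nat_lia. Qed.

Lemma idx_inj b i j i' j' : j < b -> j' < b -> i * b + j = i' * b + j' ->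
  i = i' /\ j = j'.
Proof.
move=> hj hj' E; have b0 : 0 < b by apply: leq_ltn_trans hj.
have := congr1 (fun x => x %/ b) E; have := congr1 (fun x => x %% b) E.
by rewrite /= !modnMDl !divnMDl // !modn_small // !divn_small // !addn0.
Qed.

Lemma ltS_eqVlt a b : (a < b.+1) = (a == b) || (a < b).
Proof. by rewrite ltnS leq_eqVlt. Qed.

Lemma mem_take_succ (A : eqType) (x0 : A) (l : seq A) r x : r < size l ->
  (x \in take r.+1 l) = (x \in take r l) || (x == nth x0 l r).
Proof. by move=> h; rewrite (take_nth x0) // mem_rcons inE orbC. Qed.

(** Entries are shifted by one: 0 marks the bags not visited yet. *)
Definition parent_array p (par : 'I_p -> 'I_p) (a : nat -> nat) :=
  forall c : 'I_p, a c = (val (par c : 'I_p)).+1.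

Definition bag_array n p (bg : 'I_n -> 'I_p) (a : nat -> nat) := forall v : 'I_n, a v = bg v.

Lemma exists_ltS k i (ik : i < k) (P : pred 'I_k) :
  [exists j : 'I_k, (j < i.+1) && P j] = [exists j : 'I_k, (j < i) && P j] || P (Ordinal ik).
Proof.
apply/existsP/orP => [[j /andP[]]|[/existsP[j /andP[h1 h2]]|h]].
- rewrite ltS_eqVlt => /orP[/eqP E|h] Pj; last by left; apply/existsP; exists j; rewrite h.
  by right; move: Pj; congr P; apply: val_inj.
- by exists j; rewrite ltnS ltnW.
- by exists (Ordinal ik); rewrite ltnSn.
Qed.

Lemma exists_lt0 k (P : pred 'I_k) : [exists j : 'I_k, (j < 0) && P j] = false.
Proof. by apply/existsP => -[]. Qed.

Lemma exists_ltT k (P : pred 'I_k) : [exists j : 'I_k, (j < k) && P j] = [exists j, P j].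
Proof. by apply: eq_existsb => j; rewrite ltn_ord. Qed.

Lemma forall_ltS k i (ik : i < k) (P : pred 'I_k) :
  [forall j : 'I_k, (j < i.+1) ==> P j] = [forall j : 'I_k, (j < i) ==> P j] && P (Ordinal ik).
Proof.
apply/forallP/andP => [h|[/forallP h1 h2] j].
  split; last by have := h (Ordinal ik); rewrite ltnSn.
  by apply/forallP => j; apply/implyP => ji; have /implyP := h j; apply; apply: ltnW.
rewrite ltS_eqVlt; apply/implyP => /orP[/eqP E|ji]; last exact: implyP (h1 j) ji.
by move: h2; congr P; apply: val_inj.
Qed.

Lemma forall_lt0 k (P : pred 'I_k) : [forall j : 'I_k, (j < 0) ==> P j].
Proof. by apply/forallP. Qed.

Lemma forall_ltT k (P : pred 'I_k) : [forall j : 'I_k, (j < k) ==> P j] = [forall j, P j].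
Proof. by apply: eq_forallb => j; rewrite ltn_ord. Qed.

Lemma take_filter_rcons (A : Type) M (P : pred A) (l : seq A) x :
  take M [seq y <- rcons l x | P y] =
  if P x then take M (rcons (take M [seq y <- l | P y]) x) else take M [seq y <- l | P y].
Proof.
rewrite filter_rcons; case: ifP => // _; set f := filter P l.
case: (ltnP (size f) M) => h; first by rewrite (take_oversize (ltnW h)).
rewrite -!cats1 !takel_cat //; first by rewrite take_takel.
by rewrite size_takel.
Qed.

(** * The input *)

Section Instance.
Variables (n p k : nat) (G : sgraph 'I_n) (bag : 'I_p -> {set 'I_n}) (T : sgraph 'I_p).
Variables (s t : 'I_k -> 'I_n) (U : 'I_k -> {set 'I_n}).

Definition input := encode G bag T s t U.
Definition inp := nth 0 input.
Definition N := size input.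
(** Exceeds all indices of the arrays, the largest ones being those of a table
    of [3 k] lists with at most [M] entries. *)
Definition B := N ^ 4.
Local Notation at_ := (at_ N inp).

Definition rows := [seq [seq nat_of_bool (G x y) | y <- enum 'I_n] | x <- enum 'I_n].
Definition bags := [seq ord_list (bag a) | a <- enum 'I_p].
Definition nbrs := [seq ord_list (T a) | a <- enum 'I_p].
Definition bnds a := [seq ord_list (boundary G bag a b) | b <- enum (T a)].
Definition doms := [seq ord_list (U i) | i <- enum 'I_k].
Definition blocks :=
  [:: [:: n; p; k]; pack rows; pack bags; pack nbrs;
      pack [seq pack (bnds a) | a <- enum 'I_p];
      [seq val (s i) | i <- enum 'I_k]; [seq val (t i) | i <- enum 'I_k]; pack doms].

Lemma inputE : input = pack blocks. Proof. by []. Qed.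

Definition base i := start blocks i.

Lemma at_input : at_ 0 (pack blocks).
Proof. by split. Qed.

Lemma inp_base i : i < 8 -> inp i = base i.
Proof. by move=> hi; case: (at_pack at_input (i := i) hi). Qed.

Lemma at_block i : i < 8 -> at_ (base i) (nth [::] blocks i).
Proof. by move=> hi; case: (at_pack at_input (i := i) hi). Qed.

Lemma inp_N : inp 8 = N.
Proof.
case: (at_pack at_input (i := 7) isT) => _ _ -> _.
by rewrite -start_succ // /N inputE size_pack.
Qed.

Lemma N_gt9 : 9 < N.
Proof.
have [h _] := at_block (i := 0) isT.
have : 9 <= base 0 by rewrite /base /start leq_addr.
by move: h => /=; move: (base 0) => b; nat_lia.
Qed.

Lemma base_ge9 i : 9 <= base i. Proof. by rewrite /base /start leq_addr. Qed.

Lemma at_adj : at_ (base 1) (pack rows). Proof. exact: (at_block (i := 1)). Qed.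
Lemma at_bag : at_ (base 2) (pack bags). Proof. exact: (at_block (i := 2)). Qed.
Lemma at_nbr : at_ (base 3) (pack nbrs). Proof. exact: (at_block (i := 3)). Qed.
Lemma at_bnd : at_ (base 4) (pack [seq pack (bnds a) | a <- enum 'I_p]).
Proof. exact: (at_block (i := 4)). Qed.
Lemma at_s : at_ (base 5) [seq val (s i) | i <- enum 'I_k].
Proof. exact: (at_block (i := 5)). Qed.
Lemma at_t : at_ (base 6) [seq val (t i) | i <- enum 'I_k].
Proof. exact: (at_block (i := 6)). Qed.
Lemma at_dom : at_ (base 7) (pack doms). Proof. exact: (at_block (i := 7)). Qed.

Lemma n_lt : n < N.
Proof.
have [h _] := at_adj; have := base_ge9 1; move: h.
have := size_pack_gt rows; rewrite size_map size_enum_ord.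
by move: (size (pack _)) (base 1) => x y; nat_lia.
Qed.

Lemma p_lt : p < N.
Proof.
have [h _] := at_bag; have := base_ge9 2; move: h.
have := size_pack_gt bags; rewrite size_map size_enum_ord.
by move: (size (pack _)) (base 2) => x y; nat_lia.
Qed.

Lemma k_lt : k + 9 <= N.
Proof.
have [h _] := at_s; have := base_ge9 5; move: h.
by rewrite size_map size_enum_ord; move: (base 5) => y; nat_lia.
Qed.

Lemma base_lt i : i < 8 -> base i <= N.
Proof. by move=> hi; case: (at_block hi) => h _; apply: leq_trans h; apply: leq_addr. Qed.

Lemma ord_list_lt m (A : {pred 'I_m}) : all (fun x => x < m) (ord_list A).
Proof. by apply/allP => x /mapP[y _ ->]; apply: ltn_ord. Qed.

Lemma nth_ord_list m (x0 : 'I_m) (A : {pred 'I_m}) r : r < size (ord_list A) ->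
  nth 0 (ord_list A) r = val (nth x0 (enum A) r).
Proof. by rewrite size_map => h; rewrite (nth_map x0). Qed.

Lemma ord_list_leq m M (A : {pred 'I_m}) : m <= M -> all (fun x => x <= M) (ord_list A).
Proof.
move=> h; apply: sub_all (ord_list_lt A) => x /= hx; nat_lia.
Qed.

(** Positions are at most the length of the array they point into, and the other
    entries are bits, sizes, or indices of vertices and bags. *)
Lemma inp_lt a : a < N -> inp a <= N.
Proof.
move=> ha; have : all (fun x => x <= N) input; last first.
  by move/all_nthP => /(_ 0 a ha).
have hn : n <= N := ltnW n_lt; have hp : p <= N := ltnW p_lt.
have hk : k <= N by move: k_lt; nat_lia.
have szb i : i < 8 -> size (nth [::] blocks i) <= N.
  by move=> hi; case: (at_block hi) => h _; apply: leq_trans h; apply: leq_addl.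
rewrite inputE; apply: all_pack => //.
rewrite /= hn hp hk /= andbT; apply/and5P; split.
- apply: all_pack; last exact: (szb 1).
  apply/allP => b /mapP[x _ ->]; apply/allP => v /mapP[y _ ->].
  by apply: leq_trans (leq_b1 _) _; move: N_gt9; nat_lia.
- apply: all_pack; last exact: (szb 2).
  by apply/allP => b /mapP[x _ ->]; apply: ord_list_leq.
- apply: all_pack; last exact: (szb 3).
  by apply/allP => b /mapP[x _ ->]; apply: ord_list_leq.
- apply: all_pack; last exact: (szb 4).
  apply/allP => b bin; have : size b <= N := leq_trans (size_pack_block bin) (szb 4 isT).
  move: bin => /mapP[x _ ->] hb; apply: all_pack => //.
  by apply/allP => b' /mapP[y _ ->]; apply: ord_list_leq.
apply/and3P; split.
- by apply/allP => v /mapP[y _ ->]; apply: leq_trans (ltnW (ltn_ord _)) hn.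
- by apply/allP => v /mapP[y _ ->]; apply: leq_trans (ltnW (ltn_ord _)) hn.
- apply: all_pack; last exact: (szb 7).
  by apply/allP => b /mapP[x _ ->]; apply: ord_list_leq.
Qed.

Lemma NN_B : 64 * (N * N) < B.
Proof.
rewrite /B (_ : N ^ 4 = N * N * (N * N)); last by rewrite !expnS expn0; nat_lia.
rewrite ltn_pmul2r; last by rewrite muln_gt0; move: N_gt9; nat_lia.
by apply: (@leq_trans (10 * 10)) => //; apply: leq_mul; apply: N_gt9.
Qed.

Lemma N_B : 64 * N < B.
Proof.
apply: leq_ltn_trans NN_B; rewrite leq_mul2l leq_pmulr //.
Qed.

Lemma B3 : 2 < B. Proof. by move: N_B N_gt9; nat_lia. Qed.

Lemma inp_B a : a < N -> inp a < B.
Proof. by move=> /inp_lt; move: N_B; nat_lia. Qed.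

Lemma idx_lt i j a b : i < a -> j < b -> a <= N -> b <= N -> i * b + j < B.
Proof.
move=> ia jb aN bN; apply: (@leq_ltn_trans (N * N)); last by move: NN_B; move: (N * N) => x; nat_lia.
apply: (@leq_trans (a * b)); last exact: leq_mul.
apply: (@leq_trans (i.+1 * b)); first by rewrite mulSn addnC leq_add2r ltnW.
by rewrite leq_mul2r ia orbT.
Qed.

(** Large enough for both truncations: among the entries of a list of middles,
    each path takes at most one middle or 12 slot vertices; in a bag there are
    at most [3 k] slots. *)
Definition M := 16 * k + 16.

(** The registers that are loaded once and for all. *)
Record ctx (ms : mst) : Prop := Ctx {
  c_n : rg ms rn = n; c_p : rg ms rp = p; c_k : rg ms rk = k; c_M : rg ms rM = M;
  c_adj : rg ms rAdj = base 1; c_bag : rg ms rBag = base 2; c_nbr : rg ms rNbr = base 3;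
  c_bnd : rg ms rBnd = base 4; c_s : rg ms rS = base 5; c_t : rg ms rT = base 6;
  c_U : rg ms rU = base 7 }.

Lemma ctx_fr xs js ms ms' : all (fun x => ~~ (1 < x < 13)) xs -> frame xs js ms ms' ->
  ctx ms -> ctx ms'.
Proof.
move=> h [F _] [c1 c2 c3 c4 c5 c6 c7 c8 c9 c10 c11].
have nx x : 1 < x < 13 -> x \notin xs.
  by move=> hx; apply/negP => /(allP h); rewrite hx.
by split; rewrite F // nx.
Qed.

Local Notation evs := (evs N B inp).

Lemma evs_mat ms b rb ex ey (x : nat) y bs : rg ms rb = b -> at_ b (pack bs) ->
  x < size bs -> y < size (nth [::] bs x) ->
  evs ms ex x -> evs ms ey y ->
  evs ms (In (O Add (O Add (R rb) (In (O Add (R rb) ex))) ey))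
     (nth 0 (nth [::] bs x) y).
Proof.
move=> hb hat hx hy h1 h2; have [a1 a2 a3 [a4 a5]] := at_pack hat hx.
have NB := N_B.
apply: (@evs_In _ _ _ _ _ (b + start bs x + y)); last exact: a5; last by nat_lia.
apply: evs_add => //; last by nat_lia.
apply: evs_add => //; last by nat_lia.
apply: (@evs_In _ _ _ _ _ (b + x)) => //; last by nat_lia.
by apply: evs_add => //; nat_lia.
Qed.

Definition adjE ex ey := In (O Add (O Add (R rAdj) (In (O Add (R rAdj) ex))) ey).

Lemma evs_adj ms ex ey (x y : 'I_n) : ctx ms -> evs ms ex x -> evs ms ey y ->
  evs ms (adjE ex ey) (G x y).
Proof.
move=> c h1 h2; have E : nth [::] rows x = [seq nat_of_bool (G x y) | y <- enum 'I_n].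
  by rewrite (nth_map x) ?size_enum_ord // nth_ord_enum.
have := evs_mat (c_adj c) at_adj _ _ h1 h2.
rewrite E size_map size_enum_ord (nth_map y) ?size_enum_ord // nth_ord_enum; apply=> //.
by rewrite size_map size_enum_ord.
Qed.

Definition sE e := In (O Add (R rS) e).
Definition tE e := In (O Add (R rT) e).

Lemma evs_vec ms b rb e (i : 'I_k) (f : 'I_k -> 'I_n) : rg ms rb = b ->
  at_ b [seq val (f i) | i <- enum 'I_k] -> evs ms e i ->
  evs ms (In (O Add (R rb) e)) (f i).
Proof.
move=> hb [h1 h2] he; rewrite size_map size_enum_ord in h1 h2.
have NB := N_B; have ik := ltn_ord i.
apply: (@evs_In _ _ _ _ _ (b + i)).
- by apply: evs_add => //; nat_lia.
- by nat_lia.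
- by rewrite h2 // (nth_map i) ?size_enum_ord // nth_ord_enum.
Qed.

Lemma evs_s ms e (i : 'I_k) : ctx ms -> evs ms e i -> evs ms (sE e) (s i).
Proof. by move=> c; apply: evs_vec (c_s c) at_s. Qed.

Lemma evs_t ms e (i : 'I_k) : ctx ms -> evs ms e i -> evs ms (tE e) (t i).
Proof. by move=> c; apply: evs_vec (c_t c) at_t. Qed.

Lemma nth_bags (a : 'I_p) : nth [::] bags a = ord_list (bag a).
Proof. by rewrite (nth_map a) ?size_enum_ord // nth_ord_enum. Qed.
Lemma nth_nbrs (a : 'I_p) : nth [::] nbrs a = ord_list (T a).
Proof. by rewrite (nth_map a) ?size_enum_ord // nth_ord_enum. Qed.
Lemma nth_doms (i : 'I_k) : nth [::] doms i = ord_list (U i).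
Proof. by rewrite (nth_map i) ?size_enum_ord // nth_ord_enum. Qed.

Variables (x0 : 'I_n) (bg : 'I_n -> 'I_p) (r0 : 'I_p).
Hypothesis PT : partition_tree G bag T.
Hypothesis bgP : forall v a, (v \in bag a) = (a == bg v).
Hypothesis r00 : val r0 = 0.

Local Notation wp := (wp N B inp).
Local Notation candidates := (candidates G s t U M).
Local Notation middle_of := (middle_of G s t U x0 M).
Local Notation blocked := (blocked s t).
Local Notation terminal := (terminal s t).
Local Notation slot_list := (slot_list G bag s t U).
Local Notation usable := (usable s t U).
Local Notation slots_test := (slots_test s t x0).
Local Notation clash := (clash G s t U x0 M).
Local Notation middles_test := (middles_test G s t U x0 M).
Local Notation direct_clash := (direct_clash G s t).

Let BN : 64 * (N * N) < B := NN_B.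
Let BN1 : 64 * N < B := N_B.
Let N9 : 9 < N := N_gt9.
Let nN : n < N := n_lt.
Let pN : p < N := p_lt.
Let kN : k + 9 <= N := k_lt.
Let b3 : 2 < B := B3.
Let Tac : acyclic T. Proof. by case: PT => _ []. Qed.

Let kB : k < B. Proof. by nat_lia. Qed.
Let nB : n < B. Proof. by nat_lia. Qed.
Let pB : p < B. Proof. by nat_lia. Qed.
Let N_lt_B : N < B. Proof. by nat_lia. Qed.

Lemma evs_idx ms e1 e2 r (i a j b : nat) : rg ms r = b -> i < a -> j < b ->
  a <= N -> b <= N -> evs ms e1 i -> evs ms e2 j ->
  evs ms (O Add (O Mul e1 (R r)) e2) (i * b + j).
Proof.
move=> hr ia jb aN bN h1 h2; have lt := idx_lt ia jb aN bN.
apply: evs_add => //; apply: evs_mul => //.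
by apply: leq_ltn_trans lt; rewrite leq_addr.
Qed.

(** * Domains and bags of the vertices *)

Definition MarkDomains :=
  For ri rk (ForBlock (R rU) (R ri) rst rlen rr rx
    (CPut aU (O Add (O Mul (R ri) (R rn)) (R rx)) (K 1))).

Definition domain_array (a : nat -> nat) := forall (i : 'I_k) (v : 'I_n), a (i * n + v) = (v \in U i).

Lemma wp_MarkDomains tm ms : ctx ms -> (forall i, ar ms aU i = 0) ->
  wp MarkDomains (fun t' ms' => t' <= tm + (6 + k * (62 + n * 40 + 8)) /\ domain_array (ar ms' aU)) tm ms.
Proof.
move=> c z.
apply: (wp_for_const b3 (m := k) (D := 62 + n * 40)
  (I := fun i ms' => forall (i' : 'I_k) (v : 'I_n),
     ar ms' aU (i' * n + v) = (i' < i) && (v \in U i'))) => //.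
- exact: c_k c.
- move=> i t' ms' ik ri_i F Ii.
  have c' : ctx ms' by apply: ctx_fr F c.
  have sz : size (nth [::] doms i) <= n.
    rewrite (nth_doms (Ordinal ik)) size_map -cardE.
    by apply: leq_trans (max_card _) _; rewrite card_ord.
  apply: (wp_ForBlock b3 (D := 20) (j := i) (bs := doms) (b := base 7)
    (I := fun r ms'' => forall (i' : 'I_k) (v : 'I_n),
     ar ms'' aU (i' * n + v) = (i' < i) && (v \in U i') ||
        ((i' : nat) == i) && (v \in take r (enum (U i'))))) => //.
  + by apply: evs_R; apply: c_U c'.
  + by move=> v; apply: evs_R; apply: c_U c'.
  + exact: at_dom.
  + by rewrite size_map size_enum_ord.
  + by move=> i' v; rewrite Ii take0 in_nil andbF orbF.
  + move=> r t2 ms2 rl rr_r rx_x F2 I2; have c2 : ctx ms2 by apply: ctx_fr F2 c'.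
    rewrite (nth_doms (Ordinal ik)) in rl rx_x.
    rewrite (nth_ord_list x0 rl) in rx_x; set x := nth x0 _ r in rx_x.
    apply: (wp_put_val (i := i * n + x) (v := 1)).
    * apply: (@evs_idx _ _ _ _ _ k) => //; [exact: c_n c2|nat_lia|nat_lia|].
      by apply: evs_R; rewrite (F2.1 ri).
    * by apply: evs_K; nat_lia.
    split; first by cost_lia.
    move=> i' v /=; rewrite upd_same updE.
    have Ex : ((i * n + x == i' * n + v) = ((i' : nat) == i) && (v == x)).
      apply/eqP/andP => [/idx_inj[]//|[/eqP-> /eqP->]//] => [-> /val_inj->].
      by rewrite !eqxx.
    rewrite Ex I2; case: ((i' : nat) =P i) => //= E.
    have -> : i' = Ordinal ik by apply: val_inj.
    rewrite (mem_take_succ x0) -?(size_map val) // -/x orbA.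
    by case: (v == x); rewrite ?orbT ?orbF.
  + move=> t2 ms2 F2 le2 I2; split.
      move: le2 sz; rewrite /ecost /=; move: (size _) => S; clear; lia.
    move=> i' v; rewrite I2 (nth_doms (Ordinal ik)) ltS_eqVlt.
    case: ((i' : nat) =P i) => [E|_] /=; last by rewrite orbF.
    have -> : i' = Ordinal ik by apply: val_inj.
    by rewrite take_oversize ?size_map // mem_enum ltnn.
move=> t' ms' _ le I; split; first by rewrite addnA.
by move=> i v; rewrite I ltn_ord.
Qed.

Definition LocateVertices := For ra rp (ForBlock (R rBag) (R ra) rst rlen rr rx (CPut aBG (R rx) (R ra))).

Lemma sum_bags : \sum_(a < p) #|bag a| = n.
Proof.
rewrite -[RHS]card_ord -sum1_card (partition_big bg xpredT) //=.
apply: eq_bigr => a _; rewrite -sum1_card; apply: eq_bigl => v.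
by rewrite bgP eq_sym.
Qed.

Lemma size_nth_bags (a : 'I_p) : size (nth [::] bags a) = #|bag a|.
Proof. by rewrite nth_bags size_map -cardE. Qed.

Lemma wp_LocateVertices tm ms : ctx ms ->
  wp LocateVertices (fun t' ms' => t' <= tm + (6 + (40 * p + n * 25)) /\ bag_array bg (ar ms' aBG)) tm ms.
Proof.
move=> c.
apply: (wp_for_var b3 (m := p) (D := fun a => 29 + size (nth [::] bags a) * 25)
  (I := fun a ms' => forall v : 'I_n, bg v < a -> ar ms' aBG v = bg v)) => //.
- exact: c_p c.
- move=> a t' ms' ap ra_a F Ia.
  have c' : ctx ms' by apply: ctx_fr F c.
  apply: (wp_ForBlock b3 (D := 12) (j := a) (bs := bags) (b := base 2)
    (I := fun r ms'' => forall v : 'I_n,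
      (bg v < a) || ((bg v == a :> nat) && (v \in take r (enum (bag (Ordinal ap))))) ->
      ar ms'' aBG v = bg v)) => //.
  + by apply: evs_R; exact: (c_bag c').
  + by move=> v; apply: evs_R; exact: (c_bag c').
  + exact: at_bag.
  + by rewrite size_map size_enum_ord.
  + by move=> v; rewrite take0 in_nil andbF orbF; apply: Ia.
  + move=> r t2 ms2 rl rr_r rx_x F2 I2; have c2 : ctx ms2 by apply: ctx_fr F2 c'.
    rewrite (nth_bags (Ordinal ap)) in rl rx_x.
    rewrite (nth_ord_list x0 rl) in rx_x; rewrite size_map in rl.
    set x := nth x0 _ r in rx_x.
    have xb : x \in bag (Ordinal ap) by rewrite -mem_enum mem_nth.
    apply: (wp_put_val (i := x) (v := a)); [exact: evs_R|by apply: evs_R; rewrite (F2.1 ra)|].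
    split; first by cost_lia.
    move=> v; rewrite (mem_take_succ x0) // -/x /= upd_same updE => h.
    case: eqP => [/val_inj E|ne].
      by move: xb; rewrite -E bgP => /eqP <-.
    apply: I2; move: h; case: (eqVneq v x) => [E|//]; first by rewrite E in ne.
    by rewrite orbF.
  + move=> t2 ms2 F2 le2 I2; split.
      by move: le2; rewrite /ecost /=; move: (size _) => S; clear; lia.
    move=> v; rewrite ltS_eqVlt => /orP[/eqP E|h]; apply: I2; last by rewrite h.
    rewrite take_oversize; last by rewrite -cardE -size_nth_bags.
    rewrite mem_enum bgP E eqxx /= -(_ : Ordinal ap = bg v) ?eqxx ?orbT //.
    exact: val_inj.
move=> t' ms' _ le I; split; last by move=> v; apply: I.
move: le; have -> : \sum_(i < p) (29 + size (nth [::] bags i) * 25 + 8) = 37 * p + n * 25.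
  have -> : 37 * p = \sum_(i < p) 37 by rewrite sum_nat_const card_ord mulnC.
  rewrite -[in RHS]sum_bags big_distrl /= -big_split /=.
  by apply: eq_bigr => a _; rewrite size_nth_bags addnAC.
by move: p n => x y; clear; lia.
Qed.

(** * Breadth-first search in the tree *)

(** Array [aQ] is the queue, with bag 0 in front from the start because memory is
    0 initially. *)
Definition RootTree :=
  CPut aPAR (K 0) (K 1) ;;; CSet rqt (K 1) ;;;
  For rh rp
    (CIf (O Lt (R rh) (R rqt))
       (CSet ra (A aQ (R rh)) ;;;
        ForBlock (R rNbr) (R ra) rst rlen rr rx
          (CIf (O Lt (K 0) (A aPAR (R rx))) CSkip
             (CPut aPAR (R rx) (O Add (R ra) (K 1)) ;;;
              CPut aQ (R rqt) (R rx) ;;;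
              CSet rqt (O Add (R rqt) (K 1)))))
       CSkip).

(** The queue [qs] keeps the bags that have left it. The parents and depths are
    meaningful for the bags of [qs] only. *)
Record bfs (ms : mst) (qs : seq 'I_p) (par : 'I_p -> 'I_p) (dep : 'I_p -> nat) : Prop := Bfs {
  b_uniq : uniq qs;
  b_root : exists l, qs = r0 :: l;
  b_qt : rg ms rqt = size qs;
  b_q : forall i, i < size qs -> ar ms aQ i = nth r0 qs i;
  b_par : forall c : 'I_p, ar ms aPAR c = if c \in qs then (par c).+1 else 0;
  b_par0 : par r0 = r0;
  b_dep0 : dep r0 = 0;
  b_edge : forall c, c \in qs -> c != r0 ->
     [/\ T c (par c), par c \in qs & dep c = (dep (par c)).+1] }.

Lemma bfs_size ms qs par dep : bfs ms qs par dep -> size qs <= p.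
Proof. by move=> b; have := card_uniqP (b_uniq b) => <-; rewrite -[p in _ <= p]card_ord max_card. Qed.

Definition bfs_push (ms : mst) (qt x a : nat) :=
  setr (seta (seta ms aPAR x (a + 1)) aQ qt x) rqt (qt + 1).

Lemma bfs_step ms qs par dep (a x : 'I_p) : bfs ms qs par dep -> a \in qs -> T a x -> x \notin qs ->
  exists par' dep', bfs (bfs_push ms (size qs) x a) (rcons qs x) par' dep'.
Proof.
move=> b aq ax xq; exists [eta par with x |-> a], [eta dep with x |-> (dep a).+1].
have [l ql] := b_root b.
have nx0 : x != r0 by apply: contraNneq xq => ->; rewrite ql mem_head.
have nax : a != x by apply: contraNneq xq => <-.
split.
- by rewrite rcons_uniq xq (b_uniq b).
- by exists (rcons l x); rewrite ql.
- by rewrite /= upd_same size_rcons addn1.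
- move=> i; rewrite size_rcons ltS_eqVlt /= upd_same updE nth_rcons.
  case: (eqVneq (size qs) i) => [<-|ne]; first by rewrite ltnn.
  by move=> /= lt; rewrite lt upd_neq // (b_q b lt).
- move=> c; rewrite /= upd_neq // upd_same updE mem_rcons inE.
  case: (eqVneq c x) => [->|ne]; first by rewrite eqxx addn1.
  by rewrite /= (b_par b) eq_sym (inj_eq val_inj) (negPf ne).
- by rewrite /= eq_sym (negPf nx0) (b_par0 b).
- by rewrite /= eq_sym (negPf nx0) (b_dep0 b).
- move=> c; rewrite mem_rcons inE /=; case: (eqVneq c x) => [->|ne] /=.
    by move=> _ _; rewrite (negPf nax) adj_sym mem_rcons inE aq orbT.
  move=> cq nc; have [h1 h2 h3] := b_edge b cq nc.
  have np : par c != x by apply: contraNneq xq => <-.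
  by rewrite (negPf np) mem_rcons inE h2 orbT.
Qed.

Lemma nth_lt_size_rcons h (qs : seq 'I_p) x : h < size qs -> nth r0 (rcons qs x) h = nth r0 qs h.
Proof. by move=> h1; rewrite nth_rcons h1. Qed.

(** Each adjacency list is scanned once. In the end the set of visited bags is
    closed under adjacency, so it contains all bags. *)
Lemma wp_RootTree tm ms : ctx ms -> (forall i, ar ms aPAR i = 0) -> (forall i, ar ms aQ i = 0) ->
  wp RootTree (fun t' ms' => exists par dep,
    [/\ t' <= tm + 200 + 200 * p, rooted T par r0 dep & parent_array par (ar ms' aPAR)]) tm ms.
Proof.
move=> c zP zQ.
have [[_ conn] _] : tree T by case: PT.
apply: wp_seq; apply: (wp_put_val (i := 0) (v := 1)); [apply: evs_K; nat_lia|apply: evs_K; nat_lia|].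
apply: wp_seq; apply: (wp_set_val (v := 1)); first by apply: evs_K; nat_lia.
rewrite /ecost /=; set ms1 := setr _ _ _.
have c1 : ctx ms1 by case: c => *; split.
have b0 : bfs ms1 [:: r0] (fun=> r0) (fun=> 0).
  split=> //.
  - by exists [::].
  - by case=> // _ /=; rewrite upd_neq // zQ -r00.
  - move=> x; rewrite /= upd_same updE inE zP -(inj_eq val_inj) r00 eq_sym.
    by rewrite -[nat_of_ord r0]/(val r0) r00; case: eqP.
  - by move=> x; rewrite inE => /eqP->; rewrite eqxx.
pose deg (x : 'I_p) := #|T x|.
apply: (wp_for (ltnW b3) (m := p) (I := fun h t' ms' => exists qs par dep,
   [/\ bfs ms' qs par dep, t' <= tm + 100 + 70 * h + 50 * sumn (map deg (take h qs)) &
     forall x y, x \in take h qs -> T x y -> y \in qs])) => //.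
- exact: c_p c1.
- exists [:: r0], (fun=> r0), (fun=> 0); split=> //.
  + by case: b0 => *; split.
  + by rewrite /= muln0 !addn0; nat_lia.
- move=> h t' ms' hp rh_h F [qs [par [dep [b le cl]]]].
  have c' : ctx ms' by apply: ctx_fr F c1.
  apply: (wp_if_val b3 (b := h < size qs)).
  + by apply: evs_lt; apply: evs_R => //; exact: (b_qt b).
  + move=> hq; set a := nth r0 qs h.
    apply: wp_seq; apply: (wp_set_val (v := a)).
      by apply: (evs_A (i := h)); [exact: evs_R|rewrite (b_q b hq)].
    set ms2 := setr _ _ _; have c2 : ctx ms2 by case: c' => *; split.
    apply: (wp_ForBlock b3 (D := 37) (j := a) (bs := nbrs) (b := base 3)
      (I := fun r ms'' => exists qs' par' dep', [/\ bfs ms'' qs' par' dep',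
         h < size qs', take h qs' = take h qs, nth r0 qs' h = a &
         (forall x y, x \in take h qs -> T x y -> y \in qs') /\
         {subset take r (enum (T a)) <= qs'}])) => //.
    * move=> i ms3 y v hy [qs' [par' [dep' [b' h1 h2 h3 h4]]]].
      exists qs', par', dep'; split=> //; case: b' => *; split=> //.
      by rewrite /= upd_neq //; move: hy; rewrite !inE => /or4P[]/eqP->.
    * by apply: evs_R; exact: (c_nbr c2).
    * by move=> v; apply: evs_R; exact: (c_nbr c2).
    * exact: at_nbr.
    * by rewrite size_map size_enum_ord.
    * exists qs, par, dep; split=> //.
      -- by case: b => *; split.
      -- by split=> // x; rewrite take0.
    * move=> r t3 ms3 rl rr_r rx_x F3 [qs' [par' [dep' [b' h1 h2 h3 [h4 h5]]]]].
      rewrite (nth_nbrs a) in rl rx_x.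
      rewrite (nth_ord_list r0 rl) in rx_x; rewrite size_map in rl.
      set x := nth r0 _ r in rx_x.
      have Tax : T a x by have := mem_nth r0 rl; rewrite mem_enum.
      have aq : a \in qs' by rewrite -h3 mem_nth.
      have ra3 : rg ms3 ra = a by rewrite (F3.1 ra).
      apply: (wp_if_val b3 (b := x \in qs')).
      -- have -> : (x \in qs') = (0 < if x \in qs' then (par' x).+1 else 0) by case: ifP.
         apply: evs_lt; first by apply: evs_K; nat_lia.
         by apply: (evs_A (i := x)); [exact: evs_R|exact: (b_par b' x)].
      -- move=> xq; apply: wp_skip; split; first by cost_lia.
         exists qs', par', dep'; split=> //; split=> // y.
         by rewrite (mem_take_succ r0) // => /orP[/h5|/eqP->].
      -- move=> xq; have qp := bfs_size b'.
         apply: wp_seq; apply: (wp_put_val (i := x) (v := a + 1)); first exact: evs_R.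
           apply: evs_add; [exact: evs_R|apply: evs_K; nat_lia|].
           by move: (ltn_ord a); nat_lia.
         apply: wp_seq; apply: (wp_put_val (i := size qs') (v := x)).
           by apply: evs_R; exact: (b_qt b').
           exact: evs_R.
         apply: (wp_set_val (v := size qs' + 1)).
           apply: evs_add; [by apply: evs_R; apply: b_qt b'|apply: evs_K; nat_lia|].
           by nat_lia.
         split; first by cost_lia.
         case: (bfs_step b' aq Tax xq) => par'' [dep'' b''].
         exists (rcons qs' x), par'', dep''; split=> //.
         ++ by rewrite size_rcons ltnW.
         ++ by rewrite -cats1 takel_cat // ltnW.
         ++ by rewrite nth_lt_size_rcons.
         split=> [y z hy hz|y]; first by rewrite mem_rcons inE (h4 y z) ?orbT.
         by rewrite (mem_take_succ r0) // mem_rcons inE => /orP[/h5->|->]; rewrite ?orbT.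
    * move=> t3 ms3 F3 le3 [qs' [par' [dep' [b' h1 h2 h3 [h4 h5]]]]].
      exists qs', par', dep'; split.
      -- by case: b' => *; split.
      -- rewrite (take_nth r0) // map_rcons sumn_rcons h2 h3.
         move: le3 le; rewrite (nth_nbrs a) size_map -cardE /deg -/a /ecost /=.
         move: (sumn _) #|T a| => x y; clear; lia.
      -- move=> x y; rewrite (mem_take_succ r0) // h2 h3 => /orP[hx|/eqP->]; first exact: h4.
         move=> ay; apply: h5; rewrite (nth_nbrs a) take_oversize ?size_map //.
         by rewrite mem_enum.
  + rewrite -leqNgt => hq; apply: wp_skip.
    exists qs, par, dep; split=> //.
    * by case: b => *; split.
    * move: le; rewrite !take_oversize //; last by rewrite ltnW.
      rewrite /ecost /=; move: (sumn _) => x; clear; lia.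
    * by move=> x y; rewrite take_oversize; [move=> *; apply: (cl x) => //; rewrite take_oversize|rewrite ltnW].
- move=> t' ms' F [qs [par [dep [b le cl]]]].
  rewrite take_oversize in le cl; last exact: bfs_size b.
  have all_q x : x \in qs.
    have [l ql] := b_root b.
    have /connectP[q pq ->] := conn r0 x.
    have : r0 \in qs by rewrite ql mem_head.
    elim: q (r0) pq => //= y q IH z /andP[zy yq] zq; apply: IH yq _.
    exact: cl zq zy.
  have rt : rooted T par r0 dep.
    split; [exact: b_par0 b|exact: b_dep0 b| |] => x nx;
    by case: (b_edge b (all_q x) nx).
  exists par, dep; split=> //; last by move=> x; rewrite (b_par b) all_q.
  have : sumn (map deg qs) <= 2 * p.
    have h := sum_degrees Tac rt; rewrite card_ord in h.
    rewrite sumnE big_map; apply: leq_trans h.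
    by rewrite big_uniq ?(b_uniq b) //= [X in _ <= X](bigID (mem qs)) /= leq_addr.
  by move: le; move: (sumn _) => x; clear; lia.
Qed.

Lemma slot_idx i r : i <= 3 * k -> r <= M -> i * M + r < B.
Proof.
move=> hi hr; apply: leq_ltn_trans BN.
apply: (@leq_trans ((3 * k + 1) * M)).
  rewrite mulnDl mul1n; apply: leq_add => //; by rewrite leq_mul2r hi orbT.
apply: (@leq_trans (4 * N * (16 * N))); last by rewrite mulnACA.
by apply: leq_mul; rewrite /M; nat_lia.
Qed.

Lemma M_ltB : M < B.
Proof. by have := slot_idx (leq0n _) (leqnn M). Qed.

(** * Lists of candidates *)

Definition isEnd y x := Or (O Eq (R y) (sE (R x))) (O Eq (R y) (tE (R x))).

Definition chosen x := A aCV (O Defs.Sub (O Add (O Mul (R x) (R rM)) (A aG (R x))) (K 1)).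

(** Going through all paths costs a factor [k], but spares marks on the vertices
    that would have to be removed for the next choice of middles. *)
Definition TestBlocked y :=
  CSet rb (K 0) ;;;
  For rj rk
    (CIf (Or (isEnd y rj) (And (O Lt (K 0) (A aG (R rj))) (O Eq (chosen rj) (R y))))
       (CSet rb (K 1)) CSkip).

(** The digits are required to be within the lists of candidates. *)
Record stored_digits (gd : nat -> nat) (dig val : nat -> nat) : Prop := StoredDigits {
  g_dig : forall i : 'I_k, dig i = gd i;
  g_leq : forall i : 'I_k, gd i <= size (candidates i);
  g_val : forall (i : 'I_k) r, r < gd i -> val (i * M + r) = nth x0 (candidates i) r }.

Definition digits_stored gd ms := stored_digits gd (ar ms aG) (ar ms aCV).

Lemma size_candidates i : size (candidates i) <= M.
Proof. by rewrite size_take_min geq_minl. Qed.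

Lemma digits_stored_fr xs js ms ms' gd : frame xs js ms ms' -> aG \notin js -> aCV \notin js ->
  digits_stored gd ms -> digits_stored gd ms'.
Proof. by move=> F h1 h2; rewrite /digits_stored !F.2. Qed.

Lemma evs_end ms y x (v : 'I_n) (i : 'I_k) : ctx ms -> rg ms y = v -> rg ms x = i ->
  evs ms (isEnd y x) ((v == s i) || (v == t i)).
Proof.
move=> cx hy hx; apply: (evs_or b3); apply: evs_eq; try exact: evs_R.
- by apply: (evs_s cx); apply: evs_R.
- by apply: (evs_t cx); apply: evs_R.
Qed.

Lemma evs_dig ms gd x (i : 'I_k) : digits_stored gd ms -> rg ms x = i -> evs ms (A aG (R x)) (gd i).
Proof. by move=> og hx; apply: (evs_A (i := i)); [exact: evs_R|exact: g_dig og i]. Qed.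

Lemma evs_chosen ms x (i : 'I_k) r : ctx ms -> rg ms x = i -> ar ms aG i = r ->
  r <= size (candidates i) -> (forall r', r' < r -> ar ms aCV (i * M + r') = nth x0 (candidates i) r') ->
  exists u : nat, evs ms (chosen x) u /\ (0 < r -> u = nth x0 (candidates i) r.-1).
Proof.
move=> cx hx hd hr hv; exists (ar ms aCV (i * M + r - 1)).
have hi := ltn_ord i; have hM : rg ms rM = M := c_M cx.
have hg : r <= M by apply: leq_trans hr (size_candidates i).
have h1 : i * M + r < B by apply: slot_idx => //; nat_lia.
split.
  apply: evs_A erefl; apply: evs_sub; last by apply: evs_K; nat_lia.
  apply: evs_add => //; last by apply: (evs_A (i := i)); [exact: evs_R|].
  apply: evs_mul; [exact: evs_R|exact: evs_R|].
  by apply: leq_ltn_trans h1; rewrite leq_addr.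
by move=> g0; rewrite -addnBA // subn1 hv ?prednK.
Qed.

Lemma wp_TestBlocked tm ms gd y (v : 'I_n) : ctx ms -> digits_stored gd ms -> 14 < y -> rg ms y = v ->
  wp (TestBlocked y) (fun t' ms' => t' <= tm + (10 + k * 100) /\ rg ms' rb = blocked (middle_of gd) v) tm ms.
Proof.
move=> cx og y14 hy.
have yb : rb != y by rewrite neq_ltn y14.
have yj : rj != y by rewrite neq_ltn (ltn_trans _ y14).
apply: wp_seq; apply: (wp_set_val (v := 0)); first by apply: evs_K; nat_lia.
set ms1 := setr _ _ _; have cx1 : ctx ms1 by case: cx => *; split.
pose P (j : 'I_k) := [|| v == s j, v == t j | middle_of gd j == Some v].
apply: (wp_for_const b3 (m := k) (D := 85)
  (I := fun i ms' => rg ms' rb = [exists j : 'I_k, (j < i) && P j])) => //.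
- exact: c_k cx1.
- by rewrite exists_lt0.
- move=> i0 t' ms' ik rj_i F h; pose i := Ordinal ik.
  have cx' : ctx ms' by apply: ctx_fr F cx1.
  have og' : digits_stored gd ms' by apply: (digits_stored_fr F).
  have hy' : rg ms' y = v.
    rewrite F.1 /= ?upd_neq // !inE !negb_or ![y == _]eq_sym; by rewrite yb yj.
  have [u [eu hu]] := evs_chosen cx' (i := i) rj_i (g_dig og' i) (g_leq og' i) (g_val og' (i := i)).
  apply: (wp_if_val b3 (b := P i)).
  + have -> : P i = ((v == s i) || (v == t i)) || ((0 < gd i) && (u == v)).
      rewrite /P -orbA; congr (_ || (_ || _)); rewrite /middle_of.
      have := hu; case: (gd i) => [|r] //= /(_ isT) ->.
      by [].
    apply: (evs_or b3); first by apply: evs_end.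
    apply: (evs_and b3); last by apply: evs_eq => //; apply: evs_R.
    by apply: evs_lt; [apply: evs_K; nat_lia|apply: evs_dig og' _].
  + move=> Pi; apply: (wp_set_val (v := 1)); first by apply: evs_K; nat_lia.
    by split; [cost_lia|rewrite /= upd_same exists_ltS Pi orbT].
  + move=> nP; apply: wp_skip; split; first by cost_lia.
    by rewrite h exists_ltS (negPf nP) orbF.
move=> t' ms' _ le h; split; first by move: le; rewrite /ecost /=; clear; lia.
rewrite h exists_ltT /blocked /terminal; congr nat_of_bool.
apply/existsP/orP => [[j /or3P[h1|h1|h1]]|[/existsP[j h1]|/existsP[j h1]]].
- by left; apply/existsP; exists j; rewrite h1.
- by left; apply/existsP; exists j; rewrite h1 orbT.
- by right; apply/existsP; exists j.
- by exists j; rewrite /P orbA h1.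
- by exists j; rewrite /P h1 !orbT.
Qed.

Definition stored_list aN aV (ms : mst) i (l : seq nat) :=
  ar ms aN i = size l /\ forall r, r < size l -> ar ms aV (i * M + r) = nth 0 l r.

Lemma stored_list_fr xs js ms ms' aN aV i l : frame xs js ms ms' -> aN \notin js -> aV \notin js ->
  stored_list aN aV ms i l -> stored_list aN aV ms' i l.
Proof. by move=> F h1 h2 [h3 h4]; split=> *; rewrite F.2 ?h3 ?h4. Qed.

(** Appending to a full list has no effect, which is the truncation. *)
Definition Append aN aV x y :=
  CIf (O Lt (A aN (R x)) (R rM))
    (CPut aV (O Add (O Mul (R x) (R rM)) (A aN (R x))) (R y) ;;;
     CPut aN (R x) (O Add (A aN (R x)) (K 1)))
    CSkip.

Lemma wp_Append aN aV x y tm ms i v l : aN != aV -> ctx ms -> rg ms x = i -> rg ms y = v ->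
  i <= 3 * k -> size l <= M -> stored_list aN aV ms i l ->
  wp (Append aN aV x y) (fun t' ms' => [/\ t' <= tm + 60, stored_list aN aV ms' i (take M (rcons l v)) &
     forall i' l', i' != i -> size l' <= M -> stored_list aN aV ms i' l' -> stored_list aN aV ms' i' l']) tm ms.
Proof.
move=> nNV cx hx hy ik lM [h1 h2].
have bi : i * M + size l < B by apply: slot_idx.
have hM : rg ms rM = M := c_M cx.
have en ms' : rg ms' x = i -> ar ms' aN = ar ms aN -> evs ms' (A aN (R x)) (size l).
  by move=> e1 e2; apply: (evs_A (i := i)); [exact: evs_R|rewrite e2].
apply: (wp_if_val b3 (b := size l < M)); first by apply: evs_lt; [exact: en|exact: evs_R].
  move=> lt; apply: wp_seq; apply: (wp_put_val (i := i * M + size l) (v := v)).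
  - apply: evs_add => //; last exact: en.
    apply: evs_mul; [exact: evs_R|exact: evs_R|].
    by apply: leq_ltn_trans bi; rewrite leq_addr.
  - exact: evs_R.
  set ms1 := seta _ _ _ _.
  apply: (wp_put_val (i := i) (v := size l + 1)); first exact: evs_R.
    apply: evs_add; [|apply: evs_K; nat_lia|].
      by apply: en => //=; rewrite upd_neq // eq_sym.
    by move: M_ltB lM lt; nat_lia.
  rewrite take_oversize ?size_rcons //.
  have aVE ms2 (ii v' : nat) : ar (seta ms2 aN ii v') aV = ar ms2 aV.
    by rewrite /= upd_neq.
  split; first by cost_lia.
  - split; first by rewrite /= !upd_same size_rcons addn1.
    move=> r; rewrite size_rcons ltS_eqVlt nth_rcons aVE /= upd_same updE.
    case: (eqVneq r (size l)) => [->|ne] /=; first by rewrite ltnn eqxx.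
    by move=> rl; rewrite rl ifN ?h2 // eqn_add2l eq_sym.
  - move=> i' l' ni l'M [a1 a2]; split.
      by rewrite /= upd_same updE eq_sym (negPf ni) upd_neq // eq_sym.
    move=> r rl; rewrite aVE /= upd_same updE ifN ?a2 //.
    apply: contra ni => /eqP /idx_inj[] //; first exact: leq_trans rl l'M.
    by move=> ->.
rewrite -leqNgt => ge; have eM : size l = M by apply/eqP; rewrite eqn_leq lM ge.
apply: wp_skip; split=> //; first by cost_lia.
by rewrite -cats1 -eM take_size_cat.
Qed.

Definition memU x y := A aU (O Add (O Mul (R x) (R rn)) (R y)).

Lemma evs_memU ms x y (i : 'I_k) (v : 'I_n) : ctx ms -> domain_array (ar ms aU) ->
  rg ms x = i -> rg ms y = v -> evs ms (memU x y) (v \in U i).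
Proof.
move=> cx oU hx hy; apply: (evs_A (i := i * n + v)); last exact: oU.
apply: (@evs_idx _ _ _ _ _ k) => //; try exact: evs_R.
- exact: c_n cx.
- nat_lia.
- nat_lia.
Qed.

(** The digits are still 0 when this is run, so that only the terminals are
    blocked. *)
Definition ListMiddles :=
  For ri rk
    (CSet ru (sE (R ri)) ;;; CSet rv (tE (R ri)) ;;;
     CIf (adjE (R ru) (R rv))
       (For rx rn
          (CIf (And (And (adjE (R ru) (R rx)) (adjE (R rv) (R rx))) (memU ri rx))
             (TestBlocked rx ;;; CIf (R rb) CSkip (Append aCN aCV ri rx))
             CSkip))
       CSkip).

Definition middle_lists (ms : mst) := forall i : 'I_k, stored_list aCN aCV ms i (map val (candidates i)).

Lemma wp_ListMiddles tm ms : ctx ms -> domain_array (ar ms aU) ->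
  (forall i, ar ms aG i = 0) -> (forall i, ar ms aCN i = 0) ->
  wp ListMiddles (fun t' ms' => t' <= tm + (6 + k * (100 + n * (150 + k * 100))) /\ middle_lists ms') tm ms.
Proof.
move=> cx oU zG zC.
pose part (i : 'I_k) w := take M [seq v <- take w (enum 'I_n) | G (s i) (t i) && middle G s t U i v].
have partM i w : size (part i w) <= M by rewrite size_take_min geq_minl.
have part0 i : part i 0 = [::] by rewrite /part take0.
have partS i w (wn : w < n) : part i w.+1 =
    if G (s i) (t i) && middle G s t U i (Ordinal wn)
    then take M (rcons (part i w) (Ordinal wn)) else part i w.
  rewrite /part (take_nth x0) ?size_enum_ord // take_filter_rcons.
  by have -> : nth x0 (enum 'I_n) w = Ordinal wn by exact: (nth_ord_enum x0 (Ordinal wn)).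
have partT i : part i n = candidates i.
  by rewrite /part [take n _]take_oversize ?size_enum_ord.
have og0 ms' : (forall i, ar ms' aG i = 0) -> digits_stored (fun=> 0) ms' by split.
apply: (wp_for_const b3 (m := k) (D := 92 + n * (150 + k * 100))
  (I := fun i ms' => forall j : 'I_k,
     stored_list aCN aCV ms' j (if j < i then map val (candidates j) else [::]))) => //.
- exact: c_k cx.
move=> i0 t' ms' ik ri_i F h; pose i := Ordinal ik.
have cx' : ctx ms' by apply: ctx_fr F cx.
have ei : evs ms' (R ri) i by apply: evs_R.
apply: wp_seq; apply: (wp_set_val (evs_s cx' ei)); set ms1 := setr _ _ _.
have cx1 : ctx ms1 by case: cx' => *; split.
apply: wp_seq; apply: (wp_set_val (v := t i)); first by apply: (evs_t cx1); apply: evs_R.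
set ms2 := setr _ _ _; have cx2 : ctx ms2 by case: cx1 => *; split.
have fin ms3 : (forall j : 'I_k, stored_list aCN aCV ms3 j
     (if j < i0 then map val (candidates j) else if j == i0 :> nat then map val (part i n) else [::])) ->
   forall j : 'I_k, stored_list aCN aCV ms3 j (if j < i0.+1 then map val (candidates j) else [::]).
  move=> hh j; have := hh j; rewrite ltS_eqVlt; case: eqP => [E|//] /=.
  by rewrite E ltnn partT (_ : j = i) //; apply: val_inj.
apply: (wp_if_val b3 (b := G (s i) (t i))).
- by apply: (evs_adj cx2); apply: evs_R.
- move=> adj.
  apply: (wp_for_const b3 (m := n) (D := 142 + k * 100)
   (I := fun w ms' => forall j : 'I_k, stored_list aCN aCV ms' j
     (if j < i0 then map val (candidates j) else if j == i0 :> nat then map val (part i w) else [::]))) => //.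
  + exact: c_n cx2.
  + move=> j; rewrite part0 /= if_same; have := h j; by case: (j < i0).
  + move=> w t3 ms3 wn rx_w F3 h3; pose v := Ordinal wn.
    have cx3 : ctx ms3 by apply: ctx_fr F3 cx2.
    have fR x : x \notin [:: 19; 14; 13] -> rg ms3 x = rg ms2 x.
      by rewrite !inE !negb_or => /and3P[n1 n2 n3]; apply: F3.1; rewrite /= !inE !negb_or n1 n2 n3.
    have oU3 : domain_array (ar ms3 aU) by rewrite (F3.2 aU) // /= (F.2 aU).
    have ri3 : rg ms3 ri = i by rewrite fR.
    have nomid ms4 : ~~ middle G s t U i v -> (forall j, ar ms4 aCN j = ar ms3 aCN j) ->
      (forall j, ar ms4 aCV j = ar ms3 aCV j) ->
      forall j : 'I_k, stored_list aCN aCV ms4 j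
       (if j < i0 then map val (candidates j) else if j == i0 :> nat then map val (part i w.+1) else [::]).
      move=> nm e1 e2 j; rewrite partS (negPf nm) andbF.
      by have [a1 a2] := h3 j; split=> [|r hr]; rewrite ?e1 ?e2 ?a1 ?a2.
    apply: (wp_if_val b3 (b := [&& G (s i) v, G (t i) v & v \in U i])).
    * rewrite andbA; apply: (evs_and b3); last exact: evs_memU.
      by apply: (evs_and b3); apply: (evs_adj cx3); apply: evs_R; rewrite // fR.
    * move=> h4; apply: wp_seq.
      have og3 : digits_stored (fun=> 0) ms3 by apply: og0 => j; rewrite (F3.2 aG) // /= (F.2 aG).
      apply: wp_mono (wp_TestBlocked _ cx3 og3 (y := rx) (v := v) isT rx_w) _.
      move=> t5 ms5 F5 [le5 b5].
      have cx5 : ctx ms5 by apply: ctx_fr F5 cx3.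
      have bE : blocked (middle_of (fun=> 0)) v = terminal v.
        by rewrite /blocked; case: (terminal v) => //=; apply/existsP => -[].
      rewrite bE in b5.
      apply: (wp_if_val b3 (b := terminal v)); first exact: evs_R.
      -- move=> tv; apply: wp_skip; split; first by move: le5; rewrite /ecost /=; clear; lia.
         apply: nomid.
         ++ by rewrite /middle tv !andbF.
         ++ by move=> j; rewrite (F5.2 aCN).
         ++ by move=> j; rewrite (F5.2 aCV).
      -- move=> ntv.
         have mv : middle G s t U i v by rewrite /middle ntv andbT; move: h4.
         have a5 j l : stored_list aCN aCV ms3 j l -> stored_list aCN aCV ms5 j l by apply: (stored_list_fr F5).
         have ri5 : rg ms5 ri = i by rewrite (F5.1 ri).
         have rx5 : rg ms5 rx = v by rewrite (F5.1 rx).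
         have li : stored_list aCN aCV ms5 i (map val (part i w)).
           by apply: a5; have := h3 i; rewrite /= ltnn eqxx.
         have szi : size (map val (part i w)) <= M by rewrite size_map.
         have ik3 : i <= 3 * k by move: (ik) => /=; clear; lia.
         apply: wp_mono (wp_Append _ _ cx5 ri5 rx5 ik3 szi li) _ => // t6 ms6 F6 [le6 l6 o6].
         split; first by move: le5 le6; rewrite /ecost /=; clear; lia.
         move=> j; rewrite partS adj mv /=.
         case: (eqVneq (val j) i0) => [E|ne].
           rewrite -{1}E ltnn (_ : j = i) /= ?eqxx; last exact: val_inj.
           by move: l6; rewrite -map_rcons -map_take.
         apply: o6 => //.
           by case: ifP; rewrite ?(negPf ne) // size_map size_candidates.
         by apply: a5; have := h3 j; rewrite (negPf ne).
    * move=> h4; apply: wp_skip; split; first by rewrite /ecost /=; clear; lia.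
      apply: nomid => //; apply: contra h4; rewrite /middle.
      by case/and4P => -> -> -> _.
  + move=> t3 ms3 F3 le3 h3; split; last exact: fin.
    by move: le3; rewrite /ecost /=; move: (n) => y; clear; nia.
- move=> nadj; apply: wp_skip; split; first by rewrite /ecost /=; clear; lia.
  apply: fin => j; rewrite /part (negPf nadj) filter_pred0 /= if_same.
  by have := h j; case: (j < i0).
move=> t' ms' F le h; split; first by move: le; clear; nia.
by move=> j; have := h j; rewrite ltn_ord.
Qed.

Section Rooted.
Variables (par : 'I_p -> 'I_p) (dep : 'I_p -> nat).
Hypothesis Rt : rooted T par r0 dep.

Local Notation anc := (anc par).
Local Notation crossed := (crossed G par bg s t).
Local Notation slots := (slots G T bag par bg s t U M).

(** * Crossed edges *)

Definition idxX := O Add (O Mul (R ro) (R rp)) (R rcur).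

(** Flips the bit of every bag on the way from the current bag to the root. *)
Definition FlipAncestors :=
  For rw rp
    (CIf (O Lt (K 0) (R rcur))
       (CPut aX idxX (O Defs.Sub (K 1) (A aX idxX)) ;;;
        CSet rcur (O Defs.Sub (A aPAR (R rcur)) (K 1)))
       CSkip).

Definition crossing_array (f : 'I_k -> 'I_p -> bool) (a : nat -> nat) :=
  forall (i : 'I_k) (c : 'I_p), a (i * p + c) = f i c.

Lemma evs_idxX ms i (c : 'I_p) : ctx ms -> i < k -> rg ms ro = i -> rg ms rcur = c ->
  evs ms idxX (i * p + c).
Proof.
move=> cx ik h1 h2; apply: (@evs_idx _ _ _ _ _ k) => //.
- exact: c_p cx.
- nat_lia.
- nat_lia.
Qed.

Lemma wp_FlipAncestors tm ms (i : 'I_k) (c : 'I_p) f : ctx ms -> parent_array par (ar ms aPAR) ->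
  rg ms ro = i -> rg ms rcur = c -> crossing_array f (ar ms aX) ->
  wp FlipAncestors (fun t' ms' => t' <= tm + (6 + p * 80) /\
     crossing_array (fun j d => f j d (+) [&& j == i, d != r0 & anc d c]) (ar ms' aX)) tm ms.
Proof.
move=> cx oP eo ec oX.
pose cur w := iter w par c.
apply: (wp_for_const b3 (m := p) (D := 70)
  (I := fun w ms' => rg ms' rcur = cur w /\
     crossing_array (fun j d => f j d (+) [&& j == i, d != r0, anc d c & ~~ ((d != r0) && anc d (cur w))])
       (ar ms' aX))) => //.
- exact: c_p cx.
- split=> // j d; rewrite oX /cur /=; case: (d != r0); rewrite ?andbF ?addbF //=.
  by rewrite andbN andbF addbF.
- move=> w t' ms' wlt rw_w F [h1 h2].
  have cx' : ctx ms' by apply: ctx_fr F cx.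
  have eo' : rg ms' ro = i by rewrite (F.1 ro).
  have oP' : parent_array par (ar ms' aPAR) by rewrite (F.2 aPAR).
  have ei := evs_idxX cx' (ltn_ord i) eo' h1.
  apply: (wp_if_val b3 (b := cur w != r0)).
  + have -> : (cur w != r0) = (0 < cur w) by rewrite lt0n -(inj_eq val_inj) r00.
    by apply: evs_lt; [apply: evs_K; nat_lia|apply: evs_R].
  + move=> nr; apply: wp_seq.
    apply: (wp_put_val (v := 1 - ar ms' aX (i * p + cur w)) ei).
      by apply: evs_sub; [apply: evs_K; nat_lia|apply: evs_A ei _].
    set ms2 := seta _ _ _ _.
    apply: (wp_set_val (v := par (cur w))).
      rewrite (_ : val (par (cur w)) = ar ms' aPAR (cur w) - 1); last by rewrite oP' subn1.
      apply: evs_sub; last by apply: evs_K; nat_lia.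
      by apply: (evs_A (i := cur w)); [exact: evs_R|rewrite /= upd_neq].
    split; first by cost_lia.
    split; first by rewrite /= upd_same.
    move=> j d; rewrite /= upd_same updE.
    have -> : (i * p + cur w == j * p + d) = (j == i) && (d == cur w).
      apply/eqP/andP => [/idx_inj[]//|[/eqP-> /eqP->]//] => /val_inj-> /val_inj->.
      by rewrite !eqxx.
    have acw : anc (cur w) c by apply: fconnect_iter.
    have st : anc d (cur w) = (cur w == d) || anc d (par (cur w)) by rewrite anc_step.
    case: (eqVneq j i) => [->|nj] /=; last by rewrite h2 (negPf nj).
    rewrite !h2 eqxx /= -/(cur w.+1).
    case: (eqVneq d (cur w)) => [->|nd].
      rewrite nr acw anc_refl /= (negPf (par_nanc Rt nr)) /= addbF addbT.
      by case: (f i (cur w)).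
    by rewrite st [cur w == d]eq_sym (negPf nd).
  + rewrite negbK => /eqP E; apply: wp_skip; split; first by cost_lia.
    have E2 : cur w.+1 = r0 by rewrite /cur /= -/(cur w) E (par_root Rt).
    split; first by rewrite h1 E E2.
    by rewrite E2; rewrite E in h2.
move=> t' ms' F le [h1 h2]; split; first by move: le; clear; lia.
move=> j d; rewrite h2; congr (nat_of_bool (_ (+) [&& _, _ & _])).
have -> : cur p = r0.
  by apply: (dep0 Rt); rewrite (dep_iter Rt); apply/eqP; rewrite subn_eq0 -[p in _ <= p]card_ord ltnW ?(dep_lt Rt).
case: (eqVneq d r0) => [->|nd] /=; first by rewrite andbT.
have -> : anc d r0 = false.
  by apply/negP => /(anc_dep Rt)[]; rewrite (par_dep Rt nd) (dep_root Rt).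
by rewrite andbT.
Qed.

(** A bag is flipped twice, hence left at 0, if it is above both ends. *)
Definition MarkCrossings :=
  For ro rk
    (CSet ru (sE (R ro)) ;;; CSet rv (tE (R ro)) ;;;
     CIf (Or (O Eq (R ru) (R rv)) (adjE (R ru) (R rv))) CSkip
       (CSet rcur (A aBG (R ru)) ;;; FlipAncestors ;;; CSet rcur (A aBG (R rv)) ;;; FlipAncestors)).

Lemma wp_MarkCrossings tm ms : ctx ms -> parent_array par (ar ms aPAR) -> bag_array bg (ar ms aBG) ->
  (forall i, ar ms aX i = 0) ->
  wp MarkCrossings (fun t' ms' => t' <= tm + (6 + k * (150 + p * 160)) /\
     crossing_array crossed (ar ms' aX)) tm ms.
Proof.
move=> cx oP oB z.
apply: (wp_for_const b3 (m := k) (D := 142 + p * 160)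
  (I := fun i ms' => crossing_array (fun j d => (j < i) && crossed j d) (ar ms' aX))) => //.
- exact: c_k cx.
- move=> i0 t' ms' ik ro_i F h.
  pose i := Ordinal ik; have ei : evs ms' (R ro) i by apply: evs_R.
  have cx' : ctx ms' by apply: ctx_fr F cx.
  apply: wp_seq; apply: (wp_set_val (evs_s cx' ei)); set ms1 := setr _ _ _.
  have cx1 : ctx ms1 by case: cx' => *; split.
  apply: wp_seq; apply: (wp_set_val (v := t i)); first by apply: (evs_t cx1); apply: evs_R.
  set ms2 := setr _ _ _; have cx2 : ctx ms2 by case: cx1 => *; split.
  have eu : rg ms2 ru = s i by [].
  have ev : rg ms2 rv = t i by [].
  apply: (wp_if_val b3 (b := (s i == t i) || G (s i) (t i))).
  + apply: (evs_or b3); first by apply: evs_eq; apply: evs_R.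
    by apply: (evs_adj cx2); apply: evs_R.
  + move=> nl; apply: wp_skip; split; first by rewrite /ecost /=; nat_lia.
    move=> j d; rewrite h; congr nat_of_bool; rewrite ltS_eqVlt.
    case: eqP => [E|//] /=; rewrite E ltnn /=.
    have -> : j = i by apply: val_inj.
    by rewrite /crossed /long; case/orP: nl => ->; rewrite ?andbF.
  + rewrite negb_or => lg.
    have oB2 : bag_array bg (ar ms2 aBG) by rewrite (F.2 aBG).
    have oP2 : parent_array par (ar ms2 aPAR) by rewrite (F.2 aPAR).
    apply: wp_seq; apply: (wp_set_val (v := bg (s i))).
      by apply: (evs_A (i := s i)); [exact: evs_R|exact: oB2].
    set ms3 := setr _ _ _; have cx3 : ctx ms3 by case: cx2 => *; split.
    apply: wp_seq; apply: wp_mono (wp_FlipAncestors _ cx3 oP2 (i := i) (c := bg (s i)) ro_i _ h) _ => //.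
    move=> t4 ms4 F4 [le4 h4].
    have cx4 : ctx ms4 by apply: ctx_fr F4 cx3.
    apply: wp_seq; apply: (wp_set_val (v := bg (t i))).
      apply: (evs_A (i := t i)); first by apply: evs_R; rewrite (F4.1 rv).
      by rewrite (F4.2 aBG) //; apply: oB2.
    set ms5 := setr _ _ _; have cx5 : ctx ms5 by case: cx4 => *; split.
    have oP5 : parent_array par (ar ms5 aPAR) by rewrite /= (F4.2 aPAR).
    have ro5 : rg ms5 ro = i by rewrite /= upd_neq // (F4.1 ro).
    apply: wp_mono (wp_FlipAncestors _ cx5 oP5 (i := i) (c := bg (t i)) ro5 _ h4) _ => //.
    move=> t6 ms6 F6 [le6 h6]; split.
      by move: le6 le4; rewrite /ecost /=; move: (p) => y; clear; lia.
    move=> j d; rewrite h6; congr nat_of_bool; rewrite ltS_eqVlt.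
    rewrite -[j == i](inj_eq val_inj) /=; case: (eqVneq (val j) i0) => [E|ne] /=; last by rewrite !addbF.
    have -> : j = i by apply: val_inj.
    rewrite /crossed /long lg /= ltnn /=.
    case: (eqVneq d r0) => [->|nd] /=; first by rewrite !(anc_root Rt).
    by case: (anc d (bg (s i))); case: (anc d (bg (t i))).
move=> t' ms' _ le h; split.
  by move: le; rewrite (_ : 142 + p * 160 + 8 = 150 + p * 160); [rewrite addnA|nat_lia].
by move=> i c; rewrite h ltn_ord.
Qed.

Definition CheckTerminals :=
  CSet rok (K 1) ;;;
  For ri rk
    (CSet ru (sE (R ri)) ;;; CSet rv (tE (R ri)) ;;;
     CIf (And (memU ri ru) (memU ri rv)) CSkip (CSet rok (K 0))).

Lemma wp_CheckTerminals tm ms : ctx ms -> domain_array (ar ms aU) ->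
  wp CheckTerminals (fun t' ms' => t' <= tm + (10 + k * 100) /\ rg ms' rok = terminals_ok s t U) tm ms.
Proof.
move=> cx oU; apply: wp_seq; apply: (wp_set_val (v := 1)); first by apply: evs_K; nat_lia.
set ms0 := setr _ _ _; have cx0 : ctx ms0 by case: cx => *; split.
pose P (i : 'I_k) := (s i \in U i) && (t i \in U i).
apply: (wp_for_const b3 (m := k) (D := 90)
  (I := fun i ms' => rg ms' rok = [forall j : 'I_k, (j < i) ==> P j])) => //.
- exact: c_k cx0.
- by rewrite forall_lt0.
- move=> i0 t' ms' ik ri_i F h; pose i := Ordinal ik.
  have cx' : ctx ms' by apply: ctx_fr F cx0.
  have ei : evs ms' (R ri) i by apply: evs_R.
  apply: wp_seq; apply: (wp_set_val (evs_s cx' ei)); set ms1 := setr _ _ _.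
  have cx1 : ctx ms1 by case: cx' => *; split.
  apply: wp_seq; apply: (wp_set_val (v := t i)); first by apply: (evs_t cx1); apply: evs_R.
  set ms2 := setr _ _ _; have cx2 : ctx ms2 by case: cx1 => *; split.
  have oU2 : domain_array (ar ms2 aU) by rewrite /= (F.2 aU).
  apply: (wp_if_val b3 (b := P i)).
  + by rewrite /P; apply: (evs_and b3); apply: (evs_memU cx2 oU2).
  + move=> Pi; apply: wp_skip; split; first by cost_lia.
    by rewrite /= !upd_neq // h forall_ltS Pi andbT.
  + move=> nP; apply: (wp_set_val (v := 0)); first by apply: evs_K; nat_lia.
    split; first by cost_lia.
    by rewrite /= upd_same forall_ltS (negPf nP) andbF.
move=> t' ms' _ le h; split; first by move: le; rewrite /ecost /=; clear; lia.
by rewrite h forall_ltT.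
Qed.

(** * The slots of a bag *)

Definition idxE := O Add (O Mul (R ro) (R rp)) (R re).

Definition FillSlot :=
  ForBlock (R rbase) (R rr) rst2 rlen2 rr2 rx2
    (CIf (memU ro rx2)
       (TestBlocked rx2 ;;;
        CIf (Or (Not (R rb)) (isEnd rx2 ro)) (Append aSN aSV rm rx2) CSkip)
       CSkip).

Definition AddSlot :=
  CIf (A aX idxE)
    (CPut aSO (R rm) (R ro) ;;; CPut aSN (R rm) (K 0) ;;;
     CSet rbase (O Add (R rBnd) (In (O Add (R rBnd) (R ra)))) ;;;
     FillSlot ;;;
     CSet rm (O Add (R rm) (K 1)))
    CSkip.

Definition ListSlots :=
  CSet rm (K 0) ;;;
  ForBlock (R rNbr) (R ra) rst rlen rr rx
    (CIf (O Eq (A aPAR (R ra)) (O Add (R rx) (K 1))) (CSet re (R ra)) (CSet re (R rx)) ;;;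
     For ro rk AddSlot).

Definition slots_stored (sl : seq ('I_k * seq 'I_n)) ms :=
  rg ms rm = size sl /\ forall d q, q < size sl ->
    ar ms aSO q = (nth d sl q).1 :> nat /\ stored_list aSN aSV ms q (map val (nth d sl q).2).

Lemma stored_list_nil aN aV ms i : ar ms aN i = 0 -> stored_list aN aV ms i [::].
Proof. by []. Qed.

Lemma slots_stored_rcons (sl : seq ('I_k * seq 'I_n)) (j : 'I_k) (l : seq 'I_n) ms :
  rg ms rm = (size sl).+1 -> ar ms aSO (size sl) = j ->
  stored_list aSN aSV ms (size sl) (map val l) ->
  (forall d q, q < size sl -> ar ms aSO q = (nth d sl q).1 :> nat /\
     stored_list aSN aSV ms q (map val (nth d sl q).2)) ->
  slots_stored (rcons sl (j, l)) ms.
Proof.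
move=> h1 h2 h3 h4; split; first by rewrite size_rcons.
move=> d q; rewrite size_rcons ltS_eqVlt nth_rcons.
by case: (eqVneq q (size sl)) => [->|ne] /=; [rewrite ltnn|move=> h; rewrite h; apply: h4].
Qed.

Definition fill_cost (b : 'I_p) := #|bag b| * (200 + k * 100).

Lemma nth_bnd (b : 'I_p) : nth [::] [seq pack (bnds a) | a <- enum 'I_p] b =
  pack (bnds b).
Proof. by rewrite (nth_map b) ?size_enum_ord // nth_ord_enum. Qed.

Lemma wp_FillSlot tm ms gd (b c : 'I_p) r q (j : 'I_k) : ctx ms -> domain_array (ar ms aU) -> digits_stored gd ms ->
  r < size (enum (T b)) -> c = nth r0 (enum (T b)) r ->
  rg ms rbase = base 4 + start [seq pack (bnds a) | a <- enum 'I_p] b ->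
  rg ms rr = r -> rg ms ro = j -> rg ms rm = q -> q < 3 * k -> ar ms aSN q = 0 ->
  wp FillSlot (fun t' ms' => [/\ t' <= tm + (40 + fill_cost b),
     stored_list aSN aSV ms' q (map val (take M (slot_list (middle_of gd) j b c))) &
     forall q' l, q' != q -> size l <= M -> stored_list aSN aSV ms q' l -> stored_list aSN aSV ms' q' l]) tm ms.
Proof.
move=> cx oU og rl cE ebase err ero erm q3 z.
have [_ _ _ atb] := at_pack at_bnd (i := b) (ltac:(by rewrite size_map size_enum_ord)).
rewrite nth_bnd in atb.
have nthE : nth [::] (bnds b) r = ord_list (boundary G bag b c).
  by rewrite (nth_map r0) // -cE.
pose part w := take M [seq v <- take w (enum (boundary G bag b c)) | usable (middle_of gd) j v].
have partM w : size (part w) <= M by rewrite size_take_min geq_minl.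
have szb : size (ord_list (boundary G bag b c)) <= #|bag b|.
  by rewrite size_map -cardE; apply: subset_leq_card; apply/subsetP => v; rewrite inE => /andP[].
apply: (wp_ForBlock b3 (D := 180 + k * 100) (j := r) (bs := bnds b)
  (I := fun w ms' => stored_list aSN aSV ms' q (map val (part w)) /\
     forall q' l, q' != q -> size l <= M -> stored_list aSN aSV ms q' l -> stored_list aSN aSV ms' q' l) _ _ _ _ _ _ _ atb) => //.
- by rewrite size_map.
- split=> //; rewrite /part take0 /=; exact: stored_list_nil.
- rewrite nthE => w t' ms' wl rr2_w rx2_x F [h1 h2].
  rewrite (nth_ord_list x0 wl) in rx2_x; rewrite size_map in wl; set x := nth x0 _ w in rx2_x.
  have cx' : ctx ms' by apply: ctx_fr F cx.
  have oU' : domain_array (ar ms' aU) by rewrite (F.2 aU).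
  have og' : digits_stored gd ms' by apply: (digits_stored_fr F).
  have ro' : rg ms' ro = j by rewrite (F.1 ro).
  have rm' : rg ms' rm = q by rewrite (F.1 rm).
  have partS : part w.+1 = if usable (middle_of gd) j x then take M (rcons (part w) x) else part w.
    by rewrite /part (take_nth x0) // take_filter_rcons.
  apply: (wp_if_val b3 (b := x \in U j)); first exact: (evs_memU (i := j) cx' oU').
  + move=> xU; apply: wp_seq.
    apply: wp_mono (wp_TestBlocked _ cx' og' (y := rx2) (v := x) isT rx2_x) _.
    move=> t1 ms1 F1 [le1 b1].
    have cx1 : ctx ms1 by apply: ctx_fr F1 cx'.
    have ro1 : rg ms1 ro = j by rewrite (F1.1 ro).
    have rm1 : rg ms1 rm = q by rewrite (F1.1 rm).
    have rx1 : rg ms1 rx2 = x by rewrite (F1.1 rx2).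
    have a1 q' l : stored_list aSN aSV ms' q' l -> stored_list aSN aSV ms1 q' l by apply: (stored_list_fr F1).
    apply: (wp_if_val b3 (b := [|| ~~ blocked (middle_of gd) x, x == s j | x == t j])).
    * apply: (evs_or b3); last exact: evs_end.
      by apply: (evs_not b3 (va := blocked (middle_of gd) x)); apply: evs_R.
    * move=> ub.
      have us : usable (middle_of gd) j x by rewrite /usable xU.
      have szq : size (map val (part w)) <= M by rewrite size_map.
      apply: wp_mono (wp_Append _ _ cx1 rm1 rx1 (ltnW q3) szq (a1 _ _ h1)) _ => // t2 ms2 F2 [le2 l2 o2].
      split; first by move: le1 le2; rewrite /ecost /=; clear; lia.
      split; first by rewrite partS us; move: l2; rewrite -map_rcons -map_take.
      by move=> q' l nq lM hl; apply: o2 => //; apply: a1; apply: h2.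
    * move=> nub; apply: wp_skip; split; first by move: le1; rewrite /ecost /=; clear; lia.
      have us : usable (middle_of gd) j x = false by rewrite /usable xU (negPf nub).
      split; first by rewrite partS us; apply: a1.
      by move=> q' l nq lM hl; apply: a1; apply: h2.
  + move=> xU; apply: wp_skip; split; first by rewrite /ecost /=; clear; lia.
    have us : usable (middle_of gd) j x = false by rewrite /usable (negPf xU).
    by rewrite partS us.
- rewrite nthE => t' ms' F le [h1 h2]; split=> //.
    move: le szb; rewrite /ecost /= /fill_cost; move: (size _) #|bag b| => x y; clear; nia.
  by move: h1; rewrite /part [take (size _) _]take_oversize ?size_map.
Qed.

Lemma wp_AddSlot tm ms gd (b c : 'I_p) r (j : 'I_k) sl : ctx ms -> domain_array (ar ms aU) -> digits_stored gd ms ->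
  crossing_array crossed (ar ms aX) ->
  r < size (enum (T b)) -> c = nth r0 (enum (T b)) r ->
  rg ms ra = b -> rg ms re = lower_end par b c ->
  rg ms rr = r -> rg ms ro = j -> slots_stored sl ms ->
  (crossed j (lower_end par b c) -> size sl < 3 * k) -> all (fun x => size x.2 <= M) sl ->
  wp AddSlot (fun t' ms' =>
     t' <= tm + (30 + (if crossed j (lower_end par b c) then 100 + fill_cost b else 0)) /\
     slots_stored (if crossed j (lower_end par b c) then rcons sl (j, take M (slot_list (middle_of gd) j b c)) else sl) ms')
   tm ms.
Proof.
move=> cx oU og oX rl cE era ere err ero oS szl alM.
apply: (wp_if_val b3 (b := crossed j (lower_end par b c))).
- apply: (evs_A (i := j * p + lower_end par b c)); last exact: oX.
  apply: (@evs_idx _ _ _ _ _ k) => //; try exact: evs_R.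
  + exact: c_p cx.
  + nat_lia.
  + nat_lia.
- move=> cr; rewrite cr; have {}szl := szl cr.
  have [erm oS2] := oS.
  have jB : (j : nat) < B by apply: ltn_trans (ltn_ord j) kB.
  apply: wp_seq; apply: (wp_put_val (i := size sl) (v := j)); [exact: evs_R|exact: evs_R|].
  apply: wp_seq; apply: (wp_put_val (i := size sl) (v := 0)); [exact: evs_R|apply: evs_K; nat_lia|].
  set ms1 := seta _ _ _ _.
  have cx1 : ctx ms1 by case: cx => *; split.
  have [a1 a2 _ _] := at_pack at_bnd (i := b) (ltac:(by rewrite size_map size_enum_ord)).
  apply: wp_seq; apply: (wp_set_val (v := base 4 + start [seq pack (bnds a) | a <- enum 'I_p] b)).
    have e4 : evs ms1 (R rBnd) (base 4) by apply: evs_R; apply: (c_bnd cx1).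
    have lt : base 4 + start [seq pack (bnds a) | a <- enum 'I_p] b <= N.
      have [_ _ _ [+ _]] := at_pack at_bnd (i := b) (ltac:(by rewrite size_map size_enum_ord)).
      by apply: leq_trans; apply: leq_addr.
    apply: evs_add => //; last by nat_lia.
    apply: (@evs_In _ _ _ _ _ (base 4 + b)) => //; last by nat_lia.
    by apply: evs_add => //; nat_lia.
  set ms2 := setr _ _ _; have cx2 : ctx ms2 by case: cx1 => *; split.
  have z2 : ar ms2 aSN (size sl) = 0 by rewrite /= !upd_same.
  apply: wp_seq; apply: wp_mono (wp_FillSlot _ cx2 oU og rl cE (q := size sl) _ err ero erm szl z2) _ => //.
  move=> t3 ms3 F3 [le3 l3 o3].
  have rm3 : rg ms3 rm = size sl by rewrite (F3.1 rm).
  apply: (wp_set_val (v := size sl + 1)).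
    by apply: evs_add; [exact: evs_R|apply: evs_K; nat_lia|nat_lia].
  split; first by move: le3; rewrite /ecost /=; move: (fill_cost b) => y; clear; lia.
  apply: slots_stored_rcons.
  + by rewrite /= upd_same addn1.
  + by rewrite /= (F3.2 aSO) //= [upd _ aSN _ _]upd_neq // !upd_same.
  + exact: l3.
  + move=> d q ql; have [h1 h2] := oS2 d q ql.
    have nq : q != size sl by rewrite neq_ltn ql.
    split.
      by rewrite /= (F3.2 aSO) //= [upd _ aSN _ _]upd_neq // upd_same upd_neq // eq_sym.
    apply: (o3 q (map val (nth d sl q).2)) => //.
      by rewrite size_map; move/(all_nthP d): alM; apply.
    case: h2 => h3 h4; split; first by rewrite /= upd_same upd_neq ?[_ aSN]upd_neq // eq_sym.
    by move=> r' hr; rewrite /= !upd_neq // h4.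
- move=> cr; apply: wp_skip; rewrite (negPf cr); split; first by rewrite /ecost /=; clear; lia.
  exact: oS.
Qed.

Definition slots_from g b (c : 'I_p) (js : seq 'I_k) : seq ('I_k * seq 'I_n) :=
  [seq (j, take M (slot_list g j b c)) | j <- js & crossed j (lower_end par b c)].

Lemma slotsE g b : slots g b = flatten [seq slots_from g b c (enum 'I_k) | c <- enum (T b)].
Proof. by []. Qed.

Lemma all_slots_from g b c js : all (fun x => size x.2 <= M) (slots_from g b c js).
Proof. by apply/allP => x /mapP[j _ ->]; rewrite size_take_min geq_minl. Qed.

(** The boundaries are scanned for the slots only, of which there are at most
    [3 k]; a neighbouring bag without a slot costs [O(k)]. So the bound is linear
    in the degree and in the size of the bag. *)
Lemma wp_ListSlots tm ms gd (b : 'I_p) : ctx ms -> domain_array (ar ms aU) -> digits_stored gd ms ->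
  crossing_array crossed (ar ms aX) -> parent_array par (ar ms aPAR) -> rg ms ra = b ->
  wp ListSlots (fun t' ms' =>
     t' <= tm + (40 + #|T b| * (100 + 38 * k) + 3 * k * (100 + fill_cost b)) /\
     slots_stored (slots (middle_of gd) b) ms') tm ms.
Proof.
move=> cx oU og oX oP era.
apply: wp_seq; apply: (wp_set_val (v := 0)); first by apply: evs_K; nat_lia.
set ms1 := setr _ _ _; have cx1 : ctx ms1 by case: cx => *; split.
pose E := 100 + fill_cost b.
pose cs := enum (T b).
pose f c js := slots_from (middle_of gd) b c js.
pose pre r := flatten [seq f c (enum 'I_k) | c <- take r cs].
have preS r : r < size cs -> pre r.+1 = pre r ++ f (nth r0 cs r) (enum 'I_k).
  by move=> h; rewrite /pre (take_nth r0) // map_rcons flatten_rcons.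
have pre_le r : size (pre r) <= 3 * k.
  apply: leq_trans (size_slots_leq bg s t U PT Rt M (middle_of gd) b).
  by rewrite slotsE -/cs -{1}(cat_take_drop r cs) map_cat flatten_cat size_cat leq_addr.
have pre_all r : all (fun x => size x.2 <= M) (pre r).
  by apply/allP => x /flatten_mapP[c _]; move/allP: (all_slots_from (middle_of gd) b c (enum 'I_k)) => h /h.
apply: (wp_ForBlockD b3 (j := b) (bs := nbrs) (b := base 3)
  (D := fun r => 60 + 38 * k + size (f (nth r0 cs r) (enum 'I_k)) * E)
  (I := fun r ms' => slots_stored (pre r) ms')) => //.
- move=> r ms' y v hy [h1 h2]; split=> //.
  by rewrite /= upd_neq //; move: hy; rewrite !inE => /or4P[]/eqP->.
- by apply: evs_R; apply: (c_nbr cx1).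
- by move=> v; apply: evs_R; apply: (c_nbr cx1).
- exact: at_nbr.
- by rewrite size_map size_enum_ord.
- by rewrite /pre take0.
- rewrite (nth_nbrs b) => r t' ms' rl rr_r rx_x F oS.
  rewrite (nth_ord_list r0 rl) in rx_x; rewrite size_map in rl; set c := nth r0 _ r in rx_x.
  have Tbc : T b c by have := mem_nth r0 rl; rewrite mem_enum.
  have cx' : ctx ms' by apply: ctx_fr F cx1.
  have ra' : rg ms' ra = b by rewrite (F.1 ra).
  have oP' : parent_array par (ar ms' aPAR) by rewrite (F.2 aPAR).
  have sizes : size (pre r) + size (f c (enum 'I_k)) <= 3 * k.
    by rewrite -size_cat -(preS r rl) pre_le.
  apply: wp_seq; apply: wp_mono (_ : wp _ (fun t'' ms'' => t'' <= t' + 30 /\ rg ms'' re = lower_end par b c) t' ms') _.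
    apply: (wp_if_val b3 (b := par b == c)).
    + have -> : (par b == c) = ((par b).+1 == c + 1 :> nat) by rewrite addn1 eqSS.
      apply: evs_eq; first by apply: (evs_A (i := b)); [exact: evs_R|exact: oP'].
      apply: evs_add; [exact: evs_R|apply: evs_K; nat_lia|].
      by move: (ltn_ord c); nat_lia.
    + move=> e; apply: (wp_set_val (v := b)); first exact: evs_R.
      by split; [cost_lia|rewrite /= upd_same /lower_end e].
    + move=> e; apply: (wp_set_val (v := c)); first exact: evs_R.
      by split; [cost_lia|rewrite /= upd_same /lower_end (negPf e)].
  move=> t2 ms2 F2 [le2 re2].
  have oS2 : slots_stored (pre r) ms2.
    by case: oS => h1 h2; split; [rewrite (F2.1 rm)|move=> d q ql; rewrite (F2.2 aSO) // /stored_list (F2.2 aSN) // (F2.2 aSV) //; apply: h2].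
  have cx2 : ctx ms2 by apply: ctx_fr F2 cx'.
  apply: (wp_for_var b3 (m := k)
    (D := fun i => 30 + (if insub i is Some j then if crossed j (lower_end par b c) then E else 0 else 0))
    (I := fun i ms' => slots_stored (pre r ++ f c (take i (enum 'I_k))) ms')) => //.
  + exact: (c_k cx2).
  + by rewrite take0 /f /= cats0.
  + move=> i0 t3 ms3 ik ro_i F3 oS3; pose i := Ordinal ik.
    have cx3 : ctx ms3 by apply: ctx_fr F3 cx2.
    have FF j : j \notin [:: aSO; aSN; aSV] -> ar ms3 j = ar ms j.
      rewrite !inE !negb_or => /and3P[n1 n2 n3].
      by rewrite F3.2 ?F2.2 ?F.2 //= !inE !negb_or ?n1 ?n2 ?n3.
    have fS : f c (take i0.+1 (enum 'I_k)) =
        if crossed i (lower_end par b c) then rcons (f c (take i0 (enum 'I_k))) (i, take M (slot_list (middle_of gd) i b c))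
        else f c (take i0 (enum 'I_k)).
      rewrite /f /slots_from (take_nth i) ?size_enum_ord // filter_rcons.
      have -> : nth i (enum 'I_k) i0 = i by exact: (nth_ord_enum i i).
      by case: ifP => // _; rewrite map_rcons.
    have fle i1 : size (f c (take i1 (enum 'I_k))) <= size (f c (enum 'I_k)).
      by rewrite /f /slots_from !size_map -{2}(cat_take_drop i1 (enum 'I_k)) filter_cat size_cat leq_addr.
    apply: wp_mono (wp_AddSlot _ cx3 _ _ _ rl erefl (b := b) (c := c) (r := r) (j := i) (gd := gd) _ _ _ _ oS3 _ _) _ => //.
    * by rewrite FF.
    * by rewrite /digits_stored !FF.
    * by rewrite FF.
    * by rewrite F3.1 // F2.1.
    * by rewrite F3.1.
    * by rewrite F3.1 // F2.1.
    * move=> cr; apply: leq_trans sizes; rewrite size_cat ltn_add2l.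
      by apply: leq_trans (fle i0.+1); rewrite fS cr size_rcons.
    * by rewrite all_cat pre_all all_slots_from.
    * move=> t4 ms4 _ [le4 oS4]; split.
        have -> : insub i0 = Some i by apply: (valK i).
        exact: le4.
      by move: oS4; rewrite fS; case: ifP => // _; rewrite rcons_cat.
  + move=> t3 ms3 F3 le3 oS3; split; last first.
      by rewrite preS // -/c -[enum 'I_k](take_oversize (n := k)) // size_enum_ord.
    have cnt : \sum_(i < k) (30 + (if insub (val i) is Some j then
         if crossed j (lower_end par b c) then E else 0 else 0) + 8) = 38 * k + size (f c (enum 'I_k)) * E.
      under eq_bigr do rewrite valK addnAC.
      rewrite big_split /= sum_nat_const card_ord [k * _]mulnC; congr (_ + _).
      rewrite -big_mkcond sum_nat_const /f /slots_from size_map; congr (_ * _).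
      by rewrite size_filter -sum1_count big_enum_cond -sum1_card; apply: eq_bigl.
    move: le3; rewrite cnt -/c => le3.
    by move: le2 le3; move: (size _ * E) => y; clear; lia.
- rewrite (nth_nbrs b) => t' ms' _ le oS; split; last first.
    by move: oS; rewrite /pre take_oversize // size_map.
  move: le; rewrite size_map -/cs big_split /= sum_nat_const card_ord.
  rewrite big_split /= sum_nat_const card_ord -big_distrl /=.
  have -> : \sum_(i < size cs) size (f (nth r0 cs i) (enum 'I_k)) = size (slots (middle_of gd) b).
    rewrite slotsE size_flatten /shape -map_comp sumnE big_map -/cs (big_nth r0) big_mkord.
    by [].
  have := size_slots_leq bg s t U PT Rt M (middle_of gd) b; rewrite -/cs cardE -/cs.
  rewrite -/E; move: (size (slots _ _)) (size cs) E => x y z h1 h2.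
  have h3 : x * z <= 3 * k * z by rewrite leq_mul2r h1 orbT.
  apply: leq_trans h2 _; rewrite /ecost /=.
  move: h3; move: (x * z) (3 * k * z) => u v; clear; nia.
Qed.

(** * The search in a bag *)

Definition pickE r := A aSV (O Add (O Mul (R r) (R rM)) (A aH (R r))).
Definition ownerEnd r e :=
  Or (O Eq e (sE (A aSO (R r)))) (O Eq e (tE (A aSO (R r)))).

(** The tests stop at the first digit beyond its list, as [pickE] would read a
    stale cell there. *)
Definition TestSlots :=
  CSet rgood (K 1) ;;;
  For rq rm
    (CIf (R rgood)
       (CIf (O Lt (A aH (R rq)) (A aSN (R rq)))
          (For rq2 rq
             (CIf (And (And (Not (O Eq (A aSO (R rq)) (A aSO (R rq2))))
                            (O Eq (pickE rq) (pickE rq2)))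
                       (Not (ownerEnd rq (pickE rq))))
                (CSet rgood (K 0)) CSkip))
          (CSet rgood (K 0)))
       CSkip) ;;;
  CIf (R rgood) (CSet rfound (K 1)) CSkip.

Definition test_slots_cost m := 50 + m * (100 + m * 300).

Lemma wp_TestSlots tm ms sl (h : nat -> nat) (x : bool) : ctx ms -> slots_stored sl ms ->
  size sl <= 3 * k -> all (fun e : 'I_k * seq 'I_n => size e.2 <= M) sl ->
  (forall q, q < size sl -> ar ms aH q = h q) -> rg ms rfound = x ->
  wp TestSlots (fun t' ms' => t' <= tm + test_slots_cost (size sl) /\
     rg ms' rfound = x || slots_test sl h) tm ms.
Proof.
move=> cx [oS1 oS2] sl3 slM hH hx; set m := size sl in sl3 hH oS1 oS2 *.
have mB : m < B by move: sl3; nat_lia.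
pose tn (q : 'I_m) := tnth (in_tuple sl) q.
have oS (q : 'I_m) : ar ms aSO q = (tn q).1 :> nat /\ stored_list aSN aSV ms q (map val (tn q).2).
  by rewrite /tn (tnth_nth (tn q)); apply: oS2 (ltn_ord q).
have tM (q : 'I_m) : size (tn q).2 <= M.
  by move/allP: slM; apply; apply: (mem_tnth q (in_tuple sl)).
pose fits (q : 'I_m) := h q < size (tn q).2.
pose P (q : 'I_m) := fits q && [forall q' : 'I_m, (q' < q) ==> ~~ slot_clash s t x0 h q q'].
apply: wp_seq; apply: (wp_set_val (v := 1)); first by apply: evs_K; nat_lia.
set ms0 := setr _ _ _.
have cx0 : ctx ms0 by case: cx => *; split.
have pickP ms' r (q : 'I_m) : ctx ms' -> rg ms' r = q -> ar ms' aSV = ar ms aSV -> ar ms' aH = ar ms aH ->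
   fits q -> evs ms' (pickE r) (choice x0 h q).
  move=> cx' hr e1 e2 fq; have hM : rg ms' rM = M := c_M cx'.
  have bnd : q * M + h q < B.
    by apply: (slot_idx); [apply: leq_trans (ltnW (ltn_ord q)) sl3|apply: leq_trans (ltnW fq) (tM q)].
  apply: (evs_A (i := q * M + h q)).
    apply: evs_add => //; last first.
      by apply: (evs_A (i := q)); [exact: evs_R|rewrite e2 hH].
    apply: evs_mul; [exact: evs_R|exact: evs_R|].
    by apply: leq_ltn_trans bnd; rewrite leq_addr.
  rewrite e1; case: (oS q) => _ [_ ->]; last by rewrite size_map.
  by rewrite (nth_map x0).
have ownP ms' r (q : 'I_m) : rg ms' r = q -> ar ms' aSO = ar ms aSO -> evs ms' (A aSO (R r)) (tn q).1.
  by move=> hr e1; apply: (evs_A (i := q)); [exact: evs_R|rewrite e1; case: (oS q)].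
apply: wp_seq.
apply: (wp_for_const b3 (m := m) (D := 60 + m * 300)
  (I := fun w ms' => rg ms' rgood = [forall q : 'I_m, (q < w) ==> P q])) => //.
- by rewrite forall_lt0.
- move=> q0 t1 ms1 qm rq_q F1 h1; pose q := Ordinal qm.
  have cx1 : ctx ms1 by apply: ctx_fr F1 cx0.
  apply: (wp_if_val b3 (b := [forall q : 'I_m, (q < q0) ==> P q])); first exact: evs_R.
  + move=> good.
    apply: (wp_if_val b3 (b := fits q)).
    * apply: evs_lt; apply: (evs_A (i := q)); try exact: evs_R.
      -- by rewrite (F1.2 aH) //= hH.
      -- by rewrite (F1.2 aSN) //=; case: (oS q) => _ [->]; rewrite size_map.
    * move=> fq.
      apply: (wp_for_const b3 (m := q0) (D := 280)
        (I := fun w ms' => rg ms' rgood = [forall q' : 'I_m, (q' < w) ==> ~~ slot_clash s t x0 h q q'])) => //.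
      -- by apply: ltn_trans mB.
      -- by rewrite h1 good forall_lt0.
      -- move=> q1 t2 ms2 q1q rq2_q F2 h2.
         pose q' := Ordinal (ltn_trans q1q qm).
         have cx2 : ctx ms2 by apply: ctx_fr F2 cx1.
         have fq' : fits q'.
           by move/forallP: good => /(_ q') /implyP /(_ q1q) /andP[].
         have AA j : j \notin [::] -> ar ms2 j = ar ms j.
           by move=> _; rewrite F2.2 // F1.2.
         have rq2' : rg ms2 rq = q by rewrite F2.1.
         have p1 : evs ms2 (pickE rq) (choice x0 h q) by apply: pickP; rewrite ?AA.
         have p2 : evs ms2 (pickE rq2) (choice x0 h q') by apply: pickP; rewrite ?AA.
         have o1 : evs ms2 (A aSO (R rq)) (tn q).1 by apply: ownP; rewrite ?AA.
         have o2 : evs ms2 (A aSO (R rq2)) (tn q').1 by apply: ownP; rewrite ?AA.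
         apply: (wp_if_val b3 (b := slot_clash s t x0 h q q')).
         ++ rewrite /slot_clash andbA; apply: (evs_and b3); first apply: (evs_and b3).
            ** by apply: (evs_not b3); apply: evs_eq.
            ** exact: evs_eq.
            ** apply: (evs_not b3); apply: (evs_or b3); apply: evs_eq => //.
               --- exact: (evs_s cx2).
               --- exact: (evs_t cx2).
         ++ move=> cl; apply: (wp_set_val (v := 0)); first by apply: evs_K; nat_lia.
            split; first by cost_lia.
            by rewrite /= upd_same (forall_ltS (ltn_trans q1q qm)) cl andbF.
         ++ move=> ncl; apply: wp_skip; split; first by cost_lia.
            by rewrite h2 (forall_ltS (ltn_trans q1q qm)) ncl andbT.
      -- move=> t2 ms2 F2 le2 h2; split.
           have h3 : q0 * 288 <= m * 288 by rewrite leq_mul2r ltnW ?orbT.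
           by move: le2 h3; rewrite /ecost /=; clear; lia.
         by rewrite h2 forall_ltS good /P fq.
    * move=> nf; apply: (wp_set_val (v := 0)); first by apply: evs_K; nat_lia.
      split; first by rewrite /ecost /=; clear; lia.
      by rewrite /= upd_same forall_ltS /P (negPf nf) andbF.
  + move=> ng; apply: wp_skip; split; first by rewrite /ecost /=; clear; lia.
    by rewrite h1 forall_ltS (negPf ng).
move=> t1 ms1 F1 le1 h1; rewrite forall_ltT in h1.
have -> : slots_test sl h = [forall q, P q] by [].
apply: (wp_if_val b3 (b := [forall q, P q])); first exact: evs_R.
- move=> al; apply: (wp_set_val (v := 1)); first by apply: evs_K; nat_lia.
  split; first by move: le1; rewrite /ecost /= /test_slots_cost; clear; nia.
  by rewrite /= upd_same al orbT.
- move=> nal; apply: wp_skip; split; first by move: le1; rewrite /ecost /= /test_slots_cost; clear; nia.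
  by rewrite (F1.1 rfound) //= upd_neq // hx (negPf nal) orbF.
Qed.

Definition CheckBag :=
  ListSlots ;;;
  CSet rfound (K 0) ;;;
  Odometer aH rm rM1 rii2 rcar2 rgo2 TestSlots ;;;
  CIf (R rfound) CSkip (CSet rval (K 0)).

Definition bag_ok gd b :=
  let sl := slots (middle_of gd) b in
  has (fun tau => slots_test sl (digit M tau)) (iota 0 (M ^ size sl)).

Definition bag_cost (b : 'I_p) :=
  150 + #|T b| * (100 + 38 * k) + 3 * k * (100 + fill_cost b) +
  60 * k + M ^ (3 * k) * (test_slots_cost (3 * k) + 16 + 3 * k * 48).

Lemma all_slots g b : all (fun e : 'I_k * seq 'I_n => size e.2 <= M) (slots g b).
Proof.
by apply/allP => -[j l] /slotsP[c _ ->]; rewrite /= size_take_min geq_minl.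
Qed.

Lemma wp_CheckBag tm ms gd (b : 'I_p) (x : bool) : ctx ms -> domain_array (ar ms aU) -> digits_stored gd ms ->
  crossing_array crossed (ar ms aX) -> parent_array par (ar ms aPAR) -> rg ms ra = b -> rg ms rM1 = M.-1 ->
  rg ms rval = x ->
  wp CheckBag (fun t' ms' => t' <= tm + bag_cost b /\ rg ms' rval = x && bag_ok gd b) tm ms.
Proof.
move=> cx oU og oX oP era eM1 ex; have M0 : M.-1.+1 = M by rewrite prednK // /M; nat_lia.
apply: wp_seq; apply: wp_mono (wp_ListSlots _ cx oU og oX oP era) _.
move=> t1 ms1 F1 [le1 oS1].
set sl := slots (middle_of gd) b in oS1 *.
have sl3 : size sl <= 3 * k by exact: (size_slots_leq bg s t U PT Rt).
have cx1 : ctx ms1 by apply: ctx_fr F1 cx.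
apply: wp_seq; apply: (wp_set_val (v := 0)); first by apply: evs_K; nat_lia.
set ms2 := setr _ _ _; have cx2 : ctx ms2 by case: cx1 => *; split.
have oS2 : slots_stored sl ms2 by exact: oS1.
have szB : size sl < B by move: sl3; nat_lia.
apply: wp_seq.
apply: (wp_Odometer b3 (rf := rfound) (len := size sl) (top := M.-1)
   (Db := test_slots_cost (size sl)) (test := fun tau => slots_test sl (digit M tau))) => //.
- by case: oS2.
- by rewrite /= upd_neq // (F1.1 rM1).
- by rewrite M0; apply: (M_ltB).
- rewrite M0 => tau t3 ms3 y lt F3 hd hf.
  have cx3 : ctx ms3 by apply: ctx_fr F3 cx2.
  apply: wp_TestSlots => //; last exact: all_slots.
  case: oS2 => o1 o2; split; first by rewrite (F3.1 rm).
  move=> d q ql; case: (o2 d q ql) => u1 [u2 u3].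
  by split; [rewrite (F3.2 aSO)|split; [rewrite (F3.2 aSN)|move=> r hr; rewrite (F3.2 aSV) // u3]].
- rewrite M0 => t3 ms3 F3 le3 hf.
  have rv3 : rg ms3 rval = x by rewrite (F3.1 rval) //= upd_neq // (F1.1 rval).
  have le4 : M ^ size sl * (test_slots_cost (size sl) + 16 + size sl * 48) <=
     M ^ (3 * k) * (test_slots_cost (3 * k) + 16 + 3 * k * 48).
    apply: leq_mul; first by rewrite leq_pexp2l // /M; nat_lia.
    by rewrite !leq_add // ?leq_mul2r ?sl3 ?orbT //; apply: leq_mul; rewrite ?leq_add // leq_mul2r sl3 orbT.
  have le5 : t3 + 10 <= tm + bag_cost b.
    rewrite /bag_cost; move: le1 le3 le4 sl3.
    move: (size sl) (#|T b| * _) (M ^ size sl * _) (M ^ (3 * k) * _) (3 * k * (100 + _)).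
    by move=> z1 z2 z3 z4 z5; rewrite /ecost /=; clear; lia.
  apply: (wp_if_val b3 (b := bag_ok gd b)).
  + by apply: evs_R; rewrite hf.
  + move=> ok; apply: wp_skip; split; first by move: le5; rewrite /ecost /=; clear; lia.
    by rewrite rv3 ok andbT.
  + move=> nok; apply: (wp_set_val (v := 0)); first by apply: evs_K; nat_lia.
    split; first by move: le5; rewrite /ecost /=; clear; lia.
    by rewrite /= upd_same (negPf nok) andbF.
Qed.

(** * The search for the middles *)

Definition directE x y :=
  And (Or (O Eq (sE (R x)) (tE (R x))) (adjE (sE (R x)) (tE (R x))))
      (Or (And (O Eq (sE (R x)) (sE (R y))) (O Eq (tE (R x)) (tE (R y))))
          (And (O Eq (sE (R x)) (tE (R y))) (O Eq (tE (R x)) (sE (R y))))).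

Definition TestMiddles :=
  CSet rval (K 1) ;;;
  For ri rk
    (CIf (R rval)
       (CIf (O Lt (A aCN (R ri)) (A aG (R ri))) (CSet rval (K 0))
          (For rq ri
             (CIf (O Eq (A aG (R ri)) (K 0))
                (CIf (And (O Eq (A aG (R rq)) (K 0)) (directE ri rq)) (CSet rval (K 0)) CSkip)
                (CIf (And (O Lt (K 0) (A aG (R rq))) (O Eq (chosen ri) (chosen rq)))
                   (CSet rval (K 0)) CSkip))))
       CSkip).

Lemma evs_direct ms x y (i j : 'I_k) : ctx ms -> rg ms x = i -> rg ms y = j ->
  evs ms (directE x y) (direct_clash i j).
Proof.
move=> cx hx hy.
have si : evs ms (sE (R x)) (s i) by apply: (evs_s cx); exact: evs_R.
have ti : evs ms (tE (R x)) (t i) by apply: (evs_t cx); exact: evs_R.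
have sj : evs ms (sE (R y)) (s j) by apply: (evs_s cx); exact: evs_R.
have tj : evs ms (tE (R y)) (t j) by apply: (evs_t cx); exact: evs_R.
have -> : direct_clash i j = ((s i == t i :> nat) || G (s i) (t i)) &&
    ((s i == s j :> nat) && (t i == t j :> nat) || (s i == t j :> nat) && (t i == s j :> nat)).
  by rewrite /direct_clash /long negb_and !negbK.
apply: (evs_and b3); first by apply: (evs_or b3); [exact: evs_eq|exact: evs_adj].
by apply: (evs_or b3); apply: (evs_and b3); exact: evs_eq.
Qed.

Definition middles_cost := 20 + k * (100 + k * 300).

Lemma wp_TestMiddles tm ms gd : ctx ms -> middle_lists ms -> (forall i : 'I_k, ar ms aG i = gd i) ->
  wp TestMiddles (fun t' ms' => t' <= tm + middles_cost /\ rg ms' rval = middles_test (fun i => gd i)) tm ms.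
Proof.
move=> cx oC oG.
apply: wp_seq; apply: (wp_set_val (v := 1)); first by apply: evs_K; nat_lia.
set ms0 := setr _ _ _; have cx0 : ctx ms0 by case: cx => *; split.
pose P (i : 'I_k) := (gd i <= size (candidates i)) && [forall j : 'I_k, (j < i) ==> ~~ clash (fun i => gd i) i j].
apply: (wp_for_const b3 (m := k) (D := 60 + k * 300)
  (I := fun w ms' => rg ms' rval = [forall i : 'I_k, (i < w) ==> P i])) => //.
- exact: (c_k cx0).
- by rewrite forall_lt0.
- move=> i0 t1 ms1 ik ri_i F1 h1; pose i := Ordinal ik.
  have cx1 : ctx ms1 by apply: ctx_fr F1 cx0.
  have vals ms' (j : 'I_k) : ar ms' aCV = ar ms aCV -> gd j <= size (candidates j) ->
      forall r, r < gd j -> ar ms' aCV (j * M + r) = nth x0 (candidates j) r.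
    move=> e le r rl; rewrite e; case: (oC j) => _ ->; last by rewrite size_map (leq_trans rl).
    by rewrite (nth_map x0) // (leq_trans rl).
  apply: (wp_if_val b3 (b := [forall i : 'I_k, (i < i0) ==> P i])); first exact: evs_R.
  + move=> good.
    apply: (wp_if_val b3 (b := size (candidates i) < gd i)).
    * apply: evs_lt; apply: (evs_A (i := i)); try exact: evs_R.
      -- by rewrite (F1.2 aCN) //=; case: (oC i) => ->; rewrite size_map.
      -- by rewrite (F1.2 aG) //; exact: oG.
    * move=> big; apply: (wp_set_val (v := 0)); first by apply: evs_K; nat_lia.
      split; first by rewrite /ecost /=; clear; lia.
      by rewrite /= upd_same forall_ltS /P leqNgt /= big andbF.
    * rewrite -leqNgt => gi.
      apply: (wp_for_const b3 (m := i0) (D := 280)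
        (I := fun w ms' => rg ms' rval = [forall j : 'I_k, (j < w) ==> ~~ clash (fun i => gd i) i j])) => //.
      -- by apply: ltn_trans kB.
      -- by rewrite h1 good forall_lt0.
      -- move=> j0 t2 ms2 ji rq_j F2 h2; have jk := ltn_trans ji ik; pose j := Ordinal jk.
         have cx2 : ctx ms2 by apply: ctx_fr F2 cx1.
         have gj : gd j <= size (candidates j).
           by move/forallP: good => /(_ j) /implyP /(_ ji) /andP[].
         have AA a : ar ms2 a = ar ms a by rewrite F2.2 // F1.2.
         have ri2 : rg ms2 ri = i by rewrite F2.1.
         have di : ar ms2 aG i = gd i by rewrite AA oG.
         have dj : ar ms2 aG j = gd j by rewrite AA oG.
         have ei : evs ms2 (A aG (R ri)) (gd i) by apply: (evs_A (i := i)); [exact: evs_R|].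
         have ej : evs ms2 (A aG (R rq)) (gd j) by apply: (evs_A (i := j)); [exact: evs_R|].
         have [ui [eui hui]] := evs_chosen cx2 (i := i) ri2 di gi (vals ms2 i (AA _) gi).
         have [uj [euj huj]] := evs_chosen cx2 (i := j) rq_j dj gj (vals ms2 j (AA _) gj).
         have K0 : evs ms2 (K 0) 0 by apply: evs_K; nat_lia.
         have yes t3 ms3 : clash (fun i => gd i) i j -> t3 <= t2 + 250 ->
            ar ms3 = ar ms2 -> wp (CSet rval (K 0)) (fun t'' ms'' => t'' <= t2 + 280 /\
              rg ms'' rval = [forall j : 'I_k, (j < j0.+1) ==> ~~ clash (fun i => gd i) i j]) t3 ms3.
           move=> cl le3 e3; apply: (wp_set_val (v := 0)); first by apply: evs_K; nat_lia.
           split; first by cost_lia.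
           by rewrite /= upd_same (forall_ltS jk) cl andbF.
         have no t3 : ~~ clash (fun i => gd i) i j -> t3 <= t2 + 250 ->
            wp CSkip (fun t'' ms'' => t'' <= t2 + 280 /\
              rg ms'' rval = [forall j : 'I_k, (j < j0.+1) ==> ~~ clash (fun i => gd i) i j]) t3 ms2.
           move=> ncl le3; apply: wp_skip; split; first by cost_lia.
           by rewrite h2 (forall_ltS jk) ncl andbT.
         apply: (wp_if_val b3 (b := gd i == 0)); first exact: evs_eq.
         ++ move=> z.
            have cE : clash (fun i => gd i) i j = (gd j == 0) && direct_clash i j.
              by rewrite /clash z.
            apply: (wp_if_val b3 (b := clash (fun i => gd i) i j)).
            ** rewrite cE; apply: (evs_and b3); first exact: evs_eq.
               exact: evs_direct.
            ** by move=> cl; apply: yes => //; cost_lia.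
            ** by move=> ncl; apply: no => //; cost_lia.
         ++ move=> z.
            have cE : clash (fun i => gd i) i j = (0 < gd j) && (ui == uj).
              rewrite /clash (negPf z) -lt0n; case: (posnP (gd j)) => //= g0.
              by rewrite hui ?lt0n // huj.
            apply: (wp_if_val b3 (b := clash (fun i => gd i) i j)).
            ** by rewrite cE; apply: (evs_and b3); [exact: evs_lt|exact: evs_eq].
            ** by move=> cl; apply: yes => //; cost_lia.
            ** by move=> ncl; apply: no => //; cost_lia.
      -- move=> t2 ms2 F2 le2 h2; split.
           have h3 : i0 * 288 <= k * 288 by rewrite leq_mul2r ltnW ?orbT.
           by move: le2 h3; rewrite /ecost /=; clear; lia.
         by rewrite h2 forall_ltS good /P gi.
  + move=> ng; apply: wp_skip; split; first by rewrite /ecost /=; clear; lia.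
    by rewrite h1 forall_ltS (negPf ng).
move=> t1 ms1 _ le1 h1; split.
  by move: le1; rewrite /ecost /= /middles_cost; clear; nia.
by rewrite h1 forall_ltT.
Qed.

Definition TestDigits :=
  TestMiddles ;;;
  For ra rp (CIf (R rval) CheckBag CSkip) ;;;
  CIf (R rval) (CSet rAns (K 1)) CSkip.

Definition digits_ok (gd : nat -> nat) := middles_test (fun i => gd i) && [forall b, bag_ok gd b].

Definition digits_cost := 50 + middles_cost + \sum_(b < p) (bag_cost b + 20).

Lemma wp_TestDigits tm ms (gd : nat -> nat) (x : bool) : ctx ms -> domain_array (ar ms aU) ->
  middle_lists ms -> crossing_array crossed (ar ms aX) -> parent_array par (ar ms aPAR) -> rg ms rM1 = M.-1 ->
  (forall i : 'I_k, ar ms aG i = gd i) -> rg ms rAns = x ->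
  wp TestDigits (fun t' ms' => t' <= tm + digits_cost /\ rg ms' rAns = x || digits_ok gd) tm ms.
Proof.
move=> cx oU oC oX oP eM1 oG ex.
apply: wp_seq; apply: wp_mono (wp_TestMiddles _ cx oC oG) _ => t1 ms1 F1 [le1 h1].
have cx1 : ctx ms1 by apply: ctx_fr F1 cx.
apply: wp_seq.
apply: (wp_for_var b3 (m := p)
  (D := fun i => 10 + (if insub i is Some b then bag_cost b else 0))
  (I := fun w ms' => rg ms' rval = middles_test (fun i => gd i) && [forall b : 'I_p, (b < w) ==> bag_ok gd b])) => //.
- exact: (c_p cx1).
- by rewrite forall_lt0 andbT.
- move=> b0 t2 ms2 bp ra_b F2 h2; pose b := Ordinal bp.
  have insE : insub b0 = Some b by apply: (valK b).
  rewrite insE.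
  have cx2 : ctx ms2 by apply: ctx_fr F2 cx1.
  have AA j : j \notin [:: aSO; aSN; aSV; aH] -> ar ms2 j = ar ms j.
    rewrite !inE !negb_or => /and4P[n1 n2 n3 n4].
    by rewrite F2.2 ?F1.2 //= !inE !negb_or ?n1 ?n2 ?n3 ?n4.
  apply: (wp_if_val b3 (b := middles_test (fun i => gd i) && [forall b : 'I_p, (b < b0) ==> bag_ok gd b])).
  + exact: evs_R.
  + move=> /andP[ot good].
    have og : digits_stored gd ms2.
      have gl (i : 'I_k) : gd i <= size (candidates i) by move/forallP: ot => /(_ i) /andP[].
      split=> [i|i|i r rl]; rewrite ?AA //.
      by case: (oC i) => _ ->; rewrite ?(nth_map x0) ?size_map // (leq_trans rl).
    have v2 : rg ms2 rval = true by rewrite h2 ot good.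
    apply: wp_mono (wp_CheckBag _ cx2 (gd := gd) (b := b) _ og _ _ ra_b _ v2) _.
    * by rewrite AA.
    * by rewrite AA.
    * by rewrite AA.
    * by rewrite F2.1 // F1.1.
    * move=> t3 ms3 _ [le3 h3]; split; first by move: le3; rewrite /ecost /=; clear; lia.
      by rewrite h3 ot (forall_ltS bp) good.
  + move=> ng; apply: wp_skip; split; first by rewrite /ecost /=; clear; lia.
    by rewrite h2 (forall_ltS bp) andbA (negPf ng).
move=> t2 ms2 F2 le2 h2; rewrite forall_ltT -/(digits_ok gd) in h2.
have le3 : t2 + 10 <= tm + digits_cost.
  move: le2 le1; rewrite /digits_cost.
  have -> : \sum_(i < p) (10 + (if insub (val i) is Some b then bag_cost b else 0) + 8) =
      \sum_(b < p) (bag_cost b + 18).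
    by apply: eq_bigr => b _; rewrite valK addnAC addnC.
  have : \sum_(b < p) (bag_cost b + 18) <= \sum_(b < p) (bag_cost b + 20).
    by apply: leq_sum => b _; rewrite leq_add2l.
  move: (\sum_(b < p) _) (\sum_(b < p) _) middles_cost => y1 y2 y3.
  by clear; lia.
apply: (wp_if_val b3 (b := digits_ok gd)); first exact: evs_R.
- move=> ok; apply: (wp_set_val (v := 1)); first by apply: evs_K; nat_lia.
  split; first by move: le3; rewrite /ecost /=; clear; lia.
  by rewrite /= upd_same ok orbT.
- move=> nok; apply: wp_skip; split; first by move: le3; rewrite /ecost /=; clear; lia.
  by rewrite F2.1 // F1.1 // ex (negPf nok) orbF.
Qed.

Lemma eq_middles_test (g1 g2 : 'I_k -> nat) : g1 =1 g2 -> middles_test g1 = middles_test g2.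
Proof.
move=> E; apply: eq_forallb => i; rewrite E; congr (_ && _).
by apply: eq_forallb => j; rewrite /clash !E.
Qed.

Lemma eq_slots_test sl (h1 h2 : nat -> nat) : (forall q, q < size sl -> h1 q = h2 q) ->
  slots_test sl h1 = slots_test sl h2.
Proof.
move=> E; apply: eq_forallb => q; rewrite E //; congr (_ && _).
apply: eq_forallb => q'; congr (_ ==> ~~ _).
by rewrite /slot_clash /choice !E.
Qed.

Lemma M_gt0 : 0 < M. Proof. by rewrite /M addn_gt0 orbT. Qed.

Lemma bag_okP gd b : reflect (exists h : nat -> nat, (forall q, h q < M) /\
    slots_test (slots (middle_of gd) b) h) (bag_ok gd b).
Proof.
apply: (iffP hasP) => [[tau _ ht]|[h [hM ht]]].
  by exists (digit M tau); split=> // q; apply: digit_lt M_gt0.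
have [tau lt hd] := digits_surj (size (slots (middle_of gd) b)) M_gt0 hM.
by exists tau; [rewrite mem_iota|rewrite (eq_slots_test (h2 := h))].
Qed.

(** What the two nested searches find is what [solution_digits] asks for. *)
Lemma digits_okP : terminals_ok s t U &&
    has (fun tau => digits_ok (digit M.+1 tau)) (iota 0 (M.+1 ^ k)) <->
  totally_disjoint_paths G s t U.
Proof.
have Mbig : 13 * k < M by rewrite /M; clear; lia.
rewrite (solution_digits s t U PT bgP Rt x0 Mbig); split.
- move=> /andP[tok /hasP[tau _ /andP[ot /forallP bo]]].
  exists (digit M.+1 tau); split=> //.
    by move=> i; rewrite -ltnS; apply: digit_lt.
  by move=> b; apply/bag_okP.
- move=> [gd [gM tok ot bo]]; rewrite tok /=; apply/hasP.
  have [tau lt hd] := digits_surj k (ltn0Sn M) gM.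
  exists tau; first by rewrite mem_iota.
  apply/andP; split.
    by rewrite (eq_middles_test (g2 := fun i => gd i)) // => i; apply: hd.
  apply/forallP => b; apply/bag_okP; case: (bo b) => h [h1 h2]; exists h; split=> //.
  rewrite (@eq_slots _ _ _ _ _ _ _ _ _ _ _ _ _ (middle_of gd)) // => i.
  by rewrite /middle_of hd.
Qed.

End Rooted.

(** * The program *)

Definition LoadConstants :=
  CSet rn (In (In (K 0))) ;;;
  CSet rp (In (O Add (In (K 0)) (K 1))) ;;;
  CSet rk (In (O Add (In (K 0)) (K 2))) ;;;
  CSet rM (O Add (O Mul (K 16) (R rk)) (K 16)) ;;;
  CSet rM1 (O Defs.Sub (R rM) (K 1)) ;;;
  CSet rAdj (In (K 1)) ;;; CSet rBag (In (K 2)) ;;; CSet rNbr (In (K 3)) ;;;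
  CSet rBnd (In (K 4)) ;;; CSet rS (In (K 5)) ;;; CSet rT (In (K 6)) ;;;
  CSet rU (In (K 7)).

Lemma wp_LoadConstants tm ms : wp LoadConstants (fun t' ms' =>
  [/\ t' <= tm + 100, ctx ms' & rg ms' rM1 = M.-1]) tm ms.
Proof.
have [h0 h1] := at_block (i := 0) isT.
have e0 i ms' : i < 3 -> evs ms' (O Add (In (K 0)) (K i)) (base 0 + i).
  move=> i3; move: (base_lt (i := 0) isT) => lb.
  apply: evs_add; [|apply: evs_K; nat_lia|nat_lia].
  by apply: (evs_In (a := 0)); [apply: evs_K; nat_lia|nat_lia|apply: inp_base].
have hb : base 0 + 3 <= N by exact: h0.
have eb i ms' : i < 8 -> evs ms' (In (K i)) (base i).
  by move=> i8; apply: (evs_In (a := i)); [apply: evs_K; nat_lia|nat_lia|apply: inp_base].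
apply: wp_seq; apply: (wp_set_val (v := n)).
  apply: (evs_In (a := base 0)); [exact: eb|nat_lia|].
  by rewrite -[base 0]addn0 h1.
apply: wp_seq; apply: (wp_set_val (v := p)).
  by apply: (evs_In (a := base 0 + 1)); [exact: e0|nat_lia|rewrite h1].
apply: wp_seq; apply: (wp_set_val (v := k)).
  by apply: (evs_In (a := base 0 + 2)); [exact: e0|nat_lia|rewrite h1].
apply: wp_seq; apply: (wp_set_val (v := M)).
  have MB := M_ltB; rewrite /M in MB *.
  apply: evs_add; [|apply: evs_K; nat_lia|exact: MB].
  by apply: evs_mul; [apply: evs_K; nat_lia|exact: evs_R|nat_lia].
apply: wp_seq; apply: (wp_set_val (v := M.-1)).
  by rewrite -subn1; apply: evs_sub; [exact: evs_R|apply: evs_K; nat_lia].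
do 6 (apply: wp_seq; apply: (wp_set_val (eb _ _ _)) => //).
apply: (wp_set_val (eb _ _ _)) => //.
by split; [rewrite /ecost /=; clear; lia|split|].
Qed.

Definition Solve :=
  LoadConstants ;;; MarkDomains ;;; LocateVertices ;;; RootTree ;;; MarkCrossings ;;; ListMiddles ;;; CheckTerminals ;;;
  CIf (R rok) (Odometer aG rk rM rii rcar rgo TestDigits) CSkip.

Definition solve_cost :=
  1000 + k * (62 + n * 40 + 8) + (40 * p + n * 25) + 200 * p + k * (150 + p * 160) +
  k * (100 + n * (150 + k * 100)) + k * 100 + 20 * k +
  M.+1 ^ k * (digits_cost + 16 + k * 48).

Lemma wp_Solve ms : (forall j i, ar ms j i = 0) -> rg ms rAns = 0 ->
  wp Solve (fun t' ms' => [/\ t' <= solve_cost, \sum_(b < p) #|T b| <= 2 * p &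
     exists2 ans : bool, rg ms' rAns = ans & (ans <-> totally_disjoint_paths G s t U)]) 0 ms.
Proof.
move=> z a0.
apply: wp_seq; apply: wp_mono (wp_LoadConstants _ _) _ => t1 ms1 F1 [le1 cx1 m1].
apply: wp_seq; apply: wp_mono (wp_MarkDomains _ cx1 _) _ => [i|t2 ms2 F2 [le2 oU]].
  by rewrite F1.2.
have cx2 : ctx ms2 by apply: ctx_fr F2 cx1.
apply: wp_seq; apply: wp_mono (wp_LocateVertices _ cx2) _ => t3 ms3 F3 [le3 oB].
have cx3 : ctx ms3 by apply: ctx_fr F3 cx2.
apply: wp_seq; apply: wp_mono (wp_RootTree _ cx3 _ _) _ => [i|i|t4 ms4 F4 [par [dep [le4 Rt oP]]]].
- by rewrite F3.2 // F2.2 // F1.2.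
- by rewrite F3.2 // F2.2 // F1.2.
have cx4 : ctx ms4 by apply: ctx_fr F4 cx3.
apply: wp_seq; apply: wp_mono (wp_MarkCrossings Rt _ cx4 oP _ _) _ => [|i|t5 ms5 F5 [le5 oX]].
- by rewrite F4.2.
- by rewrite F4.2 // F3.2 // F2.2 // F1.2.
have cx5 : ctx ms5 by apply: ctx_fr F5 cx4.
apply: wp_seq; apply: wp_mono (wp_ListMiddles _ cx5 _ _ _) _ => [|i|i|t6 ms6 F6 [le6 oC]].
- by rewrite F5.2 // F4.2 // F3.2.
- by rewrite F5.2 // F4.2 // F3.2 // F2.2 // F1.2.
- by rewrite F5.2 // F4.2 // F3.2 // F2.2 // F1.2.
have cx6 : ctx ms6 by apply: ctx_fr F6 cx5.
apply: wp_seq; apply: wp_mono (wp_CheckTerminals _ cx6 _) _ => [|t7 ms7 F7 [le7 hok]].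
  by rewrite F6.2 // F5.2 // F4.2 // F3.2.
have cx7 : ctx ms7 by apply: ctx_fr F7 cx6.
have a7 : rg ms7 rAns = 0.
  by rewrite F7.1 // F6.1 // F5.1 // F4.1 // F3.1 // F2.1 // F1.1.
have le8 : t7 + 100 + 20 * k + M.+1 ^ k * (digits_cost + 16 + k * 48) <= solve_cost.
  move: le1 le2 le3 le4 le5 le6 le7; rewrite /solve_cost.
  by move: (M.+1 ^ k * _) => y; clear; lia.
have deg2 : \sum_(b < p) #|T b| <= 2 * p by have := sum_degrees Tac Rt; rewrite card_ord.
apply: (wp_if_val b3 (b := terminals_ok s t U)); first exact: evs_R.
- move=> tok; apply: (wp_Odometer b3 (rf := rAns) (len := k) (top := M) (Db := digits_cost)
    (test := fun tau => digits_ok par (digit M.+1 tau))) => //.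
  + exact: (c_k cx7).
  + exact: (c_M cx7).
  + by rewrite /M; nat_lia.
  + move=> tau t8 ms8 x lt F8 hd hx.
    have cx8 : ctx ms8 by apply: ctx_fr F8 cx7.
    apply: (wp_TestDigits Rt) => //.
    * by rewrite F8.2 // F7.2 // F6.2 // F5.2 // F4.2 // F3.2.
    * by move=> i; apply: (stored_list_fr F8) => //; apply: (stored_list_fr F7).
    * by rewrite F8.2 // F7.2 // F6.2.
    * by rewrite F8.2 // F7.2 // F6.2 // F5.2.
    * by rewrite F8.1 // F7.1 // F6.1 // F5.1 // F4.1 // F3.1 // F2.1.
    * by move=> i; apply: hd.
  + move=> t8 ms8 _ le9 h8; split=> //.
      move: le8 le9; rewrite /ecost /=; move: (M.+1 ^ k * _) => y; clear; lia.
    exists (terminals_ok s t U && has (fun tau => digits_ok par (digit M.+1 tau)) (iota 0 (M.+1 ^ k))).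
      by rewrite tok.
    exact: (digits_okP Rt).
- move=> ntok; apply: wp_skip; split=> //; first by move: le8; rewrite /ecost /=; clear; lia.
  exists (terminals_ok s t U && has (fun tau => digits_ok par (digit M.+1 tau)) (iota 0 (M.+1 ^ k))).
    by rewrite (negPf ntok).
  exact: (digits_okP Rt).
Qed.

End Instance.

(** * Running time *)

Lemma leq_exp_base a b e : a <= b -> a ^ e <= b ^ e.
Proof. by case: e => // e h; rewrite leq_exp2r. Qed.

Lemma Z_bound k : 16 * k + 17 <= 2 ^ (trunc_log 2 k + 6).
Proof.
have h : k.+1 <= 2 ^ (trunc_log 2 k).+1 by apply: trunc_log_ltn.
apply: (@leq_trans (32 * k.+1)); first by clear; lia.
have -> : 2 ^ (trunc_log 2 k + 6) = 32 * 2 ^ (trunc_log 2 k).+1.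
  by rewrite -(expnD 2 5) addSn addnC.
by rewrite leq_mul2l h orbT.
Qed.

(** The exponent of [Z ^ (4 k + 6)] after writing [Z] as a power of 2. *)
Definition fexp k := (trunc_log 2 k + 6) * (4 * k + 6).

Lemma fexp_bound k : 2 <= k -> fexp k <= 49 * (k * trunc_log 2 k).
Proof.
move=> k2; have : 1 <= trunc_log 2 k by apply: trunc_log_max.
rewrite /fexp; move: (trunc_log 2 k) => L L1.
apply: (@leq_trans ((7 * L) * (7 * k))); last by rewrite mulnACA [L * k]mulnC.
by apply: leq_mul; nat_lia.
Qed.

Section Cost.
Variables (n p k : nat) (bag : 'I_p -> {set 'I_n}) (T : sgraph 'I_p).
Hypothesis n_pos : 0 < n.
Hypothesis p_le : p <= n.
Hypothesis sum_bag : \sum_(a < p) #|bag a| = n.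
Hypothesis sum_deg : \sum_(a < p) #|T a| <= 2 * p.

Let Z := 16 * k + 17.

(** The outer search makes [Z ^ k] rounds and the search in a bag at most
    [Z ^ (3 k)]; the remaining factors are polynomial in [k] and absorbed by six
    more factors [Z]. *)
Lemma solve_cost_bound : solve_cost k bag T + 10 <= n * Z ^ (4 * k + 6).
Proof.
have Z17 : 17 <= Z by rewrite /Z leq_addl.
have Zpow a b : a <= b -> Z ^ a <= Z ^ b by move=> ab; rewrite leq_pexp2l //; nat_lia.
have Z3 : 2720 * (k * k) + 1200 * (k * k) + 4800 * k + 4000 <= Z ^ 3.
  by rewrite /Z !expnS expn0 muln1; clear; nia.
have Zs a : 2 * Z ^ a <= Z ^ a.+1.
  by rewrite expnS leq_mul2r (leq_trans _ Z17) ?orbT.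
have MZ : (M k).+1 = Z by rewrite /M /Z; nat_lia.
have kk : k <= k * k by case: (k) => // k'; rewrite leq_pmulr.
pose W := M k ^ (3 * k) * (test_slots_cost (3 * k) + 16 + 3 * k * 48).
have WZ : W <= Z ^ (3 * k + 3).
  rewrite /W expnD; apply: leq_mul; first by apply: leq_exp_base; rewrite -MZ.
  by apply: leq_trans Z3; rewrite /test_slots_cost; clear; nia.
have bagsum : \sum_(b < p) (bag_cost k bag T b + 20) <= n * Z ^ (3 * k + 4).
  have -> : \sum_(b < p) (bag_cost k bag T b + 20) =
     \sum_(b < p) (170 + 300 * k + 60 * k + W) + \sum_(b < p) #|T b| * (100 + 38 * k)
      + \sum_(b < p) #|bag b| * (3 * k * (200 + k * 100)).
    rewrite -!big_split; apply: eq_bigr => b _.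
    rewrite /bag_cost -/W /fill_cost; move: #|T b| #|bag b| (W) => x y z /=; clear; nia.
  rewrite -!big_distrl /= sum_bag sum_nat_const card_ord.
  apply: (@leq_trans (n * (170 + 300 * k + 60 * k + W) + 2 * n * (100 + 38 * k) +
     n * (3 * k * (200 + k * 100)))).
    apply: leq_add => //; apply: leq_add; first by rewrite leq_mul2r p_le orbT.
    by rewrite leq_mul2r (leq_trans sum_deg) ?orbT // leq_mul2l p_le orbT.
  have -> : n * (170 + 300 * k + 60 * k + W) + 2 * n * (100 + 38 * k) +
     n * (3 * k * (200 + k * 100)) =
    n * (170 + 300 * k + 60 * k + W + 2 * (100 + 38 * k) + 3 * k * (200 + k * 100)).
    by move: (W) => w; clear; nia.
  rewrite leq_mul2l; apply/orP; right.
  apply: (@leq_trans (Z ^ 3 + Z ^ (3 * k + 3))).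
    by move: Z3 WZ kk; move: (Z ^ 3) (W) (Z ^ _) => z3 w z; clear; nia.
  apply: (@leq_trans (2 * Z ^ (3 * k + 3))).
    have := Zpow 3 (3 * k + 3) (leq_addl _ _); clear; lia.
  by rewrite [3 * k + 4]addnS.
have outer : digits_cost k bag T + 16 + k * 48 <= n * Z ^ (3 * k + 5).
  apply: (@leq_trans (n * Z ^ 3 + n * Z ^ (3 * k + 4))).
    rewrite /digits_cost; apply: (@leq_trans (n * Z ^ 3 + \sum_(b < p) (bag_cost k bag T b + 20))); last by rewrite leq_add2l.
    have : Z ^ 3 <= n * Z ^ 3 by rewrite leq_pmull.
    by move: Z3; rewrite /middles_cost; move: (Z ^ 3) (\sum_(b < p) _) (n * _) => z3 y z; clear; nia.
  rewrite -mulnDr leq_mul2l; apply/orP; right.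
  apply: (@leq_trans (2 * Z ^ (3 * k + 4))).
    have := Zpow 3 (3 * k + 4) (leq_trans (isT : 3 <= 4) (leq_addl _ _)); clear; lia.
  by rewrite [3 * k + 5]addnS.
have search : (M k).+1 ^ k * (digits_cost k bag T + 16 + k * 48) <= n * Z ^ (4 * k + 5).
  rewrite MZ; apply: (@leq_trans (Z ^ k * (n * Z ^ (3 * k + 5)))); first by rewrite leq_mul2l outer orbT.
  rewrite mulnCA -expnD leq_mul2l; apply/orP; right; apply: Zpow; clear; lia.
apply: (@leq_trans (n * Z ^ 3 + n * Z ^ (4 * k + 5))).
  rewrite /solve_cost; move: search.
  move: (_ ^ k * _) (n * Z ^ (4 * k + 5)) => x y xy.
  have pk : k * (p * 160) <= k * (n * 160) by rewrite leq_mul2l leq_mul2r p_le !orbT.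
  have n1 : 1010 + k * 300 + k * 100 <= n * (1010 + k * 300 + k * 100) by rewrite leq_pmull.
  have l3 : n * (1000 + 1010 + k * 2000 + k * k * 100) <= n * Z ^ 3.
    by rewrite leq_mul2l; apply/orP; right; apply: leq_trans Z3; move: kk; clear; nia.
  apply: (@leq_trans (n * (1000 + 1010 + k * 2000 + k * k * 100) + y)); last by rewrite leq_add2r.
  move: xy n1 pk p_le; clear; nia.
rewrite -mulnDr leq_mul2l; apply/orP; right.
apply: (@leq_trans (2 * Z ^ (4 * k + 5))).
  have := Zpow 3 (4 * k + 5) (leq_trans (isT : 3 <= 5) (leq_addl _ _)); clear; lia.
by rewrite [4 * k + 6]addnS.
Qed.

Lemma solve_cost_exp : solve_cost k bag T + 10 <= 2 ^ fexp k * n.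
Proof.
apply: leq_trans solve_cost_bound _; rewrite mulnC leq_mul2r; apply/orP; right.
rewrite /fexp expnM; apply: leq_exp_base; exact: Z_bound.
Qed.

End Cost.

Theorem theorem5p9 :
  exists (prog : cmd) (f : nat -> nat) (c d : nat),
    (* f(k) = O(k log k) *)
    (forall k : nat, 2 <= k -> f k <= c * (k * trunc_log 2 k)) /\
    forall (n p : nat) (G : sgraph 'I_n) (bag : 'I_p -> {set 'I_n})
           (T : sgraph 'I_p),
      well_partitioned_chordal G ->
      partition_tree G bag T ->
      forall (k : nat) (s t : 'I_k -> 'I_n) (U : 'I_k -> {set 'I_n}) (w : nat),
        (* words of at least d * log (input length) bits *)
        size (encode G bag T s t U) ^ d <= 2 ^ w ->
        exists (final : state) (time : nat) (answer : bool),
          [/\ exec w prog (init (encode G bag T s t U)) time final,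
              time <= 2 ^ f k * n,
              regs final 0 = answer
            & answer <-> totally_disjoint_paths G s t U].
Proof.
(* The table of the 8 blocks of the input ends with the length of the input.
   The exponent 6 makes room for addresses up to [16 * N ^ 4 + N + 15]. *)
exists (Seq (Assign rN (Read (Const 8))) (compile Solve)), fexp, 49, 6.
split; first exact: fexp_bound.
move=> n p G bag T [[n_pos0 _] _] PT k s t U w hw.
have n_pos : 0 < n by rewrite card_ord in n_pos0.
pose x0 := Ordinal n_pos.
have [[_ /and3P[/eqP cov triv n0]] [[p_pos0 conn] acy] _ _ _] := PT.
have p_pos : 0 < p by rewrite card_ord in p_pos0.
pose r0 := Ordinal p_pos.
have ex_bg v : exists a, forall b, (v \in bag b) = (b == a).
  have : v \in cover [set bag a | a : 'I_p] by rewrite cov inE.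
  move=> /bigcupP[A /imsetP[a _ ->] va]; exists a => b.
  have [[inj _] _ _ _ _] := PT.
  apply/idP/eqP => [vb|->//]; apply: inj.
  apply: contraTeq vb => nab.
  have := trivIsetP triv _ _ (imset_f bag (isT : b \in 'I_p)) (imset_f bag (isT : a \in 'I_p)) nab.
  by rewrite disjoint_sym => /disjointFr -> //.
have [bg bgP0] := fin_all_exists ex_bg.
have bgP v a : (v \in bag a) = (a == bg v) by apply: bgP0.
have p_le : p <= n.
  have surj a : exists v, bg v = a.
    have : bag a != set0.
      apply: contraNneq n0 => <-; exact: imset_f.
    by case/set0Pn => v; rewrite bgP => /eqP ->; exists v.
  have [g gP] := fin_all_exists surj.
  have gi : injective g by move=> a b E; rewrite -(gP a) -(gP b) E.
  have := max_card (mem (codom g)); rewrite card_codom // !card_ord.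
  by [].
set N := size _ in hw.
have N9 : 9 < N := N_gt9 G bag T s t U.
have NB : N + 16 * B G bag T s t U + 16 <= 2 ^ w.
  apply: leq_trans hw; change (N + 16 * N ^ 4 + 16 <= N ^ 6); rewrite (expnD N 2 4).
  have N4 : N <= N ^ 4 by rewrite -{1}(expn1 N) leq_pexp2l // ltnW // (leq_trans _ N9).
  have N2 : 100 <= N ^ 2 by apply: (@leq_trans (10 ^ 2)) => //; apply: leq_exp_base.
  apply: (@leq_trans (100 * N ^ 4)); last by rewrite leq_mul2r N2 orbT.
  by move: N4 N9; move: (N ^ 4) (N) => y z; clear; lia.
have B1 : 1 < B G bag T s t U := ltnW (B3 G bag T s t U).
pose ms0 := MSt (upd (fun=> 0) rN N) (fun _ _ => 0).
have S0 : sim N (B G bag T s t U) (inp G bag T s t U) ms0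
    (State [eta regs (init (encode G bag T s t U)) with rN |-> N] (nth 0 (encode G bag T s t U))).
  split=> //=.
  - by move=> x; rewrite updE eq_sym.
  - by move=> j i hj hi; rewrite nth_default // leq_addr.
  - split=> [x|j i] /=; last by apply: ltnW.
    by rewrite updE; case: ifP => _; [apply: leq_ltn_trans (N_B G bag T s t U); apply: leq_pmull|apply: ltnW].
have [t1 [ms1 [r1 [le1 deg2 [ans a1 a2]]]]] := wp_Solve s t U x0 PT bgP (erefl : val r0 = 0) (ms := ms0) (fun _ _ => erefl) erefl.
have [st1 e1 S1] := run_exec B1 NB (@inp_B n p k G bag T s t U) r1 isT S0.
exists st1, (3 + t1), ans; split=> //.
- apply: ExecSeq e1.
  have -> : 3 = (cost (Read (Const 8))).+1 by [].
  have eN : eval w (init (encode G bag T s t U)) (Read (Const 8)) = N.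
    rewrite /= modn_small; first exact: inp_N.
    by apply: leq_trans NB; apply: leq_trans (leq_addl _ _).
  rewrite -eN; exact: ExecAssign.
- apply: leq_trans (solve_cost_exp (bag := bag) (T := T) k n_pos p_le _ _).
  + by rewrite add0n in le1; nat_lia.
  + exact: sum_bags bgP.
  + exact: deg2.
- by rewrite (sim_rg S1).
Qed.
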